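(* Let $k$ be a field of characteristic $0$ and let $X\subset\mathbb{P}^3_k$ be a smooth cubic surface. Then the varieties $\mathrm{Sym}^6(X)$ and $\mathrm{Sym}^3(X)$ are stably birational over $k$.
   Context: $\mathrm{Sym}^m(X)$ denotes the $m$-th symmetric product of $X$ over $k$, i.e. the quotient of $X^m$ by the symmetric group $S_m$. Two $k$-varieties $Y,Z$ are stably birational if $Y\times_k\mathbb{P}^a_k$ and $Z\times_k\mathbb{P}^b_k$ are birational over $k$ for some integers $a,b\ge 0$. *)

(* Defs.v *)
From HB Require Import structures.
From mathcomp Require Import all_boot all_order fingroup perm all_algebra.
From mathcomp Require Import mpoly.

Set Implicit Arguments.
Unset Strict Implicit.
Unset Printing Implicit Defensive.

Import GRing.Theory.
Local Open Scope ring_scope.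
Local Open Scope quotient_scope.

(* A variety over a field k of characteristic 0 is represented by its points
   over an algebraic closure K of k, with its k-Zariski topology and, for each
   k-open set U, the K-valued functions on U that are regular and defined over
   k (a "space with functions").  [regular U f] is meaningful when U is open
   and only depends on the values of f on U.  The record contains the data
   only: the axioms hold for the spaces built below, and the definitions of
   morphisms and birationality do not need them as fields. *)
Record kspace (K : Type) := KSpace {
  points : choiceType;
  opens : (points -> Prop) -> Prop;
  regular : (points -> Prop) -> (points -> K) -> Prop
}.
Arguments opens {K} X U : rename.
Arguments regular {K} X U f : rename.
Coercion points : kspace >-> choiceType.

Definition is_algebraic_closure (k : fieldType) (K : closedFieldType)
    (iota : {rmorphism k -> K}) : Prop :=
  forall x : K, algebraicOver iota x.

(* The space whose topology is generated by the sets {x in V | h x <> 0} and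
   whose regular functions are locally of the form g / h, for [frac V g h]. *)
Section Fractions.
Variables (K : fieldType) (T : choiceType).
Variable frac : (T -> Prop) -> (T -> K) -> (T -> K) -> Prop.

Definition frac_open (U : T -> Prop) : Prop :=
  forall x, U x -> exists V g h,
    [/\ frac V g h, V x, h x != 0 & forall y, V y -> h y != 0 -> U y].

Definition frac_regular (U : T -> Prop) (f : T -> K) : Prop :=
  forall x, U x -> exists V g h,
    [/\ frac V g h, V x, h x != 0
      & forall y, U y -> V y -> h y != 0 -> f y = g y / h y].

Definition frac_space : kspace K := KSpace frac_open frac_regular.
End Fractions.

Section ProjectiveSpace.
Variables (k K : fieldType) (iota : {rmorphism k -> K}) (n : nat).

Definition nzvec := {v : 'rV[K]_n.+1 | v != 0}.

(* Equality of the lines spanned by v and w. *)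
Definition proportional : rel nzvec := fun v w => (val v == val w)%MS.

Lemma proportional_refl : reflexive proportional.
Proof. by move=> v; rewrite /proportional submx_refl. Qed.

Lemma proportional_sym : ssrbool.symmetric proportional.
Proof. by move=> v w; rewrite /proportional andbC. Qed.

Lemma proportional_trans : transitive proportional.
Proof.
move=> v u w /andP[uv vu] /andP[vw wv]; apply/andP; split.
  exact: submx_trans vw.
exact: submx_trans vu.
Qed.

Canonical proportional_equiv : equiv_rel nzvec :=
  EquivRel proportional proportional_refl proportional_sym proportional_trans.

Definition proj_point := {eq_quot proportional}.
HB.instance Definition _ := Choice.on proj_point.

Definition evalv (p : {mpoly k[n.+1]}) (v : 'rV[K]_n.+1) : K :=
  (map_mpoly iota p).@[fun i => v 0 i].

Definition evalp (p : {mpoly k[n.+1]}) (x : proj_point) : K :=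
  evalv p (val (generic_quotient.repr x)).

Definition proj_frac (V : proj_point -> Prop) (g h : proj_point -> K) : Prop :=
  (forall x, V x) /\ exists (d : nat) (p q : {mpoly k[n.+1]}),
    [/\ p \is d.-homog, q \is d.-homog, g =1 evalp p & h =1 evalp q].

Definition proj_space : kspace K := frac_space proj_frac.
End ProjectiveSpace.

Section Subspace.
Variables (K : fieldType) (X : kspace K) (Z : pred X).

Definition sub_open (W : {x : X | Z x} -> Prop) : Prop :=
  exists2 U, opens X U & forall x, W x <-> U (val x).

Definition sub_regular (W : {x : X | Z x} -> Prop) (f : {x : X | Z x} -> K) :
    Prop :=
  forall x, W x -> exists U g,
    [/\ opens X U, regular X U g, U (val x)
      & forall y, W y -> U (val y) -> f y = g (val y)].

Definition subspace : kspace K := KSpace sub_open sub_regular.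
End Subspace.

(* Products: the regular functions are locally fractions of elements of the
   tensor product of the algebras of regular functions on the factors. *)
Section Products.
Variable K : fieldType.

Definition prod_tensor (X Y : kspace K) (U : X -> Prop) (V : Y -> Prop)
    (g : (X * Y)%type -> K) : Prop :=
  exists (r : nat) (a : 'I_r -> X -> K) (b : 'I_r -> Y -> K),
    [/\ forall j, regular X U (a j), forall j, regular Y V (b j)
      & forall x y, g (x, y) = \sum_(j < r) a j x * b j y].

Definition prod_frac (X Y : kspace K) (W : (X * Y)%type -> Prop)
    (g h : (X * Y)%type -> K) : Prop :=
  exists U V, [/\ opens X U, opens Y V, forall z, W z <-> U z.1 /\ V z.2,
    prod_tensor U V g & prod_tensor U V h].

Definition prod_space (X Y : kspace K) : kspace K :=
  frac_space (@prod_frac X Y).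

Definition power_tensor (X : kspace K) (m : nat) (U : 'I_m -> X -> Prop)
    (g : {ffun 'I_m -> X} -> K) : Prop :=
  exists (r : nat) (a : 'I_r -> 'I_m -> X -> K),
    (forall j i, regular X (U i) (a j i)) /\
    (forall x, g x = \sum_(j < r) \prod_(i < m) a j i (x i)).

Definition power_frac (X : kspace K) (m : nat) (W : {ffun 'I_m -> X} -> Prop)
    (g h : {ffun 'I_m -> X} -> K) : Prop :=
  exists U : 'I_m -> X -> Prop,
    [/\ forall i, opens X (U i), forall x, W x <-> forall i, U i (x i),
      power_tensor U g & power_tensor U h].

Definition power_space (X : kspace K) (m : nat) : kspace K :=
  frac_space (@power_frac X m).
End Products.

Section Quotient.
Variables (K : fieldType) (X : kspace K) (e : equiv_rel X).

Definition quot_open (U : {eq_quot e} -> Prop) : Prop :=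
  opens X (fun x => U (\pi_({eq_quot e}) x)).

Definition quot_regular (U : {eq_quot e} -> Prop) (f : {eq_quot e} -> K) :
    Prop :=
  regular X (fun x => U (\pi_({eq_quot e}) x))
            (fun x => f (\pi_({eq_quot e}) x)).

Definition quot_space : kspace K := KSpace quot_open quot_regular.
End Quotient.

Section SymmetricProduct.
Variables (K : fieldType) (X : kspace K) (m : nat).

Definition perm_ffun (s : 'S_m) (x : {ffun 'I_m -> X}) : {ffun 'I_m -> X} :=
  [ffun i => x (s i)].

Definition same_orbit : rel (power_space X m) :=
  fun x y => [exists s : 'S_m, y == perm_ffun s x].

Lemma same_orbit_refl : reflexive same_orbit.
Proof.
by move=> x; apply/existsP; exists 1%g; apply/eqP/ffunP=> i; rewrite ffunE perm1.
Qed.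

Lemma same_orbit_sym : ssrbool.symmetric same_orbit.
Proof.
suff imp x y : same_orbit x y -> same_orbit y x.
  by move=> x y; apply/idP/idP; apply: imp.
case/existsP=> s /eqP->; apply/existsP; exists (s^-1)%g.
by apply/eqP/ffunP=> i; rewrite !ffunE permKV.
Qed.

Lemma same_orbit_trans : transitive same_orbit.
Proof.
move=> y x z /existsP[s /eqP->] /existsP[t /eqP->]; apply/existsP.
by exists (t * s)%g; apply/eqP/ffunP=> i; rewrite !ffunE permM.
Qed.

Canonical same_orbit_equiv : equiv_rel (power_space X m) :=
  EquivRel same_orbit same_orbit_refl same_orbit_sym same_orbit_trans.

Definition sym_product : kspace K := quot_space same_orbit_equiv.
End SymmetricProduct.

Section Birational.
Variable K : fieldType.

Definition dense_open (X : kspace K) (U : X -> Prop) : Prop :=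
  opens X U /\
  forall W, opens X W -> (exists x, W x) -> exists x, U x /\ W x.

(* [phi] restricts to a morphism from the open subset U of X to Y; its values
   outside U are irrelevant. *)
Definition morphism_on (X Y : kspace K) (U : X -> Prop) (phi : X -> Y) : Prop :=
  forall W, opens Y W ->
    opens X (fun x => U x /\ W (phi x)) /\
    forall f, regular Y W f ->
      regular X (fun x => U x /\ W (phi x)) (fun x => f (phi x)).

Definition birational (X Y : kspace K) : Prop :=
  exists (U : X -> Prop) (V : Y -> Prop) (phi : X -> Y) (psi : Y -> X),
    [/\ dense_open U /\ dense_open V,
        morphism_on U phi /\ morphism_on V psi,
        forall x, U x -> V (phi x) /\ psi (phi x) = x
      & forall y, V y -> U (psi y) /\ phi (psi y) = y].
End Birational.

Definition stably_birational (k K : fieldType) (iota : {rmorphism k -> K})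
    (X Y : kspace K) : Prop :=
  exists a b : nat, birational (prod_space X (proj_space iota a))
                               (prod_space Y (proj_space iota b)).

Section Hypersurface.
Variables (k K : fieldType) (iota : {rmorphism k -> K}) (n : nat).
Variable F : {mpoly k[n.+1]}.

(* For F homogeneous, evaluation at a representative vector decides whether a
   point of projective space lies on the hypersurface. *)
Definition hypersurface : kspace K :=
  subspace (X := proj_space iota n) (fun x => evalp iota F x == 0).

(* Smoothness over k by the Jacobian criterion, at all points over the
   algebraic closure. *)
Definition smooth_hypersurface : Prop :=
  forall v : 'rV[K]_n.+1, v != 0 -> evalv iota F v = 0 ->
    exists i : 'I_n.+1, evalv iota (F^`M(i)) v != 0.
End Hypersurface.

(* Main.v *)
(* A map w : P^1 -> P^3 given by cubic forms pulls F back to a form of degree 9.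
   Let W_m be the space of pairs of such a w and a factor of degree m of this
   form.  Taking the residual factor identifies dense opens of W_6 and W_3, so it
   suffices that W_m is birational to Sym^m(X) x P^n, with n = 4 for m = 6 and
   n = 10 for m = 3.

   In suitable coordinates and by Lagrange interpolation, a curve through the
   points v_i (normalised by v_i0 = 1) with parameters t_i is determined by the
   weights a_i, by b_i = a_i t_i and, for m = 3, by its leading coefficient.  For
   m = 3 the weights are arbitrary; for m = 6 the curve is cubic if and only if
   sum_i a_i v_i = sum_i b_i v_i = 0.  The pairs (a, b) form a vector bundle over
   Sym^m(X), which is trivialised by y_j = sum_i a_i g_j(v_i) and
   z_j = sum_i b_i g_j(v_i) for suitable quadrics g_1, ..., g_m: the first four
   are x_0 x_l when m = 6, so that the linear conditions say that the first four
   of the y_j and of the z_j vanish.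

   The opens involved are nonempty because some curve over k meets X in nine
   distinct points outside x_0 = 0; they are dense because a smooth cubic surface
   is geometrically irreducible. *)

Require Import Defs.
From Stdlib Require Import FunctionalExtensionality PropExtensionality.
From mathcomp Require Import all_boot fingroup perm all_algebra.
From mathcomp Require Import mpoly separable.
From mathcomp Require Import ring zify.

Set Implicit Arguments.
Unset Strict Implicit.
Unset Printing Implicit Defensive.

Import GRing.Theory.
Local Open Scope ring_scope.
Local Open Scope quotient_scope.

(** * Opens and regular functions *)

(** A general curve meets X in finitely many points, so W_m has the dimension 16 of the space of
    matrices w, and n is forced by 16 = 2m + n. Two obstacles shape the proof. The m points and
    their parameters are not individually defined over k: every map is written on ordered data and
    then descended, to Sym^m(X) by norms and sums over S_m, to the coefficients of the factor by
    symmetric functions. And irreducibility over k does not pass to products, so it is proved over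
    K, in a form that survives fixing a coordinate at a K-point. For the surface, irreducibility
    comes from projecting away from a point off X. A proper factor of the resulting monic cubic in z
    would yield a root rational in x and y; such a root turns out to be a polynomial, then an affine
    function, and its graph is a plane inside X, which would carry a singular point. The quadrics
    are chosen to take the values 1, t, ..., t^(m-1) on the curve (1, t, t^2, t^3). The coordinates
    make this curve the one with nine distinct intersection points, so that the trivialisation of
    the bundle is tested there by a Vandermonde determinant. *)

Lemma pred_ext (T : Type) (U V : T -> Prop) : (forall x, U x <-> V x) -> U = V.
Proof.
by move=> UV; apply: functional_extensionality => x; apply: propositional_extensionality.
Qed.

Section KSpaces.
Variables (k K : fieldType) (iota : {rmorphism k -> K}).

(* K only enters as the field of values: openness and regularity are over k. *)
Record kaxioms (X : kspace K) : Prop := KSpaceLaws {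
  opensT : opens X (fun=> True);
  opensI U V : opens X U -> opens X V -> opens X (fun x => U x /\ V x);
  opens_local U :
    (forall x, U x -> exists V, [/\ opens X V, V x & forall y, V y -> U y]) ->
    opens X U;
  opens_neq0 U f : opens X U -> regular X U f ->
    opens X (fun x => U x /\ f x != 0);
  regularC U a : regular X U (fun=> iota a);
  regularD U f g : regular X U f -> regular X U g ->
    regular X U (fun x => f x + g x);
  regularM U f g : regular X U f -> regular X U g ->
    regular X U (fun x => f x * g x);
  regularV U f : opens X U -> regular X U f -> (forall x, U x -> f x != 0) ->
    regular X U (fun x => (f x)^-1);
  regularS U V f : regular X U f -> (forall x, V x -> U x) -> regular X V f;
  regularE U f g : (forall x, U x -> f x = g x) ->
    regular X U f -> regular X U g;
  regular_local U f :
    (forall x, U x -> exists V,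
      [/\ opens X V, V x, forall y, V y -> U y & regular X V f]) ->
    regular X U f
}.

Section KSpaceTheory.
Variables (X : kspace K) (kX : kaxioms X).

Lemma regular_sum (J : Type) (r : seq J) (P : pred J) U (f : J -> X -> K) :
  (forall j, regular X U (f j)) ->
  regular X U (fun x => \sum_(j <- r | P j) f j x).
Proof.
move=> rf; elim: r => [|j r IH].
  apply: (regularE kX) (regularC kX U 0) => x _.
  by rewrite big_nil rmorph0.
case Pj: (P j).
  by apply: (regularE kX) (regularD kX (rf j) IH) => x _; rewrite big_cons Pj.
by apply: (regularE kX) IH => x _; rewrite big_cons Pj.
Qed.

Lemma regular_prod (J : Type) (r : seq J) (P : pred J) U (f : J -> X -> K) :
  (forall j, regular X U (f j)) ->
  regular X U (fun x => \prod_(j <- r | P j) f j x).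
Proof.
move=> rf; elim: r => [|j r IH].
  apply: (regularE kX) (regularC kX U 1) => x _.
  by rewrite big_nil rmorph1.
case Pj: (P j).
  by apply: (regularE kX) (regularM kX (rf j) IH) => x _; rewrite big_cons Pj.
by apply: (regularE kX) IH => x _; rewrite big_cons Pj.
Qed.

Lemma opensI_fin (J : finType) (U : J -> X -> Prop) :
  (forall j, opens X (U j)) -> opens X (fun x => forall j, U j x).
Proof.
move=> oU; have: opens X (fun x => forall j, j \in enum J -> U j x).
  elim: (enum J) => [|j s IH].
    rewrite (_ : (fun x => _) = (fun=> True)); first exact: (opensT kX).
    exact: pred_ext.
  rewrite (_ : (fun x => _) = (fun x => U j x /\ forall i, i \in s -> U i x)).
    exact: (opensI kX).
  apply: pred_ext => x; split=> [Ux|[Ujx Usx] i].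
    by split=> [|i si]; apply: Ux; rewrite in_cons ?eqxx ?si ?orbT.
  by rewrite in_cons => /predU1P[->|/Usx].
congr opens; apply: pred_ext => x; split=> Ux j; last by move=> _.
by apply: Ux; rewrite mem_enum.
Qed.
End KSpaceTheory.

Section FracSpace.
Variables (T : choiceType) (frac : (T -> Prop) -> (T -> K) -> (T -> K) -> Prop).

(** [fracW] serves to invert a fraction. [fracH], combined with [fracM], allows numerator and
    denominator to be multiplied by a further denominator, which shrinks the basic open set without
    changing the function. *)
Record frac_axioms : Prop := FracLaws {
  fracC a : exists V, frac V (fun=> iota a) (fun=> 1) /\ forall x, V x;
  fracM V V' g g' h h' : frac V g h -> frac V' g' h' ->
    frac (fun x => V x /\ V' x) (fun x => g x * g' x) (fun x => h x * h' x);
  fracD V V' g g' h h' : frac V g h -> frac V' g' h' ->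
    frac (fun x => V x /\ V' x) (fun x => g x * h' x + g' x * h x)
         (fun x => h x * h' x);
  fracW V g h : frac V g h -> frac V h g;
  fracH V g h : frac V g h -> frac V h h
}.

Hypothesis fA : frac_axioms.

Lemma frac_space_kaxioms : kaxioms (frac_space frac).
Proof.
(* Multiplying both parts of g / h by h0 confines the fraction to the basic open set of h0, hence to
   any open set that contains the latter. *)
have restr V0 g0 h0 V g h : frac V0 g0 h0 -> frac V g h ->
    frac (fun x => V0 x /\ V x) (fun x => h0 x * g x) (fun x => h0 x * h x).
  by move=> F0 F; apply: (fracM fA) F; apply: (fracH fA) F0.
split.
- move=> x _; have [V [FV VT]] := fracC fA 1.
  by exists V, (fun=> iota 1), (fun=> 1); split; rewrite ?oner_eq0.
- move=> U U' oU oU' x [/oU[V [g [h [F Vx hx UV]]]] /oU'[V' [g' [h' [F' V'x h'x UV']]]]].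
  do 3 eexists; split; [exact: (fracM fA F F')|by []|by rewrite mulf_neq0|].
  move=> y [Vy V'y]; rewrite mulf_eq0 negb_or => /andP[hy h'y].
  by split; [exact: UV|exact: UV'].
- move=> U lU x /lU[V [oV Vx VU]]; have [V' [g [h [F V'x hx UV]]]] := oV x Vx.
  by exists V', g, h; split=> // y V'y hy; apply/VU/UV.
- move=> U f oU rf x [Ux fx].
  have [V0 [g0 [h0 [F0 V0x h0x V0U]]]] := oU x Ux.
  have [V [g [h [F Vx hx E]]]] := rf x Ux.
  have gx : g x != 0 by apply: contraNneq fx => gx; rewrite E // gx mul0r.
  do 3 eexists; split; [exact: (restr _ _ _ _ _ _ F0 (fracM fA F (fracW fA F)))|..].
  + by [].
  + by rewrite !mulf_neq0.
  move=> y [V0y [Vy _]]; rewrite !mulf_eq0 !negb_or => /and3P[h0y hy gy].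
  have Uy: U y by apply: V0U.
  by split=> //; rewrite E // mulf_neq0 // invr_eq0.
- move=> U a x _; have [V [FV VT]] := fracC fA a.
  exists V, (fun=> iota a), (fun=> 1); split; rewrite ?oner_eq0 // => *.
  by rewrite divr1.
- move=> U f f' rf rf' x Ux; have [V [g [h [F Vx hx E]]]] := rf x Ux.
  have [V' [g' [h' [F' V'x h'x E']]]] := rf' x Ux.
  do 3 eexists; split; [exact: (fracD fA F F')|by []|by rewrite mulf_neq0|].
  move=> y Uy [Vy V'y]; rewrite mulf_eq0 negb_or => /andP[hy h'y].
  by rewrite E // E' // addf_div.
- move=> U f f' rf rf' x Ux; have [V [g [h [F Vx hx E]]]] := rf x Ux.
  have [V' [g' [h' [F' V'x h'x E']]]] := rf' x Ux.
  do 3 eexists; split; [exact: (fracM fA F F')|by []|by rewrite mulf_neq0|].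
  move=> y Uy [Vy V'y]; rewrite mulf_eq0 negb_or => /andP[hy h'y].
  by rewrite E // E' // mulf_div.
- move=> U f oU rf fN x Ux.
  have [V [g [h [F Vx hx E]]]] := rf x Ux.
  have gx : g x != 0 by apply: contraNneq (fN x Ux) => gx; rewrite E // gx mul0r.
  do 3 eexists; split; [exact: (fracM fA (fracH fA F) (fracW fA F))|by []|..].
    by rewrite mulf_neq0.
  move=> y Uy [Vy _]; rewrite mulf_eq0 negb_or => /andP[hy gy].
  by rewrite E // invf_div /= -mulf_div divff // mul1r.
- move=> U V f rf VU x Vx; have [V' [g [h [F V'x hx E]]]] := rf x (VU x Vx).
  by exists V', g, h; split=> // y Vy V'y hy; apply: E => //; apply: VU.
- move=> U f f' ff' rf x Ux; have [V [g [h [F Vx hx E]]]] := rf x Ux.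
  by exists V, g, h; split=> // y Uy Vy hy; rewrite -ff' // E.
- move=> U f lU x Ux; have [V [oV Vx VU rV]] := lU x Ux.
  have [V0 [g0 [h0 [F0 V0x h0x V0U]]]] := oV x Vx.
  have [V' [g [h [F V'x hx E]]]] := rV x Vx.
  do 3 eexists; split; [exact: (restr _ _ _ _ _ _ F0 F)|by []|by rewrite mulf_neq0|].
  move=> y Uy [V0y Vy]; rewrite mulf_eq0 negb_or => /andP[h0y hy].
  by rewrite E //=; [rewrite -mulf_div divff // mul1r|apply: V0U].
Qed.

(** Cross-multiplication gives finitely many regular functions one denominator near x, so that a
    K-linear combination of them becomes a single fraction. The clause on g0 keeps h admissible when
    J is empty. *)
Lemma frac_common (J : finType) U (f : J -> T -> K) x :
  frac_open frac U -> U x -> (forall j, frac_regular frac U (f j)) ->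
  exists V h (g : J -> T -> K), [/\ V x, h x != 0,
    forall j, frac V (g j) h, exists g0, frac V g0 h
    & forall y, V y -> h y != 0 -> U y /\ forall j, f j y = g j y / h y].
Proof.
move=> oU Ux rf.
suff: exists V h (g : J -> T -> K), [/\ V x, h x != 0,
    forall j, j \in enum J -> frac V (g j) h, exists g0, frac V g0 h
    & forall y, V y -> h y != 0 ->
      U y /\ forall j, j \in enum J -> f j y = g j y / h y].
  move=> [V [h [g [Vx hx F F0 E]]]]; exists V, h, g; split=> // [j|y Vy hy].
    by apply: F; rewrite mem_enum.
  by have [Uy Ey] := E y Vy hy; split=> // j; apply: Ey; rewrite mem_enum.
elim: (enum J) => [|j s [V [h [g [Vx hx F [g0 F0] E]]]]].
  have [V [g [h [F Vx hx VU]]]] := oU x Ux.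
  by exists V, h, (fun=> g); split=> //; [exists g|move=> y Vy hy; split=> //; apply: VU].
have [V' [g' [h' [F' V'x h'x E']]]] := rf j x Ux.
exists (fun x => V x /\ V' x), (fun x => h x * h' x),
  (fun i x => if i == j then h x * g' x else g i x * h' x); split=> //.
- by rewrite mulf_neq0.
- move=> i; rewrite in_cons; case: eqP => [_ _|_ /= si].
    by apply: (fracM fA) F'; apply: (fracH fA) F0.
  by apply: (fracM fA); [exact: F|exact: (fracH fA) F'].
- by exists (fun x => g0 x * g' x); apply: (fracM fA) F0 F'.
move=> y [Vy V'y]; rewrite mulf_eq0 negb_or => /andP[hy h'y].
have [Uy Ey] := E y Vy hy; split=> // i; rewrite in_cons.
case: eqP => [-> _|_ /= /Ey->].
  by rewrite E' // /= -mulf_div divff // mul1r.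
by rewrite /= -mulf_div divff // mulr1.
Qed.
End FracSpace.

Lemma subspace_kaxioms (X : kspace K) (Z : pred X) :
  kaxioms X -> kaxioms (subspace Z).
Proof.
move=> kX; pose S := {x : X | Z x}.
(* [sub_open] asks for a single ambient open set; the union of all ambient opens whose trace lies in
   W is one. *)
have opU (W : S -> Prop) : (forall x, W x -> exists O,
    [/\ opens X O, O (val x) & forall y : S, O (val y) -> W y]) ->
    sub_open W.
  move=> lW; exists (fun x => exists O, [/\ opens X O, O x
      & forall y : S, O (val y) -> W y]).
    apply: (opens_local kX) => x [O [oO Ox OW]]; exists O; split=> // y Oy.
    by exists O.
  by move=> x; split=> [/lW //|[O [oO Ox OW]]]; apply: OW.
split.
- by exists (fun=> True) => //; apply: (opensT kX).
- move=> U V [U0 oU0 U0E] [V0 oV0 V0E].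
  exists (fun x => U0 x /\ V0 x); first exact: (opensI kX).
  by move=> x; rewrite U0E V0E.
- move=> U lU; apply: opU => x /lU[V [[O oO OE] Vx VU]].
  by exists O; split=> // [|y Oy]; [apply/OE|apply/VU/OE].
- move=> U f [O oO OE] rf; apply: opU => x [Ux fx].
  have [O' [g [oO' rg O'x E]]] := rf x Ux.
  exists (fun y => O y /\ (O' y /\ g y != 0)); split.
  + by apply: (opensI kX) => //; apply: (opens_neq0 kX).
  + by split; [apply/OE|rewrite -E].
  + move=> y [Oy [O'y gy]]; have Uy: U y by apply/OE.
    by rewrite E.
- move=> U a x Ux; exists (fun=> True), (fun=> iota a); split=> //.
    exact: (opensT kX).
  exact: (regularC kX).
- move=> U f f' rf rf' x Ux.
  have [O [g [oO rg Ox E]]] := rf x Ux; have [O' [g' [oO' rg' O'x E']]] := rf' x Ux.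
  exists (fun y => O y /\ O' y), (fun y => g y + g' y); split=> //.
  + exact: (opensI kX).
  + by apply: (regularD kX); [apply: (regularS kX rg)|apply: (regularS kX rg')] => ? [].
  + by move=> y Uy [Oy O'y]; rewrite E // E'.
- move=> U f f' rf rf' x Ux.
  have [O [g [oO rg Ox E]]] := rf x Ux; have [O' [g' [oO' rg' O'x E']]] := rf' x Ux.
  exists (fun y => O y /\ O' y), (fun y => g y * g' y); split=> //.
  + exact: (opensI kX).
  + by apply: (regularM kX); [apply: (regularS kX rg)|apply: (regularS kX rg')] => ? [].
  + by move=> y Uy [Oy O'y]; rewrite E // E'.
- move=> U f oU rf fN x Ux.
  have [O [g [oO rg Ox E]]] := rf x Ux.
  exists (fun y => O y /\ g y != 0), (fun y => (g y)^-1); split.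
  + exact: (opens_neq0 kX).
  + apply: (regularV kX); [exact: (opens_neq0 kX)| |by move=> y []].
    by apply: (regularS kX rg) => y [].
  + by rewrite -E ?fN.
  + by move=> y Uy [Oy _]; rewrite E.
- move=> U V f rf VU x Vx; have [O [g [oO rg Ox E]]] := rf x (VU x Vx).
  by exists O, g; split=> // y Vy Oy; apply: E => //; apply: VU.
- move=> U f f' ff' rf x Ux; have [O [g [oO rg Ox E]]] := rf x Ux.
  by exists O, g; split=> // y Uy Oy; rewrite -ff' // E.
- move=> U f lU x Ux; have [V [[O oO OE] Vx VU rV]] := lU x Ux.
  have [O' [g [oO' rg O'x E]]] := rV x Vx.
  exists (fun y => O y /\ O' y), g; split.
  + exact: (opensI kX).
  + by apply: (regularS kX rg) => y [].
  + by split=> //; apply/OE.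
  + by move=> y Uy [Oy O'y]; apply: E => //; apply/OE.
Qed.

Lemma quot_kaxioms (X : kspace K) (e : equiv_rel X) :
  kaxioms X -> kaxioms (quot_space e).
Proof.
move=> kX; split.
- exact: (opensT kX).
- by move=> U V; apply: (opensI kX).
- move=> U lU; apply: (opens_local kX) => x /lU[V [oV Vx VU]].
  by exists (fun x => V (\pi_({eq_quot e}) x)); split=> // y; apply: VU.
- by move=> U f; apply: (opens_neq0 kX).
- by move=> U a; apply: (regularC kX).
- by move=> U f g; apply: (regularD kX).
- by move=> U f g; apply: (regularM kX).
- by move=> U f oU rf fN; apply: (regularV kX) => // x; apply: fN.
- by move=> U V f rf VU; apply: (regularS kX rf) => x; apply: VU.
- by move=> U f g fg; apply: (regularE kX) => x; apply: fg.
- move=> U f lU; apply: (regular_local kX) => x /lU[V [oV Vx VU rV]].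
  by exists (fun x => V (\pi_({eq_quot e}) x)); split=> // y; apply: VU.
Qed.

Section ProductSpace.
Variables (X Y : kspace K) (kX : kaxioms X) (kY : kaxioms Y).

Lemma prod_tensor_fin (J : finType) (U : X -> Prop) (V : Y -> Prop)
    (a : J -> X -> K) (b : J -> Y -> K) (g : (X * Y)%type -> K) :
  (forall j, regular X U (a j)) -> (forall j, regular Y V (b j)) ->
  (forall x y, g (x, y) = \sum_j a j x * b j y) -> prod_tensor U V g.
Proof.
move=> ra rb E; exists #|J|, (fun i => a (enum_val i)), (fun i => b (enum_val i)).
split=> // x y; rewrite E (reindex (@enum_val J J)) //.
exact/onW_bij/enum_val_bij.
Qed.

Lemma prod_tensorS U V U' V' (g : (X * Y)%type -> K) :
  (forall x, U' x -> U x) -> (forall y, V' y -> V y) ->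
  prod_tensor U V g -> prod_tensor U' V' g.
Proof.
move=> UU VV [r [a [b [ra rb E]]]]; exists r, a, b; split=> // j.
  exact: (regularS kX (ra j)).
exact: (regularS kY (rb j)).
Qed.

Lemma prod_tensorM U V (g g' : (X * Y)%type -> K) :
  prod_tensor U V g -> prod_tensor U V g' ->
  prod_tensor U V (fun z => g z * g' z).
Proof.
move=> [r [a [b [ra rb E]]]] [r' [a' [b' [ra' rb' E']]]].
apply: (@prod_tensor_fin ('I_r * 'I_r')%type _ _
  (fun j x => a j.1 x * a' j.2 x) (fun j y => b j.1 y * b' j.2 y)).
- by move=> j; apply: (regularM kX).
- by move=> j; apply: (regularM kY).
move=> x y; rewrite E E' mulr_suml -(pair_bigA _ (fun i j =>
  a i x * a' j x * (b i y * b' j y))) /=.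
by apply: eq_bigr => i _; rewrite mulr_sumr; apply: eq_bigr => j _; rewrite mulrACA.
Qed.

Lemma prod_tensorD U V (g g' : (X * Y)%type -> K) :
  prod_tensor U V g -> prod_tensor U V g' ->
  prod_tensor U V (fun z => g z + g' z).
Proof.
move=> [r [a [b [ra rb E]]]] [r' [a' [b' [ra' rb' E']]]].
apply: (@prod_tensor_fin ('I_r + 'I_r')%type _ _
  (fun j x => match j with inl i => a i x | inr i => a' i x end)
  (fun j y => match j with inl i => b i y | inr i => b' i y end)).
- by case.
- by case.
by move=> x y; rewrite E E' big_sumType.
Qed.

Lemma prod_frac_axioms : frac_axioms (@prod_frac _ X Y).
Proof.
have IE U V U' V' (W W' : (X * Y)%type -> Prop) :
  (forall z, W z <-> U z.1 /\ V z.2) -> (forall z, W' z <-> U' z.1 /\ V' z.2) ->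
  forall z, W z /\ W' z <-> (U z.1 /\ U' z.1) /\ (V z.2 /\ V' z.2).
  by move=> E E' z; rewrite E E'; tauto.
split.
- move=> a; exists (fun=> True); split=> //.
  exists (fun=> True), (fun=> True); split=> //.
  + exact: (opensT kX).
  + exact: (opensT kY).
  + apply: (@prod_tensor_fin 'I_1 _ _ (fun=> fun=> iota a) (fun=> fun=> iota 1)) => *.
    * exact: (regularC kX).
    * exact: (regularC kY).
    * by rewrite big_ord1 rmorph1 mulr1.
  + apply: (@prod_tensor_fin 'I_1 _ _ (fun=> fun=> iota 1) (fun=> fun=> iota 1)) => *.
    * exact: (regularC kX).
    * exact: (regularC kY).
    * by rewrite big_ord1 rmorph1 mulr1.
- move=> W W' g g' h h' [U [V [oU oV E tg th]]] [U' [V' [oU' oV' E' tg' th']]].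
  have S f : prod_tensor U V f ->
    prod_tensor (fun x => U x /\ U' x) (fun x => V x /\ V' x) f.
    by apply: prod_tensorS => ? [].
  have S' f : prod_tensor U' V' f ->
    prod_tensor (fun x => U x /\ U' x) (fun x => V x /\ V' x) f.
    by apply: prod_tensorS => ? [].
  do 2 eexists; split; [exact: (opensI kX oU oU')|exact: (opensI kY oV oV')|exact: IE|..];
    by apply: prod_tensorM; auto.
- move=> W W' g g' h h' [U [V [oU oV E tg th]]] [U' [V' [oU' oV' E' tg' th']]].
  have S f : prod_tensor U V f ->
    prod_tensor (fun x => U x /\ U' x) (fun x => V x /\ V' x) f.
    by apply: prod_tensorS => ? [].
  have S' f : prod_tensor U' V' f ->
    prod_tensor (fun x => U x /\ U' x) (fun x => V x /\ V' x) f.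
    by apply: prod_tensorS => ? [].
  do 2 eexists; split; [exact: (opensI kX oU oU')|exact: (opensI kY oV oV')|exact: IE|..].
    by apply: prod_tensorD; apply: prod_tensorM; auto.
  by apply: prod_tensorM; auto.
- by move=> W g h [U [V [*]]]; exists U, V.
- by move=> W g h [U [V [*]]]; exists U, V.
Qed.

Lemma prod_space_kaxioms : kaxioms (prod_space X Y).
Proof. exact/frac_space_kaxioms/prod_frac_axioms. Qed.
End ProductSpace.

Section PowerSpace.
Variables (X : kspace K) (kX : kaxioms X) (m : nat).

Lemma power_tensor_fin (J : finType) (U : 'I_m -> X -> Prop)
    (a : J -> 'I_m -> X -> K) (g : {ffun 'I_m -> X} -> K) :
  (forall j i, regular X (U i) (a j i)) ->
  (forall x, g x = \sum_j \prod_i a j i (x i)) -> power_tensor U g.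
Proof.
move=> ra E; exists #|J|, (fun i => a (enum_val i)).
split=> // x; rewrite E (reindex (@enum_val J J)) //.
exact/onW_bij/enum_val_bij.
Qed.

Lemma power_tensorS (U U' : 'I_m -> X -> Prop) (g : {ffun 'I_m -> X} -> K) :
  (forall i x, U' i x -> U i x) -> power_tensor U g -> power_tensor U' g.
Proof.
move=> UU [r [a [ra E]]]; exists r, a; split=> // j i.
exact: (regularS kX (ra j i) (UU i)).
Qed.

Lemma power_tensorM (U : 'I_m -> X -> Prop) (g g' : {ffun 'I_m -> X} -> K) :
  power_tensor U g -> power_tensor U g' -> power_tensor U (fun z => g z * g' z).
Proof.
move=> [r [a [ra E]]] [r' [a' [ra' E']]].
apply: (@power_tensor_fin ('I_r * 'I_r')%type _
  (fun j i x => a j.1 i x * a' j.2 i x)).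
- by move=> j i; apply: (regularM kX).
move=> x; rewrite E E' mulr_suml -(pair_bigA _ (fun i j =>
  \prod_i0 (a i i0 (x i0) * a' j i0 (x i0)))) /=.
by apply: eq_bigr => i _; rewrite mulr_sumr; apply: eq_bigr => j _; rewrite big_split.
Qed.

Lemma power_tensorD (U : 'I_m -> X -> Prop) (g g' : {ffun 'I_m -> X} -> K) :
  power_tensor U g -> power_tensor U g' -> power_tensor U (fun z => g z + g' z).
Proof.
move=> [r [a [ra E]]] [r' [a' [ra' E']]].
apply: (@power_tensor_fin ('I_r + 'I_r')%type _
  (fun j i x => match j with inl l => a l i x | inr l => a' l i x end)).
- by case.
by move=> x; rewrite E E' big_sumType.
Qed.

(* For m = 0 only the natural numbers are sums of (empty) products. *)
Lemma power_tensorC (i0 : 'I_m) (U : 'I_m -> X -> Prop) a :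
  power_tensor U (fun=> iota a).
Proof.
apply: (@power_tensor_fin 'I_1 _ (fun _ i _ => iota (if i == i0 then a else 1))).
  by move=> _ i; apply: (regularC kX).
move=> x; rewrite big_ord1 (bigD1 i0) //= eqxx big1 ?mulr1 // => i /negPf->.
by rewrite rmorph1.
Qed.

Lemma power_frac_axioms (i0 : 'I_m) : frac_axioms (@power_frac _ X m).
Proof.
have IE (U U' : 'I_m -> X -> Prop) (W W' : {ffun 'I_m -> X} -> Prop) :
  (forall z, W z <-> forall i, U i (z i)) ->
  (forall z, W' z <-> forall i, U' i (z i)) ->
  forall z, W z /\ W' z <-> forall i, U i (z i) /\ U' i (z i).
  move=> E E' z; rewrite E E'; split=> [[Uz U'z] i|Uz]; first by [].
  by split=> i; case: (Uz i).
split.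
- move=> a; exists (fun=> True); split=> //.
  exists (fun _ _ => True); split=> //.
  + by move=> i; apply: (opensT kX).
  + exact: power_tensorC.
  + by rewrite -(rmorph1 iota); apply: power_tensorC.
- move=> W W' g g' h h' [U [oU E tg th]] [U' [oU' E' tg' th']].
  have S f : power_tensor U f -> power_tensor (fun i x => U i x /\ U' i x) f.
    by apply: power_tensorS => ? ? [].
  have S' f : power_tensor U' f -> power_tensor (fun i x => U i x /\ U' i x) f.
    by apply: power_tensorS => ? ? [].
  exists (fun i x => U i x /\ U' i x); split.
  + by move=> i; apply: (opensI kX).
  + exact: IE.
  + by apply: power_tensorM; auto.
  + by apply: power_tensorM; auto.
- move=> W W' g g' h h' [U [oU E tg th]] [U' [oU' E' tg' th']].
  have S f : power_tensor U f -> power_tensor (fun i x => U i x /\ U' i x) f.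
    by apply: power_tensorS => ? ? [].
  have S' f : power_tensor U' f -> power_tensor (fun i x => U i x /\ U' i x) f.
    by apply: power_tensorS => ? ? [].
  exists (fun i x => U i x /\ U' i x); split.
  + by move=> i; apply: (opensI kX).
  + exact: IE.
  + by apply: power_tensorD; apply: power_tensorM; auto.
  + by apply: power_tensorM; auto.
- by move=> W g h [U [*]]; exists U.
- by move=> W g h [U [*]]; exists U.
Qed.

Lemma power_space_kaxioms : (0 < m)%N -> kaxioms (power_space X m).
Proof.
by move=> m_gt0; apply/frac_space_kaxioms/power_frac_axioms/(Ordinal m_gt0).
Qed.

Lemma sym_product_kaxioms : (0 < m)%N -> kaxioms (sym_product X m).
Proof. by move=> m_gt0; apply/quot_kaxioms/power_space_kaxioms. Qed.
End PowerSpace.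

Section ProjectiveSpace.
Variable n : nat.

Lemma proj_frac_axioms : frac_axioms (@proj_frac k K iota n).
Proof.
split.
- move=> a; exists (fun=> True); split=> //; split=> //.
  exists 0%N, (a%:MP), 1; split.
  + by rewrite -alg_mpolyC; apply: dhomogZ; exact: dhomog1.
  + exact: dhomog1.
  + by move=> x; rewrite /evalp /evalv map_mpolyC mevalC.
  + by move=> x; rewrite /evalp /evalv rmorph1 meval1.
- move=> V V' g g' h h' [VT [d [p [q [hp hq Eg Eh]]]]] [VT' [d' [p' [q' [hp' hq' Eg' Eh']]]]].
  split=> [x|]; first by split.
  exists (d + d')%N, (p * p'), (q * q'); split; [exact: dhomogM|exact: dhomogM|..].
  + by move=> x; rewrite Eg Eg' /evalp /evalv rmorphM mevalM.
  + by move=> x; rewrite Eh Eh' /evalp /evalv rmorphM mevalM.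
- move=> V V' g g' h h' [VT [d [p [q [hp hq Eg Eh]]]]] [VT' [d' [p' [q' [hp' hq' Eg' Eh']]]]].
  split=> [x|]; first by split.
  exists (d + d')%N, (p * q' + p' * q), (q * q'); split.
  + by apply: dhomogD; [|rewrite addnC]; exact: dhomogM.
  + exact: dhomogM.
  + by move=> x; rewrite Eg Eg' Eh Eh' /evalp /evalv rmorphD !rmorphM mevalD !mevalM.
  + by move=> x; rewrite Eh Eh' /evalp /evalv rmorphM mevalM.
- by move=> V g h [VT [d [p [q [hp hq Eg Eh]]]]]; split=> //; exists d, q, p.
- by move=> V g h [VT [d [p [q [hp hq Eg Eh]]]]]; split=> //; exists d, q, q.
Qed.

Lemma proj_space_kaxioms : kaxioms (proj_space iota n).
Proof. exact/frac_space_kaxioms/proj_frac_axioms. Qed.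
End ProjectiveSpace.

End KSpaces.

(** * Morphisms *)

Section Morphisms.
Variables (k K : fieldType) (iota : {rmorphism k -> K}).

Lemma opens_ext (X : kspace K) (U V : X -> Prop) :
  (forall x, U x <-> V x) -> opens X U -> opens X V.
Proof. by move=> UV; rewrite (pred_ext UV). Qed.

Definition rvec n (x : proj_point K n) : 'rV[K]_n.+1 :=
  val (generic_quotient.repr x).

Section IntoFrac.
Variables (X : kspace K) (kX : kaxioms iota X) (U : X -> Prop).
Hypothesis oU : opens X U.

(** Numerator and denominator are pulled back only up to a common factor e, which depends on the
    point and is not assumed regular. This leaves room for homogeneous coordinates, which are chosen
    representatives without any regularity. *)
Lemma morphism_on_frac (T : choiceType) frac (phi : X -> @frac_space K T frac) :
  (forall V g h, frac V g h ->
     opens X (fun x => U x /\ V (phi x)) /\ exists g' h',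
     [/\ regular X (fun x => U x /\ V (phi x)) g',
         regular X (fun x => U x /\ V (phi x)) h'
       & forall x, U x -> V (phi x) -> exists2 e, e != 0 &
           g (phi x) = e * g' x /\ h (phi x) = e * h' x]) ->
  morphism_on U phi.
Proof.
move=> H W oW; have oUW: opens X (fun x => U x /\ W (phi x)).
  apply: (opens_local kX) => x [Ux Wx].
  have [V [g [h [F Vx hx VW]]]] := oW _ Wx.
  have [oUV [g' [h' [rg rh E]]]] := H _ _ _ F.
  exists (fun y => (U y /\ V (phi y)) /\ h' y != 0); split.
  - exact: (opens_neq0 kX).
  - split=> //; have [e e0 [_ Eh]] := E x Ux Vx.
    by apply: contraNneq hx; rewrite Eh => ->; rewrite mulr0.
  move=> y [[Uy Vy] hy]; split=> //; apply: VW => //.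
  by have [e e0 [_ ->]] := E y Uy Vy; rewrite mulf_neq0.
split=> // f rf; apply: (regular_local kX) => x [Ux Wx].
have [V [g [h [F Vx hx fE]]]] := rf _ Wx.
have [oUV [g' [h' [rg rh E]]]] := H _ _ _ F.
pose O x := (U x /\ W (phi x)) /\ ((U x /\ V (phi x)) /\ h' x != 0).
have oO : opens X O by apply: (opensI kX oUW); apply: (opens_neq0 kX).
exists O; split=> //.
- split=> //; split=> //; have [e e0 [_ Eh]] := E x Ux Vx.
  by apply: contraNneq hx; rewrite Eh => ->; rewrite mulr0.
- by move=> y [].
apply: (regularE kX (f := fun y => g' y * (h' y)^-1)).
  move=> y [[Uy Wy] [[_ Vy] hy]]; have [e e0 [Eg Eh]] := E y Uy Vy.
  by rewrite fE ?Eh ?mulf_neq0 // Eg -mulf_div divff // mul1r.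
apply: (regularM kX); first by apply: (regularS kX rg) => y [_ []].
by apply: (regularV kX) => [//| |y [_ [] //]]; apply: (regularS kX rh) => y [_ []].
Qed.

Lemma morphism_on_prod (Y Z : kspace K) (phi : X -> prod_space Y Z) :
  morphism_on U (fun x => (phi x).1 : Y) ->
  morphism_on U (fun x => (phi x).2 : Z) -> morphism_on U phi.
Proof.
move=> m1 m2; apply: morphism_on_frac => W g h [V1 [V2 [oV1 oV2 WE tg th]]].
have [o1 r1] := m1 _ oV1; have [o2 r2] := m2 _ oV2.
have E x : U x /\ W (phi x) <-> (U x /\ V1 (phi x).1) /\ (U x /\ V2 (phi x).2).
  by rewrite WE; tauto.
split; first by apply: opens_ext (opensI kX o1 o2) => x; rewrite E.
have R g0 : prod_tensor V1 V2 g0 ->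
    regular X (fun x => U x /\ W (phi x)) (fun x => g0 (phi x)).
  move=> [r [a [b [ra rb gE]]]]; apply: (regularE kX (f := fun x =>
    \sum_(j < r) a j (phi x).1 * b j (phi x).2)).
    by move=> x _; rewrite -gE; case: (phi x).
  apply: (regular_sum kX) => j; apply: (regularM kX).
    by apply: (regularS kX (r1 _ (ra j))) => x /E[].
  by apply: (regularS kX (r2 _ (rb j))) => x /E[].
exists (fun x => g (phi x)), (fun x => h (phi x)); split; [exact: R|exact: R|].
by move=> x _ _; exists 1; rewrite ?oner_eq0 ?mul1r.
Qed.

Lemma morphism_on_power (Y : kspace K) m (phi : X -> power_space Y m) :
  (forall i, morphism_on U (fun x => (phi x : {ffun 'I_m -> Y}) i : Y)) ->
  morphism_on U phi.
Proof.
move=> mi; apply: morphism_on_frac => W g h [V [oV WE tg th]].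
have E x : U x /\ W (phi x) <->
    U x /\ forall i, U x /\ V i ((phi x : {ffun 'I_m -> Y}) i).
  rewrite WE; split=> [[Ux Vx]|[Ux Vx]]; split=> // i.
  by case: (Vx i).
split.
  apply: (opens_ext (fun x => iff_sym (E x))).
  by apply: (opensI kX) => //; apply: (opensI_fin kX) => i; have [] := mi i _ (oV i).
have R g0 : power_tensor V g0 ->
    regular X (fun x => U x /\ W (phi x)) (fun x => g0 (phi x)).
  move=> [r [a [ra gE]]]; apply: (regularE kX (f := fun x =>
    \sum_(j < r) \prod_i a j i ((phi x : {ffun 'I_m -> Y}) i))).
    by move=> x _; rewrite -gE.
  apply: (regular_sum kX) => j; apply: (regular_prod kX) => i.
  have [_ ri] := mi i _ (oV i).
  by apply: (regularS kX (ri _ (ra j i))) => x /E[].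
exists (fun x => g (phi x)), (fun x => h (phi x)); split; [exact: R|exact: R|].
by move=> x _ _; exists 1; rewrite ?oner_eq0 ?mul1r.
Qed.

Lemma morphism_on_subspace (Y : kspace K) (Z : pred Y) (phi : X -> subspace Z) :
  morphism_on U (fun x => val (phi x) : Y) -> morphism_on U phi.
Proof.
move=> mphi W [O oO WO]; have [oUO rO] := mphi _ oO.
have oUW : opens X (fun x => U x /\ W (phi x)).
  by apply: opens_ext oUO => x; rewrite WO.
split=> // f rf; apply: (regular_local kX) => x [Ux Wx].
have [O' [g [oO' rg O'x E]]] := rf _ Wx; have [oUO' rO'] := mphi _ oO'.
exists (fun x => (U x /\ W (phi x)) /\ (U x /\ O' (val (phi x)))); split=> //.
- exact: (opensI kX).
- by move=> y [].
apply: (regularE kX (f := fun x => g (val (phi x)))).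
  by move=> y [[Uy Wy] [_ O'y]]; rewrite E.
by apply: (regularS kX (rO' _ rg)) => y [].
Qed.

Lemma evalvZ n d (p : {mpoly k[n.+1]}) (c : K) (v : 'rV[K]_n.+1) :
  p \is d.-homog -> evalv iota p (c *: v) = c ^+ d * evalv iota p v.
Proof.
move=> hp; rewrite /evalv.
have hp' : map_mpoly iota p \is d.-homog.
  apply/dhomogP => mm; rewrite mcoeff_msupp mcoeff_map_mpoly => pm.
  apply: (dhomogP _ _ _ hp); rewrite mcoeff_msupp.
  by apply: contraNneq pm => ->; rewrite (raddf0 iota).
rewrite !mevalE mulr_sumr; apply: eq_big_seq => mm mp.
rewrite mulrCA; congr (_ * _).
rewrite -(dhomogP _ _ _ hp' _ mp) /= mdegE -prodrXr -big_split /=.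
by apply: eq_bigr => i _; rewrite mxE exprMn.
Qed.

Lemma regular_mpoly n (p : {mpoly k[n.+1]}) (v : X -> 'rV[K]_n.+1) W :
  (forall i, regular X W (fun x => v x 0 i)) ->
  regular X W (fun x => evalv iota p (v x)).
Proof.
move=> rv; apply: (regularE kX (f := fun x => \sum_(mm <- msupp p)
  iota p@_mm * \prod_i (v x 0 i) ^+ mm i)).
  move=> x _; rewrite /evalv [p in RHS]mpolyE (rmorph_sum (map_mpoly iota)) (rmorph_sum (meval _)).
  apply: eq_bigr => mm _ /=; rewrite map_mpolyZ mevalZ map_mpolyX mevalX //.
apply: (regular_sum kX) => mm; apply: (regularM kX); first exact: (regularC kX).
apply: (regular_prod kX) => i; elim: (mm i) => [|d IH].
  by apply: (regularE kX) (regularC kX _ 1) => x _; rewrite rmorph1.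
by apply: (regularE kX) (regularM kX (rv i) IH) => x _; rewrite exprS.
Qed.

(** By homogeneity the unknown factor c between the chosen representative and the regular vector v
    enters numerator and denominator alike, as c^d. *)
Lemma morphism_on_proj n (phi : X -> proj_space iota n) (v : X -> 'rV[K]_n.+1) :
  (forall i, regular X U (fun x => v x 0 i)) ->
  (forall x, U x -> exists2 c, c != 0 & rvec (phi x) = c *: v x) ->
  morphism_on U phi.
Proof.
move=> rv E; apply: morphism_on_frac => V g h [VT [d [p [q [hp hq Eg Eh]]]]].
have UE : (fun x => U x /\ V (phi x)) = U by apply: pred_ext => x; split=> [[]|].
rewrite UE; split=> //.
exists (fun x => evalv iota p (v x)), (fun x => evalv iota q (v x)).
split; try exact: regular_mpoly.
move=> x Ux _; have [c c0 vE] := E x Ux; exists (c ^+ d); first exact: expf_neq0.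
by rewrite Eg Eh /evalp -/(rvec _) vE !(evalvZ _ _ hp) !(evalvZ _ _ hq).
Qed.
End IntoFrac.

Lemma morphism_on_comp (X Y Z : kspace K) (U : X -> Prop) (V : Y -> Prop)
    (phi : X -> Y) (psi : Y -> Z) :
  morphism_on U phi -> morphism_on V psi ->
  morphism_on (fun x => U x /\ V (phi x)) (fun x => psi (phi x)).
Proof.
move=> mphi mpsi W oW; have [o r] := mpsi W oW; have [o' r'] := mphi _ o.
have E x : U x /\ (V (phi x) /\ W (psi (phi x))) <->
  (U x /\ V (phi x)) /\ W (psi (phi x)) by tauto.
by rewrite -(pred_ext E); split=> // f /r/r'.
Qed.

Lemma repr_proj n (v : nzvec K n) :
  exists2 c, c != 0 & rvec (\pi_(proj_point K n) v) = c *: val v.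
Proof.
have /eqmodP : \pi_(proj_point K n) (generic_quotient.repr (\pi_(proj_point K n) v)) =
    \pi_(proj_point K n) v by rewrite reprK.
move=> /andP[/sub_rVP[c E] _]; exists c => //.
by apply: contraNneq (valP (generic_quotient.repr (\pi_(proj_point K n) v))) => c0;
  rewrite E c0 scale0r.
Qed.

Lemma proj_eq n (x y : proj_point K n) c :
  rvec x = c *: rvec y -> x = y.
Proof.
rewrite /rvec => E; have c0 : c != 0.
  by apply: contraNneq (valP (generic_quotient.repr x)) => c0; rewrite E c0 scale0r.
rewrite -[x]reprK -[y]reprK; apply/eqmodP/andP; split.
  by apply/sub_rVP; exists c.
by apply/sub_rVP; exists c^-1; rewrite E scalerA mulVf // scale1r.
Qed.

End Morphisms.

(** * Polynomial and rational functions of coordinates *)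

Section PolynomialFunctions.
Variables (k K : fieldType) (iota : {rmorphism k -> K}).

(** The k-algebra generated by the functions [c i]. It consists of functions rather than formal
    polynomials, so relations between the coordinates on T need no ideal. *)
Inductive kalg (T I : Type) (c : I -> T -> K) : (T -> K) -> Prop :=
| kalgC a : kalg c (fun=> iota a)
| kalgX i : kalg c (c i)
| kalgD f g : kalg c f -> kalg c g -> kalg c (fun x => f x + g x)
| kalgM f g : kalg c f -> kalg c g -> kalg c (fun x => f x * g x).

Section Closure.
Variables (T I : Type) (c : I -> T -> K).
Local Notation kalg := (kalg c).

Lemma kalg_ext f g : f =1 g -> kalg f -> kalg g.
Proof. by move=> /functional_extensionality->. Qed.

Lemma kalg0 : kalg (fun=> 0).
Proof. by apply: kalg_ext (kalgC c 0) => x; rewrite rmorph0. Qed.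

Lemma kalg1 : kalg (fun=> 1).
Proof. by apply: kalg_ext (kalgC c 1) => x; rewrite rmorph1. Qed.

Lemma kalgN f : kalg f -> kalg (fun x => - f x).
Proof.
by move=> /(kalgM (kalgC c (-1))); apply: kalg_ext => x; rewrite rmorphN1 mulN1r.
Qed.

Lemma kalgB f g : kalg f -> kalg g -> kalg (fun x => f x - g x).
Proof. by move=> kf kg; apply/kalgD/kalgN. Qed.

Lemma kalg_sum (J : Type) (r : seq J) (P : pred J) (f : J -> T -> K) :
  (forall j, P j -> kalg (f j)) -> kalg (fun x => \sum_(j <- r | P j) f j x).
Proof.
move=> kf; elim: r => [|j r IH].
  by apply: kalg_ext kalg0 => x; rewrite big_nil.
case Pj: (P j); last by apply: kalg_ext IH => x; rewrite big_cons Pj.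
by apply: kalg_ext (kalgD (kf _ Pj) IH) => x; rewrite big_cons Pj.
Qed.

Lemma kalg_prod (J : Type) (r : seq J) (P : pred J) (f : J -> T -> K) :
  (forall j, P j -> kalg (f j)) -> kalg (fun x => \prod_(j <- r | P j) f j x).
Proof.
move=> kf; elim: r => [|j r IH].
  by apply: kalg_ext kalg1 => x; rewrite big_nil.
case Pj: (P j); last by apply: kalg_ext IH => x; rewrite big_cons Pj.
by apply: kalg_ext (kalgM (kf _ Pj) IH) => x; rewrite big_cons Pj.
Qed.

Lemma kalg_exp f d : kalg f -> kalg (fun x => f x ^+ d).
Proof.
move=> kf; elim: d => [|d IH]; first exact: kalg1.
by apply: kalg_ext (kalgM kf IH) => x; rewrite exprS.
Qed.

Lemma kalg_det m (A : T -> 'M[K]_m) :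
  (forall i j, kalg (fun x => A x i j)) -> kalg (fun x => \det (A x)).
Proof.
move=> kA; apply: kalg_sum => s _; apply: kalgM.
  apply: kalg_ext (kalg_exp (odd_perm s) (kalgC c (-1))) => x.
  by rewrite rmorphN1.
by apply: kalg_prod => i _; apply: kA.
Qed.

Lemma kalg_mpoly n (p : {mpoly k[n]}) (v : 'I_n -> T -> K) :
  (forall i, kalg (v i)) -> kalg (fun x => mmap iota (v^~ x) p).
Proof.
move=> kv; apply: kalg_sum => mm _; apply: kalgM; first exact: kalgC.
by apply: kalg_prod => i _; apply: kalg_exp.
Qed.
End Closure.

Lemma kalg_comp (T I T' I' : Type) (c : I -> T -> K) (c' : I' -> T' -> K)
    (phi : T' -> T) f :
  (forall i, kalg c' (fun x => c i (phi x))) -> kalg c f ->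
  kalg c' (fun x => f (phi x)).
Proof.
move=> kc; elim=> [a|i|g h _ IHg _ IHh|g h _ IHg _ IHh].
- exact: kalgC.
- exact: kc.
- exact: kalgD.
- exact: kalgM.
Qed.

Lemma kalg_regular (X : kspace K) (T I : Type) (c : I -> T -> K) U
    (phi : X -> T) f : kaxioms iota X ->
  (forall i, regular X U (fun x => c i (phi x))) -> kalg c f ->
  regular X U (fun x => f (phi x)).
Proof.
move=> kX rc; elim=> [a|i|g h _ IHg _ IHh|g h _ IHg _ IHh].
- exact: (regularC kX).
- exact: rc.
- exact: (regularD kX).
- exact: (regularM kX).
Qed.

Section AffineSpace.
Variables (T : choiceType) (I : Type) (c : I -> T -> K).

Definition aff_frac (V : T -> Prop) (g h : T -> K) : Prop :=
  (forall x, V x) /\ kalg c g /\ kalg c h.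

Definition aff_space : kspace K := frac_space aff_frac.

Lemma aff_frac_axioms : frac_axioms iota aff_frac.
Proof.
split.
- move=> a; exists (fun=> True); split=> //; split=> //.
  by split; [exact: kalgC|exact: kalg1].
- move=> V V' g g' h h' [VT [kg kh]] [VT' [kg' kh']]; split=> //.
  by split; exact: kalgM.
- move=> V V' g g' h h' [VT [kg kh]] [VT' [kg' kh']]; split=> //.
  by split; [apply: kalgD|]; exact: kalgM.
- by move=> V g h [VT [kg kh]].
- by move=> V g h [VT [kg kh]].
Qed.

Lemma aff_kaxioms : kaxioms iota aff_space.
Proof. exact/frac_space_kaxioms/aff_frac_axioms. Qed.

Lemma aff_regular U f : kalg c f -> regular aff_space U f.
Proof.
move=> kf x _; exists (fun=> True), f, (fun=> 1); split=> //.
- by split=> //; split=> //; exact: kalg1.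
- exact: oner_neq0.
- by move=> y _ _ _; rewrite divr1.
Qed.

Lemma morphism_on_aff (X : kspace K) (U : X -> Prop) (phi : X -> aff_space) :
  kaxioms iota X -> opens X U ->
  (forall i, regular X U (fun x => c i (phi x))) -> morphism_on U phi.
Proof.
move=> kX oU rc; apply: (morphism_on_frac kX) => // V g h [VT [kg kh]].
have UE : (fun x => U x /\ V (phi x)) = U by apply: pred_ext => x; split=> [[]|].
rewrite UE; split=> //.
exists (fun x => g (phi x)), (fun x => h (phi x)).
split; try exact: (kalg_regular kX rc).
by move=> x _ _; exists 1; rewrite ?oner_eq0 ?mul1r.
Qed.
End AffineSpace.

(** * Symmetric functions of the roots *)

Section Symmetrization.
Variables (W I : Type) (cW : I -> W -> K) (m : nat).

Definition pair_coord (i : I + 'I_m) (z : W * 'rV[K]_m) : K :=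
  match i with inl j => cW j z.1 | inr j => z.2 0 j end.

Definition roots_poly (t : 'rV[K]_m) : {poly K} := \prod_i ('X - (t 0 i)%:P).

Definition sym_coefs (t : 'rV[K]_m) : 'rV[K]_m := \row_j (roots_poly t)`_j.

(** Separates w from t: permutations of the roots then act on the monomials alone. *)
Lemma kalg_pair_normal Phi : kalg pair_coord Phi ->
  exists (J : finType) (a : J -> W -> K) (e : J -> 'I_m -> nat),
    (forall j, kalg cW (a j)) /\
    forall w t, Phi (w, t) = \sum_j a j w * \prod_i t 0 i ^+ e j i.
Proof.
elim=> [b|[i|i]|f g _ [J [a [e [ka E]]]] _ [J' [a' [e' [ka' E']]]]
       |f g _ [J [a [e [ka E]]]] _ [J' [a' [e' [ka' E']]]]].
- exists 'I_1, (fun _ _ => iota b), (fun _ _ => 0%N); split=> [_|w t].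
    exact: kalgC.
  by rewrite big_ord1 big1 ?mulr1.
- exists 'I_1, (fun=> cW i), (fun _ _ => 0%N); split=> [_|w t].
    exact: kalgX.
  by rewrite big_ord1 big1 ?mulr1.
- exists 'I_1, (fun _ _ => 1), (fun _ j => (j == i) : nat); split=> [_|w t].
    exact: kalg1.
  rewrite big_ord1 mul1r (bigD1 i) //= eqxx expr1 big1 ?mulr1 // => j.
  by move=> /negPf->.
- exists (J + J')%type, (fun j => match j with inl i => a i | inr i => a' i end),
    (fun j => match j with inl i => e i | inr i => e' i end); split.
    by case.
  by move=> w t; rewrite E E' big_sumType.
- exists (J * J')%type, (fun j w => a j.1 w * a' j.2 w),
    (fun j i => (e j.1 i + e' j.2 i)%N); split.
    by move=> j; apply: kalgM.
  move=> w t; rewrite E E' mulr_suml -(pair_bigA _ (fun i j =>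
    a i w * a' j w * \prod_l t 0 l ^+ (e i l + e' j l))) /=.
  apply: eq_bigr => i _; rewrite mulr_sumr; apply: eq_bigr => j _.
  rewrite mulrACA -big_split /=; congr (_ * _); apply: eq_bigr => l _.
  by rewrite exprD.
Qed.

Lemma mmap_comp_mpoly n p (lq : n.-tuple {mpoly k[m]}) (h : 'I_m -> K) :
  mmap iota h (p \mPo lq) = mmap iota (fun i => mmap iota h (tnth lq i)) p.
Proof.
rewrite comp_mpolyE (rmorph_sum (mmap iota h)); apply: eq_bigr => mm _ /=.
rewrite mmapZ; congr (_ * _); rewrite (rmorph_prod (mmap iota h)).
by apply: eq_bigr => i _; rewrite rmorphXn.
Qed.

(** Vieta's formula. [rev_ord] appears because the elementary symmetric function of degree i + 1 is,
    up to sign, the coefficient of degree m - i - 1. *)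
Lemma sym_coefs_mesym (t : 'rV[K]_m) (i : 'I_m) :
  mmap iota (t 0) (mesym m k i.+1) =
  (-1) ^+ i.+1 * sym_coefs t 0 (rev_ord i).
Proof.
have i_lt : (i.+1 < m.+1)%N by rewrite ltnS.
have := mroots_coeff [tuple t 0 i | i < m] (Ordinal i_lt).
rewrite big_tuple (eq_bigr (fun i => 'X - (t 0 i)%:P)); last first.
  by move=> j _; rewrite tnth_mktuple.
rewrite -/(roots_poly t) mxE /= => ->.
rewrite mulrA -expr2 sqrr_sign mul1r.
rewrite (meval_eq (v2 := t 0)); last by move=> j; rewrite tnth_mktuple.
rewrite /mesym !raddf_sum /=; apply: eq_bigr => h _.
rewrite !rmorph_prod /=; apply: eq_bigr => j _.
by rewrite mmapX mmap1U mevalXU.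
Qed.

(** The sum of the permuted copies of each monomial in t is a symmetric polynomial over k, hence, by
    the fundamental theorem, a polynomial over k in the elementary symmetric ones. *)
Lemma kalg_symmetrize Phi : kalg pair_coord Phi ->
  exists2 Theta, kalg pair_coord Theta & forall w (t : 'rV[K]_m),
    \sum_(s : 'S_m) Phi (w, \row_i t 0 (s i)) = Theta (w, sym_coefs t).
Proof.
move=> /kalg_pair_normal[J [a [e [ka E]]]].
pose p j : {mpoly k[m]} := \sum_(s : 'S_m) \prod_i 'X_(s i) ^+ e j i.
have psym j : p j \is symmetric.
  apply/forallP => s; apply/eqP; rewrite /p rmorph_sum /=.
  rewrite [RHS](reindex_inj (mulIg s)) /=; apply: eq_bigr => s' _.
  rewrite rmorph_prod; apply: eq_bigr => i _; rewrite rmorphXn /=.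
  by rewrite /msym mmapX mmap1U permM.
have pE j : exists q, q \mPo [tuple (mesym m k i.+1) | i < m] = p j.
  by have [q [qE _]] := sym_fundamental (psym j); exists q.
have [q qE] := fin_all_exists pE.
exists (fun z : W * 'rV[K]_m => \sum_j a j z.1 *
  mmap iota (fun i : 'I_m => (-1) ^+ i.+1 * z.2 0 (rev_ord i)) (q j)).
  apply: kalg_sum => j _; apply: kalgM.
    by apply: (kalg_comp (c := cW)) => // i; exact: (kalgX pair_coord (inl i)).
  apply: kalg_mpoly => i; apply: kalgM; last exact: (kalgX pair_coord (inr _)).
  apply: kalg_ext (kalg_exp i.+1 (kalgC pair_coord (-1))) => x.
  by rewrite rmorphN1.
move=> w t; under eq_bigr do rewrite E.
rewrite exchange_big /=.
apply: eq_bigr => j _; rewrite -mulr_sumr; congr (_ * _).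
transitivity (mmap iota (t 0) (p j)).
  rewrite /p rmorph_sum /=; apply: eq_bigr => s _; rewrite rmorph_prod.
  by apply: eq_bigr => i _; rewrite rmorphXn /= mmapX mmap1U mxE.
rewrite -qE mmap_comp_mpoly; apply: eq_bigr => mm _; congr (_ * _).
apply: eq_bigr => i _; congr (_ ^+ _).
by rewrite tnth_mktuple sym_coefs_mesym.
Qed.

(** If every monomial weight gave zero, so would every polynomial weight. The product of the
    P_i(t_(s i)), with P_i the product of the T - t_j over j != i, vanishes for all s except the
    identity, where it is nonzero because the t_i are distinct. *)
Lemma separating_weight (t : 'rV[K]_m) (h : 'S_m -> K) :
  injective (t 0) -> h 1%g != 0 ->
  exists e : 'I_m -> nat, \sum_(s : 'S_m) (\prod_i t 0 (s i) ^+ e i) * h s != 0.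
Proof.
move=> t_inj h1; pose P i := \prod_(j | j != i) ('X - (t 0 j)%:P).
pose d := \max_i size (P i).
have PE i x : (P i).[x] = \sum_(j < d) (P i)`_j * x ^+ j.
  by rewrite (horner_coef_wide (n := d)) // /d; apply: leq_bigmax.
have P0 (s : 'S_m) : s != 1%g -> \prod_i (P i).[t 0 (s i)] = 0.
  move=> s1; have [i si] : exists i, s i != i.
    apply/existsP; apply: contraNT s1; rewrite negb_exists => /forallP s1.
    by apply/eqP/permP => i; rewrite perm1; apply/eqP/negPn.
  rewrite (bigD1 i) //= {1}/P horner_prod (bigD1 (s i)) //= hornerXsubC subrr.
  by rewrite !mul0r.
have P1 : \prod_i (P i).[t 0 i] != 0.
  apply/prodf_neq0 => i _; rewrite horner_prod; apply/prodf_neq0 => j ji.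
  by rewrite hornerXsubC subr_eq0; apply: contraNneq ji => /t_inj->.
have [f E | E0] := pickP (fun f : {ffun 'I_m -> 'I_d} =>
    \sum_(s : 'S_m) (\prod_i t 0 (s i) ^+ f i) * h s != 0).
  by exists (fun i => f i : nat).
suff: \sum_(s : 'S_m) (\prod_i (P i).[t 0 (s i)]) * h s = 0.
  rewrite (bigD1 1%g) //= [X in _ + X]big1 ?addr0 => [/eqP|s s1]; last by rewrite P0 ?mul0r.
  rewrite mulf_eq0 (negPf h1) orbF (eq_bigr (fun i => (P i).[t 0 i])).
    by rewrite (negPf P1).
  by move=> i _; rewrite perm1.
under eq_bigr => s _.
  under eq_bigr do rewrite PE.
  rewrite bigA_distr_bigA mulr_suml; over.
rewrite exchange_big big1 //= => f _.
transitivity ((\prod_i (P i)`_(f i)) *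
    \sum_(s : 'S_m) (\prod_i t 0 (s i) ^+ f i) * h s).
  by rewrite mulr_sumr; apply: eq_bigr => s _; rewrite big_split /= mulrA.
by have /negbFE/eqP-> := E0 f; rewrite mulr0.
Qed.
End Symmetrization.
End PolynomialFunctions.

(** * Rational functions with one denominator on a set *)

Section RationalFunctions.
Variables (k K : fieldType) (iota : {rmorphism k -> K}).
Variables (T I : Type) (c : I -> T -> K) (S : T -> Prop).
Local Notation kalgc := (kalg iota c).

(** A single fraction valid on all of S, unlike the local fractions of [frac_regular]: descent
    through S_m takes the norm of one denominator for all orderings at once. *)
Definition rat (f : T -> K) : Prop := exists g h, [/\ kalgc g, kalgc h
  & forall x, S x -> h x != 0 /\ f x = g x / h x].

Lemma rat_kalg f : kalgc f -> rat f.
Proof.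
move=> kf; exists f, (fun=> 1); split=> //; first exact: kalg1.
by move=> x _; rewrite divr1 oner_neq0.
Qed.

Lemma rat_ext f g : (forall x, S x -> f x = g x) -> rat f -> rat g.
Proof.
move=> fg [a [b [ka kb E]]]; exists a, b; split=> // x Sx.
by rewrite -fg //; apply: E.
Qed.

Lemma ratC a : rat (fun=> iota a).
Proof. exact/rat_kalg/kalgC. Qed.

Lemma rat0 : rat (fun=> 0).
Proof. exact/rat_kalg/kalg0. Qed.

Lemma rat1 : rat (fun=> 1).
Proof. exact/rat_kalg/kalg1. Qed.

Lemma ratD f g : rat f -> rat g -> rat (fun x => f x + g x).
Proof.
move=> [a [b [ka kb E]]] [a' [b' [ka' kb' E']]].
exists (fun x => a x * b' x + a' x * b x), (fun x => b x * b' x); split.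
- by apply: kalgD; apply: kalgM.
- exact: kalgM.
move=> x Sx; have [bx ->] := E x Sx; have [b'x ->] := E' x Sx.
by rewrite mulf_neq0 // addf_div.
Qed.

Lemma ratM f g : rat f -> rat g -> rat (fun x => f x * g x).
Proof.
move=> [a [b [ka kb E]]] [a' [b' [ka' kb' E']]].
exists (fun x => a x * a' x), (fun x => b x * b' x); split; try exact: kalgM.
move=> x Sx; have [bx ->] := E x Sx; have [b'x ->] := E' x Sx.
by rewrite mulf_neq0 // mulf_div.
Qed.

Lemma ratN f : rat f -> rat (fun x => - f x).
Proof.
by move=> /(ratM (ratC (-1))); apply: rat_ext => x _; rewrite rmorphN1 mulN1r.
Qed.

Lemma ratB f g : rat f -> rat g -> rat (fun x => f x - g x).
Proof. by move=> rf /ratN; apply: ratD. Qed.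

Lemma ratV f : (forall x, S x -> f x != 0) -> rat f -> rat (fun x => (f x)^-1).
Proof.
move=> f0 [a [b [ka kb E]]]; exists b, a; split=> // x Sx.
have [bx fE] := E x Sx; rewrite fE invf_div; split=> //.
by apply: contraNneq (f0 x Sx) => ax; rewrite fE ax mul0r.
Qed.

Lemma rat_sum (J : Type) (r : seq J) (P : pred J) (f : J -> T -> K) :
  (forall j, P j -> rat (f j)) -> rat (fun x => \sum_(j <- r | P j) f j x).
Proof.
move=> rf; elim: r => [|j r IH].
  by apply: rat_ext rat0 => x; rewrite big_nil.
case Pj: (P j); last by apply: rat_ext IH => x; rewrite big_cons Pj.
by apply: rat_ext (ratD (rf _ Pj) IH) => x; rewrite big_cons Pj.
Qed.

Lemma rat_prod (J : Type) (r : seq J) (P : pred J) (f : J -> T -> K) :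
  (forall j, P j -> rat (f j)) -> rat (fun x => \prod_(j <- r | P j) f j x).
Proof.
move=> rf; elim: r => [|j r IH].
  by apply: rat_ext rat1 => x; rewrite big_nil.
case Pj: (P j); last by apply: rat_ext IH => x; rewrite big_cons Pj.
by apply: rat_ext (ratM (rf _ Pj) IH) => x; rewrite big_cons Pj.
Qed.

Lemma rat_comp (T' I' : Type) (c' : I' -> T' -> K) (phi : T -> T') f :
  (forall i, rat (fun x => c' i (phi x))) -> kalg iota c' f ->
  rat (fun x => f (phi x)).
Proof.
move=> rc; elim=> [a|i|g h _ IHg _ IHh|g h _ IHg _ IHh].
- exact: ratC.
- exact: rc.
- exact: ratD.
- exact: ratM.
Qed.

Lemma rat_det m (A : T -> 'M[K]_m) :
  (forall i j, rat (fun x => A x i j)) -> rat (fun x => \det (A x)).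
Proof.
move=> rA; apply: rat_sum => s _; apply: ratM; last first.
  by apply: rat_prod => i _; apply: rA.
by apply: rat_ext (ratC ((-1) ^+ s)) => x _; rewrite rmorphXn rmorphN1.
Qed.

Lemma rat_invmx m (A : T -> 'M[K]_m) i j :
  (forall i j, rat (fun x => A x i j)) ->
  (forall x, S x -> A x \in unitmx) -> rat (fun x => invmx (A x) i j).
Proof.
move=> rA uA; apply: (@rat_ext (fun x => (\det (A x))^-1 *
    ((-1) ^+ (j + i) * \det (row' j (col' i (A x)))))).
  by move=> x Sx; rewrite /invmx uA // !mxE.
apply: ratM.
  by apply: ratV => [x /uA|]; [rewrite unitmxE unitfE|exact: rat_det].
apply: ratM; first by apply: rat_ext (ratC ((-1) ^+ (j + i))) => x _;
  rewrite rmorphXn rmorphN1.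
by apply: rat_det => i' j'; apply: rat_ext (rA (lift j i') (lift i j')) => x _;
  rewrite !mxE.
Qed.

Definition ratp (p : T -> {poly K}) : Prop := forall j, rat (fun x => (p x)`_j).

Lemma ratpC f : rat f -> ratp (fun x => (f x)%:P).
Proof.
move=> rf [|j]; first by apply: rat_ext rf => x _; rewrite coefC.
by apply: rat_ext rat0 => x _; rewrite coefC.
Qed.

Lemma ratpX : ratp (fun=> 'X).
Proof.
move=> j; apply: rat_ext (ratC (j == 1)%:R) => x _.
by rewrite coefX rmorph_nat.
Qed.

Lemma ratpD p q : ratp p -> ratp q -> ratp (fun x => p x + q x).
Proof. by move=> rp rq j; apply: rat_ext (ratD (rp j) (rq j)) => x _; rewrite coefD. Qed.

Lemma ratpB p q : ratp p -> ratp q -> ratp (fun x => p x - q x).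
Proof. by move=> rp rq j; apply: rat_ext (ratB (rp j) (rq j)) => x _; rewrite coefB. Qed.

Lemma ratpM p q : ratp p -> ratp q -> ratp (fun x => p x * q x).
Proof.
move=> rp rq j; apply: (@rat_ext (fun x => \sum_(i < j.+1) (p x)`_i * (q x)`_(j - i))).
  by move=> x _; rewrite coefM.
by apply: rat_sum => i _; apply: ratM.
Qed.

Lemma ratp_sum (J : Type) (r : seq J) (P : pred J) (f : J -> T -> {poly K}) :
  (forall j, P j -> ratp (f j)) -> ratp (fun x => \sum_(j <- r | P j) f j x).
Proof.
move=> rf i; apply: (@rat_ext (fun x => \sum_(j <- r | P j) (f j x)`_i)).
  by move=> x _; rewrite coef_sum.
by apply: rat_sum => j /rf.
Qed.

Lemma ratp_prod (J : Type) (r : seq J) (P : pred J) (f : J -> T -> {poly K}) :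
  (forall j, P j -> ratp (f j)) -> ratp (fun x => \prod_(j <- r | P j) f j x).
Proof.
move=> rf; elim: r => [|j r IH].
  by move=> i; apply: rat_ext (ratpC rat1 i) => x; rewrite big_nil.
case Pj: (P j); last by move=> i; apply: rat_ext (IH i) => x; rewrite big_cons Pj.
by move=> i; apply: rat_ext (ratpM (rf _ Pj) IH i) => x; rewrite big_cons Pj.
Qed.

Lemma ratp_exp p d : ratp p -> ratp (fun x => p x ^+ d).
Proof.
move=> rp; elim: d => [|d IH] j.
  by apply: rat_ext (ratpC rat1 j) => x _; rewrite expr0.
by apply: rat_ext (ratpM rp IH j) => x _; rewrite exprS.
Qed.

Lemma ratp_mpoly n (p : {mpoly k[n]}) (v : 'I_n -> T -> {poly K}) :
  (forall i, ratp (v i)) ->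
  ratp (fun x => mmap (polyC \o iota) (v^~ x) p).
Proof.
move=> rv; apply: ratp_sum => mm _; apply: ratpM; first exact/ratpC/ratC.
by apply: ratp_prod => i _; apply: ratp_exp.
Qed.
End RationalFunctions.

Section AffineSubspaces.
Variables (k K : fieldType) (iota : {rmorphism k -> K}).
Variables (T : choiceType) (I : Type) (c : I -> T -> K) (Z : pred T).

Definition aff_sub : kspace K :=
  aff_space iota (fun i (x : {x | Z x}) => c i (val x)).

Lemma aff_sub_kaxioms : kaxioms iota aff_sub.
Proof. exact: aff_kaxioms. Qed.

Lemma kalg_sub (f : T -> K) : kalg iota c f ->
  kalg iota (fun i (x : {x | Z x}) => c i (val x)) (fun x => f (val x)).
Proof.
by apply: kalg_comp => i; exact: (kalgX _ (fun i (x : {x | Z x}) => c i (val x))).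
Qed.

(** Extends a polynomial function from the subset to the ambient set, where [kalg_symmetrize]
    applies. *)
Lemma kalg_subE (f : {x | Z x} -> K) :
  kalg iota (fun i (x : {x | Z x}) => c i (val x)) f ->
  exists2 g, kalg iota c g & forall x, f x = g (val x).
Proof.
elim=> [a|i|g h _ [g' kg gE] _ [h' kh hE]|g h _ [g' kg gE] _ [h' kh hE]].
- by exists (fun=> iota a) => //; exact: kalgC.
- by exists (c i) => //; exact: kalgX.
- by exists (fun x => g' x + h' x) => [|x]; [exact: kalgD|rewrite gE hE].
- by exists (fun x => g' x * h' x) => [|x]; [exact: kalgM|rewrite gE hE].
Qed.

Lemma rat_regular (S : T -> Prop) (U : aff_sub -> Prop) f :
  (forall x, U x -> S (val x)) -> rat iota c S f ->
  regular aff_sub U (fun x => f (val x)).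
Proof.
move=> US [g [h [kg kh E]]] x Ux.
have kg' := kalg_sub kg; have kh' := kalg_sub kh.
exists (fun=> True), (fun x => g (val x)), (fun x => h (val x)); split=> //.
  by case: (E _ (US x Ux)).
by move=> y Uy _ _; case: (E _ (US y Uy)).
Qed.

End AffineSubspaces.

(** * Descent from ordered roots to coefficients *)

Section RootDescent.
Variables (k K : fieldType) (iota : {rmorphism k -> K}).
Variables (W : choiceType) (I : Type) (cW : I -> W -> K) (m : nat).
Variables (ZN ZM : pred (W * 'rV[K]_m)%type).

Definition perm_row (s : 'S_m) (t : 'rV[K]_m) : 'rV[K]_m := \row_i t 0 (s i).

Hypothesis ZN_inj : forall w t, ZN (w, t) -> injective (t 0).
Hypothesis ZN_perm : forall w t s, ZN (w, t) -> ZN (w, perm_row s t).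
Hypothesis ZNM : forall w t, ZN (w, t) -> ZM (w, sym_coefs t).
Hypothesis ZM_lift :
  forall w p, ZM (w, p) -> exists2 t, ZN (w, t) & sym_coefs t = p.

Local Notation crd := (pair_coord cW (m := m)).
Let N := aff_sub iota crd ZN.
Let M := aff_sub iota crd ZM.

Lemma sym_coefs_perm s (t : 'rV[K]_m) : sym_coefs (perm_row s t) = sym_coefs t.
Proof.
rewrite /sym_coefs; suff -> : roots_poly (perm_row s t) = roots_poly t by [].
rewrite /roots_poly [RHS](reindex_inj (@perm_inj _ s)) /=.
by apply: eq_bigr => i _; rewrite mxE.
Qed.

Definition root_map (z : N) : M :=
  exist (fun x => ZM x) ((val z).1, sym_coefs (val z).2)
    (ZNM (eq_ind _ (fun x => ZN x) (valP z) _ (surjective_pairing _))).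

(* Openness and regularity descend along root_map: weighted by a monomial that
   separates the orderings of the roots, local numerators and denominators are
   summed over all permutations. *)
Lemma root_descent_open (V : M -> Prop) :
  opens N (fun z => V (root_map z)) -> opens M V.
Proof.
move=> oV [[w p] Zp] Vp; have [t Zt tp] := ZM_lift Zp.
pose z : N := exist (fun x => ZN x) (w, t) Zt.
have zE : root_map z = exist (fun x => ZM x) (w, p) Zp.
  by apply: val_inj; rewrite /= tp.
have [|V0 [g [h [[VT [_ kh]] _ hz hV]]]] := oV z; first by rewrite zE.
have {kh}[h' kh hE] := kalg_subE kh.
have h1 : h' (w, perm_row 1%g t) != 0.
  rewrite (_ : perm_row _ _ = t); first by rewrite -(hE z).
  by apply/rowP => i; rewrite mxE perm1.
have [e he] := separating_weight (h := fun s => h' (w, perm_row s t))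
  (ZN_inj Zt) h1.
pose Phi (z : W * 'rV[K]_m) := (\prod_i z.2 0 i ^+ e i) * h' z.
have kPhi : kalg iota crd Phi.
  apply: kalgM kh; apply: kalg_prod => i _; apply: kalg_exp.
  exact: (kalgX _ crd (inr i)).
have [Th kTh ThE] := kalg_symmetrize kPhi.
have PhiE w' t' : Th (w', sym_coefs t') =
    \sum_(s : 'S_m) (\prod_i t' 0 (s i) ^+ e i) * h' (w', perm_row s t').
  rewrite -ThE; apply: eq_bigr => s _; congr (_ * _).
  by apply: eq_bigr => i _; rewrite mxE.
exists (fun=> True), (fun=> 0), (fun x => Th (val x)); split=> //.
- by split=> //; split; [exact: kalg0|exact: kalg_sub].
- by rewrite /= -tp PhiE.
move=> [[w' p'] Zp'] _ /=; have [t' Zt' tp'] := ZM_lift Zp'.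
rewrite -{1}tp' PhiE => /eqP nz.
have [s hs] : exists s, h' (w', perm_row s t') != 0.
  apply/existsP; apply: contra_notT nz; rewrite negb_exists => /forallP h0.
  by rewrite big1 // => s _; have /negPn/eqP-> := h0 s; rewrite mulr0.
pose z' : N := exist (fun x => ZN x) (w', perm_row s t') (ZN_perm s Zt').
have <- : root_map z' = exist (fun x => ZM x) (w', p') Zp'.
  by apply: val_inj; rewrite /= sym_coefs_perm tp'.
by apply: hV => //; rewrite hE.
Qed.

Lemma root_descent_regular (V : M -> Prop) f :
  regular N (fun z => V (root_map z)) (fun z => f (root_map z)) ->
  regular M V f.
Proof.
move=> rf [[w p] Zp] Vp; have [t Zt tp] := ZM_lift Zp.
pose z : N := exist (fun x => ZN x) (w, t) Zt.
have zE : root_map z = exist (fun x => ZM x) (w, p) Zp.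
  by apply: val_inj; rewrite /= tp.
have [|V0 [g [h [[VT [kg kh]] _ hz hV]]]] := rf z; first by rewrite zE.
have {kh}[h' kh hE] := kalg_subE kh; have {kg}[g' kg gE] := kalg_subE kg.
(* The denominator enters squared: f h^2 = g h holds at every ordering of the roots, also where h
   vanishes, whereas f h = g is only known where h does not. The identity can therefore be summed
   over all orderings. *)
have h1 : h' (w, perm_row 1%g t) ^+ 2 != 0.
  rewrite (_ : perm_row _ _ = t); first by rewrite -(hE z) expf_neq0.
  by apply/rowP => i; rewrite mxE perm1.
have [e he] := separating_weight (h := fun s => h' (w, perm_row s t) ^+ 2)
  (ZN_inj Zt) h1.
pose Phi q (z : W * 'rV[K]_m) := (\prod_i z.2 0 i ^+ e i) * q z.
have kPhi q : kalg iota crd q -> kalg iota crd (Phi q).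
  move=> kq; apply: kalgM kq; apply: kalg_prod => i _; apply: kalg_exp.
  exact: (kalgX _ crd (inr i)).
have [Th kTh ThE] := kalg_symmetrize (kPhi _ (kalg_exp 2 kh)).
have [Th' kTh' ThE'] := kalg_symmetrize (kPhi _ (kalgM kg kh)).
have PhiE w' t' : Th (w', sym_coefs t') =
    \sum_(s : 'S_m) (\prod_i t' 0 (s i) ^+ e i) * h' (w', perm_row s t') ^+ 2.
  rewrite -ThE; apply: eq_bigr => s _; congr (_ * _).
  by apply: eq_bigr => i _; rewrite mxE.
exists (fun=> True), (fun x => Th' (val x)), (fun x => Th (val x)); split=> //.
- by split=> //; split; exact: kalg_sub.
- by rewrite /= -tp PhiE.
move=> [[w' p'] Zp'] Vp' _ /=; have [t' Zt' tp'] := ZM_lift Zp'.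
move=> nz; apply: canRL (mulfK nz) _.
have -> : Th (w', p') = Th (w', sym_coefs t') by rewrite tp'.
have -> : Th' (w', p') = Th' (w', sym_coefs t') by rewrite tp'.
rewrite -ThE -ThE' mulr_sumr; apply: eq_bigr => s _.
pose z' : N := exist (fun x => ZN x) (w', perm_row s t') (ZN_perm s Zt').
have zE' : root_map z' = exist (fun x => ZM x) (w', p') Zp'.
  by apply: val_inj; rewrite /= sym_coefs_perm tp'.
rewrite -zE' /Phi mulrCA; congr (_ * _).
have [h0|h0] := eqVneq (h' (w', perm_row s t')) 0.
  by rewrite h0 expr0n /= !mulr0.
rewrite (hV z') //; [|by rewrite zE'|by rewrite hE].
by rewrite hE gE /= expr2 mulrA divfK.
Qed.

Lemma morphism_on_root_descent (Y : kspace K) (phi : M -> Y) :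
  morphism_on (X := N) (fun=> True) (fun z => phi (root_map z)) ->
  morphism_on (X := M) (fun=> True) phi.
Proof.
move=> mphi V oV; have [o r] := mphi V oV; split; first exact: root_descent_open.
by move=> f /r rf; apply: root_descent_regular.
Qed.
End RootDescent.

(** * Descent from ordered tuples to the symmetric product *)

Section SymmetricDescent.
Variables (k K : fieldType) (iota : {rmorphism k -> K}).
Variables (X P : kspace K) (kX : kaxioms iota X) (kP : kaxioms iota P).
Variables (X0 : X -> Prop) (P0 : P -> Prop) (oX0 : opens X X0) (oP0 : opens P P0).
Variables (I J : Type) (cX : I -> X -> K) (cP : J -> P -> K).
Hypothesis rX : forall i, regular X X0 (cX i).
Hypothesis rP : forall j, regular P P0 (cP j).
Variables (m : nat) (m_gt0 : (0 < m)%N) (m_fact : (m`!)%:R != 0 :> K).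

Local Notation Xm := {ffun 'I_m -> X}.
Local Notation S := (sym_product X m).
Local Notation A := (prod_space S P).

Definition ffun_coord (i : (I * 'I_m) + J) (z : Xm * P) : K :=
  match i with inl il => cX il.1 (z.1 il.2) | inr j => cP j z.2 end.

Definition sym_class (x : Xm) : S := \pi_({eq_quot (same_orbit_equiv X m)}) x.
Definition sym_lift (s : S) : Xm := generic_quotient.repr s.

Lemma sym_liftK s : sym_class (sym_lift s) = s.
Proof. exact: reprK. Qed.

Lemma sym_class_perm x s : sym_class (perm_ffun s x) = sym_class x.
Proof.
apply/esym/eqmodP/existsP; exists s.
exact: eqxx.
Qed.

Lemma sym_classK x : exists s, sym_lift (sym_class x) = perm_ffun s x.
Proof.
have /esym/eqmodP/existsP[s /eqP E] := sym_liftK (sym_class x).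
by exists s.
Qed.

Lemma perm_ffunM s t (x : Xm) : perm_ffun s (perm_ffun t x) = perm_ffun (s * t)%g x.
Proof. by apply/ffunP => i; rewrite !ffunE permM. Qed.

Definition affine_locus (z : A) : Prop :=
  (forall i, X0 (sym_lift z.1 i)) /\ P0 z.2.

Lemma affine_locus_class x y :
  affine_locus (sym_class x, y) <-> (forall i, X0 (x i)) /\ P0 y.
Proof.
have [s xs] := sym_classK x; rewrite /affine_locus /= xs.
split=> -[Xx Py]; split=> // i; last by rewrite ffunE.
by have := Xx (s^-1 i)%g; rewrite ffunE permKV.
Qed.

Lemma opens_box (U : X -> Prop) : opens X U -> opens S (fun s => forall i, U (sym_lift s i)).
Proof.
move=> oU; have kS := power_space_kaxioms kX m_gt0.
have oB : opens (power_space X m) (fun x : Xm => forall i, U (x i)).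
  move=> x Ux; exists (fun x : Xm => forall i, U (x i)), (fun=> 0), (fun=> 1).
  split; rewrite ?oner_neq0 //; exists (fun _ => U); split=> //.
    by rewrite -(rmorph0 iota); apply: (power_tensorC kX (Ordinal m_gt0)).
  by rewrite -(rmorph1 iota); apply: (power_tensorC kX (Ordinal m_gt0)).
apply: opens_ext oB => x; have [s xs] := sym_classK x.
rewrite -/(sym_class x) xs; split=> Ux i; first by rewrite ffunE.
by have := Ux (s^-1 i)%g; rewrite ffunE permKV.
Qed.

Lemma opens_affine_locus : opens A affine_locus.
Proof.
have kS := sym_product_kaxioms kX m_gt0.
move=> z [Xz Pz]; exists affine_locus, (fun=> iota 1), (fun=> iota 1).
split=> //; last by rewrite rmorph1 oner_neq0.
have T1 : prod_tensor (fun s : S => forall i, X0 (sym_lift s i)) P0 (fun=> iota 1).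
  apply: (@prod_tensor_fin _ S P 'I_1 _ _ (fun _ _ => iota 1) (fun _ _ => iota 1)).
  - by move=> _; apply: (regularC kS).
  - by move=> _; apply: (regularC kP).
  - by move=> x y; rewrite big_ord1 rmorph1 mulr1.
exists (fun s : S => forall i, X0 (sym_lift s i)), P0; split=> //.
exact: opens_box.
Qed.

(** A polynomial in the coordinates is a sum of products with one factor for each of the m points
    and one for P, which is the shape that [power_tensor] and [prod_tensor] require. *)
Lemma kalg_ffun_normal Phi : kalg iota ffun_coord Phi ->
  exists (R : finType) (a : R -> 'I_m -> X -> K) (b : R -> P -> K),
    [/\ forall j i, regular X X0 (a j i), forall j, regular P P0 (b j)
      & forall x y, Phi (x, y) = \sum_j (\prod_i a j i (x i)) * b j y].
Proof.
elim=> [c|[[i l]|j]|f g _ [R [a [b [ra rb E]]]] _ [R' [a' [b' [ra' rb' E']]]]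
       |f g _ [R [a [b [ra rb E]]]] _ [R' [a' [b' [ra' rb' E']]]]].
- exists 'I_1, (fun _ _ _ => iota 1), (fun _ _ => iota c); split=> [_ _|_|x y].
  + exact: (regularC kX).
  + exact: (regularC kP).
  + by rewrite big_ord1 big1 ?mul1r // => *; rewrite rmorph1.
- exists 'I_1, (fun _ l' x => if l' == l then cX i x else iota 1),
    (fun _ _ => iota 1); split=> [_ l'|_|x y].
  + by case: (l' == l); [exact: rX|exact: (regularC kX)].
  + exact: (regularC kP).
  + rewrite big_ord1 (bigD1 l) //= eqxx big1 ?rmorph1 ?mulr1 // => l'.
    by move=> /negPf->.
- exists 'I_1, (fun _ _ _ => iota 1), (fun _ => cP j); split=> [_ _|_|x y].
  + exact: (regularC kX).
  + exact: rP.
  + by rewrite big_ord1 big1 ?mul1r // => *; rewrite rmorph1.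
- exists (R + R')%type, (fun j => match j with inl i => a i | inr i => a' i end),
    (fun j => match j with inl i => b i | inr i => b' i end); split.
  + by case.
  + by case.
  + by move=> x y; rewrite E E' big_sumType.
- exists (R * R')%type, (fun j i x => a j.1 i x * a' j.2 i x),
    (fun j y => b j.1 y * b' j.2 y); split.
  + by move=> j i; apply: (regularM kX).
  + by move=> j; apply: (regularM kP).
  move=> x y; rewrite E E' mulr_suml -(pair_bigA _ (fun i j =>
    (\prod_l (a i l (x l) * a' j l (x l))) * (b i y * b' j y))) /=.
  apply: eq_bigr => i _; rewrite mulr_sumr; apply: eq_bigr => j _.
  by rewrite mulrACA -big_split.
Qed.

Definition sym_sum (Phi : Xm * P -> K) (z : A) : K :=
  \sum_(s : 'S_m) Phi (perm_ffun s (sym_lift z.1), z.2).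

Lemma sym_sum_class Phi x y :
  sym_sum Phi (sym_class x, y) = \sum_(s : 'S_m) Phi (perm_ffun s x, y).
Proof.
rewrite /sym_sum /=; have [t ->] := sym_classK x.
by rewrite [RHS](reindex_inj (mulIg t)) /=; apply: eq_bigr => s _; rewrite perm_ffunM.
Qed.

(** The permutations leave the factors on P alone, so summing over them turns each product over the
    m points into a function on Sym^m(X), and the total is again a tensor. *)
Lemma sym_sum_regular Phi : kalg iota ffun_coord Phi ->
  regular A affine_locus (sym_sum Phi).
Proof.
have kS := sym_product_kaxioms kX m_gt0.
move=> /kalg_ffun_normal[R [a [b [ra rb E]]]] z [Xz Pz].
exists affine_locus, (sym_sum Phi), (fun=> iota 1); split=> //.
- exists (fun s : S => forall i, X0 (sym_lift s i)), P0; split=> //.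
  + exact: opens_box.
  + pose B j (s : S) := \sum_(t : 'S_m) \prod_i a j i (perm_ffun t (sym_lift s) i).
    apply: (@prod_tensor_fin _ S P R _ _ B b) => //.
      move=> j; rewrite /=/quot_regular /=.
      move=> x Xx; exists (fun x : Xm => forall i, X0 (x i)).
      (* Reindexing by the inverse moves the permutation from the points to the factors, so that the
         i-th factor depends on [x i] as in [power_tensor]. *)
      exists (fun x : Xm => \sum_(t : 'S_m) \prod_i a j (t^-1 i)%g (x i)), (fun=> iota 1).
      split=> //; last 2 first.
      * by rewrite rmorph1 oner_neq0.
      * move=> y _ _ _; rewrite rmorph1 divr1 /B.
        have [s ->] := sym_classK y.
        rewrite [RHS](reindex_inj (mulIg s)) /=; apply: eq_bigr => t _.
        rewrite [RHS](reindex_inj (@perm_inj _ (t * s)%g)) /=.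
        by apply: eq_bigr => i _; rewrite permK perm_ffunM ffunE.
      * exists (fun=> X0); split=> //; last exact: (power_tensorC kX (Ordinal m_gt0)).
        by apply: (@power_tensor_fin _ X m 'S_m _ (fun t i => a j (t^-1 i)%g)).
      * have [s xs] := sym_classK x; move: Xx; rewrite -/(sym_class x) xs => Xx i.
        by have := Xx (s^-1 i)%g; rewrite ffunE permKV.
    move=> s y; transitivity (\sum_(t : 'S_m) \sum_j
        (\prod_i a j i (perm_ffun t (sym_lift s) i)) * b j y).
      by apply: eq_bigr => t _; rewrite E.
    by rewrite exchange_big /=; apply: eq_bigr => j _; rewrite mulr_suml.
  + apply: (@prod_tensor_fin _ S P 'I_1 _ _ (fun _ _ => iota 1) (fun _ _ => iota 1)).
    * by move=> _; apply: (regularC kS).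
    * by move=> _; apply: (regularC kP).
    * by move=> x y; rewrite big_ord1 rmorph1 mulr1.
- by rewrite rmorph1 oner_neq0.
- by move=> y _ _ _; rewrite rmorph1 divr1.
Qed.

Lemma kalg_perm Phi s : kalg iota ffun_coord Phi ->
  kalg iota ffun_coord (fun z => Phi (perm_ffun s z.1, z.2)).
Proof.
apply: kalg_comp => -[[i l]|j].
  apply: kalg_ext (kalgX _ ffun_coord (inl (i, s l))) => z /=.
  by rewrite ffunE.
exact: (kalgX _ ffun_coord (inr j)).
Qed.

Definition sym_norm (D : Xm * P -> K) (z : Xm * P) : K :=
  \prod_(s : 'S_m) D (perm_ffun s z.1, z.2).

Lemma sym_norm_perm D x y s : sym_norm D (perm_ffun s x, y) = sym_norm D (x, y).
Proof.
rewrite /sym_norm /= [RHS](reindex_inj (mulIg s)) /=.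
by apply: eq_bigr => t _; rewrite perm_ffunM.
Qed.

Lemma sym_sum_norm D x y :
  sym_sum (sym_norm D) (sym_class x, y) = sym_norm D (x, y) *+ m`!.
Proof.
rewrite sym_sum_class (eq_bigr (fun=> sym_norm D (x, y))).
  by rewrite sumr_const card_Sn.
by move=> s _; apply: sym_norm_perm.
Qed.

(** The nonvanishing of D is invariant, so D and its norm over S_m vanish at the same points. The
    norm is symmetric, and its sum over S_m is m! times itself, hence regular on the quotient with
    the same zeros. *)
Lemma sym_open (D : Xm * P -> K) : kalg iota ffun_coord D ->
  (forall x y s, D (x, y) != 0 -> D (perm_ffun s x, y) != 0) ->
  opens A (fun z => affine_locus z /\ D (sym_lift z.1, z.2) != 0).
Proof.
move=> kD Dperm; have kA := prod_space_kaxioms (sym_product_kaxioms kX m_gt0) kP.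
have kN : kalg iota ffun_coord (sym_norm D).
  by apply: kalg_prod => s _; exact: kalg_perm.
apply: opens_ext (opens_neq0 kA opens_affine_locus (sym_sum_regular kN)) => -[s y].
rewrite -{2}[s]sym_liftK sym_sum_norm -mulr_natr mulf_eq0 negb_or m_fact andbT.
split=> -[Az Dz]; split=> //=; last first.
  by apply/prodf_neq0 => t _; apply: Dperm.
move/prodf_neq0: Dz => /(_ 1%g isT) /=.
by rewrite (_ : perm_ffun 1 _ = sym_lift s) //; apply/ffunP => i; rewrite ffunE perm1.
Qed.

(* Multiplying f by the norm of the denominator makes both sides symmetric;
   averaging over the permutations then needs m! to be invertible. *)
Lemma sym_descent_regular (U : A -> Prop) (f : A -> K) (F : Xm * P -> K) :
  opens A U -> (forall z, U z -> affine_locus z) ->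
  rat iota ffun_coord (fun z => U (sym_class z.1, z.2)) F ->
  (forall x y, U (sym_class x, y) -> f (sym_class x, y) = F (x, y)) ->
  regular A U f.
Proof.
move=> oU UA [g [h [kg kh E]]] fF.
have kA := prod_space_kaxioms (sym_product_kaxioms kX m_gt0) kP.
pose h' z := \prod_(s : 'S_m | s != 1%g) h (perm_ffun s z.1, z.2).
have p1 (x : Xm) : perm_ffun 1 x = x by apply/ffunP => i; rewrite ffunE perm1.
have hE x y : sym_norm h (x, y) = h (x, y) * h' (x, y).
  by rewrite /sym_norm (bigD1 1%g) //= p1.
have kh' : kalg iota ffun_coord h' by apply: kalg_prod => s _; exact: kalg_perm.
have kn : kalg iota ffun_coord (sym_norm h).
  by apply: kalg_prod => s _; exact: kalg_perm.
have rn := regularS kA (sym_sum_regular kn) UA.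
have rg := regularS kA (sym_sum_regular (kalgM kg kh')) UA.
have n0 z : U z -> sym_sum (sym_norm h) z != 0.
  case: z => s y Uz; rewrite -[s]sym_liftK sym_sum_norm -mulr_natr mulf_neq0 //.
  apply/prodf_neq0 => t _ /=; have [|//] := E (perm_ffun t (sym_lift s), y).
  by rewrite /= sym_class_perm sym_liftK.
have rq := regularM kA rg (regularV kA oU rn n0).
apply: (regularE kA _ rq) => -[s y] Uz.
apply/esym; apply: canRL (mulfK (n0 _ Uz)) _.
rewrite -[s]sym_liftK in Uz *; rewrite !sym_sum_class mulr_sumr.
apply: eq_bigr => t _; rewrite hE.
have Ut : U (sym_class (perm_ffun t (sym_lift s)), y) by rewrite sym_class_perm.
rewrite -(sym_class_perm _ t) fF //; have [hz ->] := E (_, y) Ut.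
by rewrite mulrA divfK.
Qed.
End SymmetricDescent.

(** * Cubic polynomials without rational roots *)

Section RationalRoots.
Import Pdiv.Idomain.

(** This is b^n P(a / b) cleared of denominators: it expresses within R that a / b is a root in the
    fraction field. *)
Definition hom_horner (R : nzRingType) n (P : {poly R}) (a b : R) : R :=
  \sum_(i < n.+1) P`_i * a ^+ i * b ^+ (n - i).

Lemma hom_hornerZ (R : comNzRingType) n (P : {poly R}) (a b c : R) :
  hom_horner n P (a * c) (b * c) = hom_horner n P a b * c ^+ n.
Proof.
rewrite /hom_horner mulr_suml; apply: eq_bigr => i _.
have -> : c ^+ n = c ^+ i * c ^+ (n - i) by rewrite -exprD subnKC // -ltnS.
by rewrite !exprMn; ring.
Qed.

Lemma hom_horner1 (R : comNzRingType) n (P : {poly R}) a : (size P <= n.+1)%N ->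
  hom_horner n P a 1 = P.[a].
Proof.
move=> sP; rewrite (horner_coef_wide _ sP); apply: eq_bigr => i _.
by rewrite expr1n mulr1.
Qed.

(** The rational root theorem over D[T], where gcds exist only up to constants of D. In lowest terms
    the denominator divides a power of the numerator, P being monic, and is coprime to it; hence it
    is a constant e. *)
Lemma monic_rational_root (D : idomainType) n (P : {poly {poly D}}) (a b : {poly D}) :
  size P = n.+1 -> P \is monic -> b != 0 -> hom_horner n P a b = 0 ->
  exists e a', e != 0 /\ e *: a = a' * b.
Proof.
move=> sP mP b0 E; pose g := gcdp a b.
have g0 : g != 0 by rewrite gcdp_eq0 negb_and b0 orbT.
have [u u0 aE] : exists2 u, u != 0 & u *: a = a %/ g * g.
  have := dvdp_gcdl a b; rewrite dvdp_eq => /eqP<-.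
  by eexists; last reflexivity; rewrite expf_neq0 // lead_coef_eq0.
have [v v0 bE] : exists2 v, v != 0 & v *: b = b %/ g * g.
  have := dvdp_gcdr a b; rewrite dvdp_eq => /eqP<-.
  by eexists; last reflexivity; rewrite expf_neq0 // lead_coef_eq0.
(* The constants u and v from the pseudo-divisions are exchanged, so that a and b are multiplied by
   the same constant u v. *)
pose a1 := v *: (a %/ g); pose b1 := u *: (b %/ g).
have aE' : (u * v) *: a = a1 * g by rewrite mulrC -scalerA aE scalerAl.
have bE' : (u * v) *: b = b1 * g by rewrite -scalerA bE scalerAl.
have cop : coprimep b1 a1.
  rewrite /a1 /b1 coprimepZl // coprimepZr // coprimep_sym.
  by apply: coprimep_div_gcd; rewrite b0 orbT.
have E1 : hom_horner n P a1 b1 = 0.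
  have := hom_hornerZ n P a1 b1 g; rewrite -aE' -bE' -!mul_polyC.
  rewrite ![_%:P * _]mulrC hom_hornerZ E mul0r => /esym/eqP.
  by rewrite mulf_eq0 expf_eq0 (negPf g0) andbF orbF => /eqP.
have : b1 %| 1 * a1 ^+ n.
  rewrite mul1r; move: E1; rewrite /hom_horner big_ord_recr /= subnn mulr1.
  have -> : P`_n = 1 by rewrite -(monicP mP) lead_coefE sP.
  rewrite mul1r addrC => /eqP; rewrite addr_eq0 => /eqP->.
  rewrite dvdpNr; apply: (big_ind (fun p => b1 %| p)) => [|p q dp dq|i _]; first exact: dvdp0.
    exact: dvdp_add.
  by rewrite dvdp_mull // -(subnSK (ltn_ord i)) exprS dvdp_mulr.
rewrite Gauss_dvdpl ?coprimep_expr // dvdp1 => /size_poly1P[e e0 b1E].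
exists e, a1; split=> //; apply: (mulfI (x := (u * v)%:P)).
  by rewrite polyC_eq0 mulf_neq0.
rewrite mul_polyC scalerA mulrC -scalerA aE' mulrCA mul_polyC bE' b1E.
by rewrite -mul_polyC; ring.
Qed.
End RationalRoots.

Section CubicFactors.
Import Pdiv.Idomain.

Lemma cubic_linear_factor (R : idomainType) (f q l : {poly R}) c :
  size f = 4 -> size l = 2 -> c != 0 -> c *: f = q * l ->
  hom_horner 3 f (- l`_0) l`_1 = 0.
Proof.
move=> sf sl c0 E.
have [l0 q0] : l != 0 /\ q != 0.
  have f0 : f != 0 by rewrite -size_poly_eq0 sf.
  by split; apply: contra_neq f0 => z; move/eqP: E;
    rewrite z ?mul0r ?mulr0 scale_poly_eq0 (negPf c0) => /eqP.
have sq : (size q <= 3)%N.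
  have := congr1 (size : {poly R} -> nat) E; rewrite size_scale // sf size_mul // sl.
  by lia.
have qi i : (2 < i)%N -> q`_i = 0 by move=> i2; rewrite nth_default ?(leq_trans sq).
have li i : (1 < i)%N -> l`_i = 0 by move=> i1; rewrite nth_default ?sl.
have fE i : c * f`_i = \sum_(j < i.+1) q`_j * l`_(i - j) by rewrite -coefZ E coefM.
apply: (mulfI c0); rewrite mulr0 /hom_horner !big_ord_recr big_ord0 /= /bump /=.
have := (fE 0, fE 1, fE 2, fE 3); rewrite !big_ord_recr !big_ord0 /= /bump /=.
rewrite !(subn0, subSS) (li 2) // (li 3) // (qi 3) // => -[[[f0 f1] f2] f3].
by rewrite !mulrDr !mulrA f0 f1 f2 f3; ring.
Qed.

(** If the resultant vanishes, the gcd has positive degree. In degree 1 or 2 the gcd or its cofactor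
    is a linear factor of f and gives a root in the fraction field; in degree 3 it is f itself up to
    constants, and f divides g. *)
Lemma resultant_cubic (R : idomainType) (f g : {poly R}) :
  size f = 4 -> (forall a b, b != 0 -> hom_horner 3 f a b != 0) ->
  ~~ (f %| g) -> resultant f g != 0.
Proof.
move=> sf irr; apply: contraNN; rewrite resultant_eq0; set d := gcdp f g => sd.
have f0 : f != 0 by rewrite -size_poly_eq0 sf.
have d0 : d != 0 by rewrite gcdp_eq0 negb_and f0.
have /dvdpP[[c q] /= c0 E] : d %| f := dvdp_gcdl f g.
have q0 : q != 0.
  apply: contra_neq f0 => z; move/eqP: E.
  by rewrite z mul0r scale_poly_eq0 (negPf c0) => /eqP.
have no_lin (l q' : {poly R}) : size l = 2 -> c *: f = q' * l -> False.
  move=> sl E'; have l1 : l`_1 != 0.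
    rewrite (_ : l`_1 = lead_coef l); last by rewrite lead_coefE sl.
    by rewrite lead_coef_eq0 -size_poly_eq0 sl.
  by have := irr (- l`_0) _ l1; rewrite (cubic_linear_factor sf sl c0 E') eqxx.
have := congr1 (size : {poly R} -> nat) E.
rewrite size_scale // sf size_mul // => sE.
have d_le : (size d <= 4)%N by apply: leq_trans (dvdp_leq f0 (dvdp_gcdl f g)) _; rewrite sf.
case: (ltngtP (size d) 4) => [d4|d4|d4].
- case: (ltngtP (size d) 2) => [d2|d2|d2].
  + by move: sd d2; case: (size d) => [|[|]].
  + have sq : size q = 2 by lia.
    by case: (no_lin q d sq); rewrite E mulrC.
  + by case: (no_lin d q d2 E).
- by move: d4; rewrite ltnNge d_le.
- have: d %= f by rewrite -dvdp_size_eqp ?dvdp_gcdl // d4 sf.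
  by move=> /eqp_dvdl<-; apply: dvdp_gcdr.
Qed.

(** Induction on the degree: a = a(n0) + q (T - n0), and e divides q(n) (n - n0) for the later
    integers n, where n - n0 is a unit in characteristic 0. It serves to cancel a denominator that
    is seen only after specialisation. *)
Lemma dvdp_coefs (K : fieldType) (e : {poly K}) (a : {poly {poly K}}) :
  [pchar K] =i pred0 -> (forall n, e %| a.[n%:R]) -> exists s, a = e *: s.
Proof.
move=> /pcharf0P char0 ea0.
(* The threshold n0 has to move: divisibility of the values of the quotient by T - n0 is only
   obtained beyond n0. *)
suff H d n0 (b : {poly {poly K}}) : (size b <= d)%N ->
    (forall n, (n0 <= n)%N -> e %| b.[n%:R]) -> exists s, b = e *: s.
  exact: (H (size a) 0%N).
elim: d => [|d IH] in n0 b *.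
  by rewrite size_poly_leq0 => /eqP-> _; exists 0; rewrite scaler0.
move=> sa ea; pose c : {poly K} := n0%:R.
have /factor_theorem[q qE] : root (b - (b.[c])%:P) c.
  by rewrite rootE !hornerE subrr.
have bE : b = (b.[c])%:P + q * ('X - c%:P) by rewrite -qE addrC subrK.
have sq : (size q <= d)%N.
  have [->|q0] := eqVneq q 0; first by rewrite size_poly0.
  have : (size (b - (b.[c])%:P)%R <= d.+1)%N.
    rewrite (leq_trans (size_polyD _ _)) // geq_max sa size_polyN.
    by rewrite (leq_trans (size_polyC_leq1 _)).
  by rewrite qE size_mul ?polyXsubC_eq0 // size_XsubC addn2.
have [n n0n|s qs] := IH n0.+1 q sq.
  have /ea := ltnW n0n; rewrite {1}bE !hornerE.
  rewrite dvdp_addr; last exact: ea.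
  have -> : n%:R - c = ((n - n0)%:R : K)%:P.
    by rewrite polyCMn /c -natrB // ltnW.
  rewrite mulrC mul_polyC dvdpZr // char0 subn_eq0 -ltnNge //.
have /Pdiv.Field.dvdpP[r rE] := ea n0 (leqnn _).
exists (r%:P + s * ('X - c%:P)); rewrite {1}bE /c rE qs -!mul_polyC polyCM.
by ring.
Qed.
End CubicFactors.

(** * Polynomials restricted to lines and curves *)

Section MpolyTools.

Lemma mpoly_alg_ind n (R : comNzRingType) (P : {mpoly R[n]} -> Prop) :
  (forall c, P c%:MP) -> (forall i, P 'X_i) ->
  (forall p q, P p -> P q -> P (p + q)) -> (forall p q, P p -> P q -> P (p * q)) ->
  forall p, P p.
Proof.
move=> PC PX PD PM p; rewrite (mpolyE p).
apply: (big_ind P) => [|//|mm _]; first by rewrite -mpolyC0.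
rewrite -mul_mpolyC; apply: (PM _ _) => //; rewrite mpolyXE_id.
apply: (big_ind P) => [|q r Pq Pr|i _]; [by rewrite -mpolyC1|exact: PM|].
by elim: (mm i) => [|d IH]; rewrite ?expr0 -?mpolyC1 // exprS; apply: PM.
Qed.

Lemma rmorph_mmap n (R S T : comNzRingType) (f : R -> S)
    (g : {rmorphism S -> T}) (w : 'I_n -> S) p :
  g (mmap f w p) = mmap (g \o f) (fun i => g (w i)) p.
Proof.
rewrite rmorph_sum; apply: eq_bigr => mm _; rewrite rmorphM; congr (_ * _).
by rewrite rmorph_prod; apply: eq_bigr => i _; rewrite rmorphXn.
Qed.

Lemma eq_mmap n (R S : nzRingType) (f g : R -> S) (v w : 'I_n -> S) p :
  f =1 g -> v =1 w -> mmap f v p = mmap g w p.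
Proof.
move=> fg vw; apply: eq_bigr => mm _; rewrite fg; congr (_ * _).
by apply: eq_bigr => i _; rewrite vw.
Qed.

Lemma meval_map_mpoly n (R S : comNzRingType) (f : {rmorphism R -> S})
    (w : 'I_n -> S) p : (map_mpoly f p).@[w] = mmap f w p.
Proof.
elim/mpoly_alg_ind: p => [c|i|p q Hp Hq|p q Hp Hq].
- by rewrite map_mpolyC mevalC mmapC.
- by rewrite map_mpolyX mevalXU mmapX mmap1U.
- by rewrite !raddfD /= Hp Hq.
- by rewrite !rmorphM /= Hp Hq.
Qed.

Lemma meval_map_mpoly_image n (R S : comNzRingType) (f : {rmorphism R -> S})
    (w : 'I_n -> R) p : (map_mpoly f p).@[fun i => f (w i)] = f p.@[w].
Proof. by rewrite meval_map_mpoly rmorph_mmap; apply: eq_mmap. Qed.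

Lemma horner_mmap n (R S : comNzRingType) (f : R -> S) (w : 'I_n -> {poly S}) p x :
  (mmap (polyC \o f) w p).[x] = mmap f (fun i => (w i).[x]) p.
Proof.
rewrite -/(horner_eval x _) (rmorph_mmap _ (horner_eval x)).
by apply: eq_mmap => c //=; rewrite /horner_eval hornerC.
Qed.

Lemma horner_meval n (S : comNzRingType) (w : 'I_n -> {poly S}) p x :
  (mmap polyC w p).[x] = p.@[fun i => (w i).[x]].
Proof. exact: (horner_mmap idfun). Qed.

Lemma size_linear (R : nzRingType) (a b : R) : (size (a%:P + b%:P * 'X)%R <= 2)%N.
Proof.
rewrite (leq_trans (size_polyD _ _)) // geq_max (leq_trans (size_polyC_leq1 _)) //.
have := size_polyMleq b%:P 'X; have := size_polyC_leq1 b; rewrite size_polyX; lia.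
Qed.

(** The coefficient at a degree bound rather than at the exact degree: c may be zero, and the notion
    is compatible with sums as well as with products. *)
Definition top_coef (R : nzRingType) e (p : {poly R}) c :=
  (size p <= e.+1)%N /\ p`_e = c.

Lemma top_coefM (R : nzRingType) e e' (p q : {poly R}) c d :
  top_coef e p c -> top_coef e' q d -> top_coef (e + e') (p * q) (c * d).
Proof.
move=> [sp pc] [sq qd]; split.
  apply: leq_trans (size_polyMleq _ _) _.
  by move: sp sq; lia.
have e_lt : (e < (e + e').+1)%N by rewrite ltnS leq_addr.
rewrite coefM (bigD1 (Ordinal e_lt)) //= addKn pc qd big1 ?addr0 // => i.
rewrite -val_eqE /= neq_ltn => /orP[ie|ei].
  rewrite [q`_ _]nth_default ?mulr0 // (leq_trans sq) //.
  by rewrite ltn_subRL ltn_add2r.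
by rewrite nth_default ?mul0r // (leq_trans sp).
Qed.

Lemma top_coef_mmap n (R S : comNzRingType) (f : R -> S) (w : 'I_n -> {poly S})
    e d (p : {mpoly R[n]}) :
  (forall i, size (w i) <= e.+1)%N -> p \is d.-homog ->
  top_coef (d * e) (mmap (polyC \o f) w p) (mmap f (fun i => (w i)`_e) p).
Proof.
move=> sw /dhomogP hp; rewrite /mmap !big_seq.
apply: (big_ind2 (top_coef (d * e))) => [|a b a' b' [sa ca] [sb cb]|mm /hp dm].
- by split; rewrite ?size_poly0 ?coef0.
- split; last by rewrite coefD ca cb.
  by rewrite (leq_trans (size_polyD _ _)) // geq_max sa.
rewrite -dm /= mdegE -[(_ * e)%N]add0n; apply: top_coefM.
  by split; rewrite ?size_polyC_leq1 //= coefC.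
rewrite big_distrl /=.
apply: (big_rec3 (fun a b c => top_coef c a b)) => [|i a b c _ ac].
  by split; rewrite ?size_polyC_leq1 //= coefC.
apply: top_coefM => //; elim: (mm i) => [|l IH].
  by split; rewrite ?size_polyC_leq1 //= coefC.
by rewrite !exprS mulSn; apply: top_coefM.
Qed.

(** The linear Taylor coefficient along the line through v in direction d is the directional
    derivative. *)
Lemma coef1_mmap n (R : comNzRingType) (v d : 'I_n -> R) (p : {mpoly R[n]}) :
  (mmap polyC (fun i => (v i)%:P + (d i)%:P * 'X) p)`_1 =
    \sum_i d i * (p^`M(i)).@[v].
Proof.
set W := mmap _ _.
have W0 q : (W q)`_0 = q.@[v].
  rewrite -horner_coef0 /W horner_meval; apply: meval_eq => i.
  by rewrite !hornerE.
elim/mpoly_alg_ind: p => [c|j|p q IHp IHq|p q IHp IHq].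
- rewrite /W mmapC coefC big1 // => i _.
  by rewrite mderivC meval0 mulr0.
- rewrite /W mmapX mmap1U coefD coefC coefMX coefC /= add0r.
  rewrite (bigD1 j) //= big1 => [|i ij].
    rewrite addr0 mderivX mnm1E eqxx scale1r.
    rewrite (_ : (_ - _)%MM = 0%MM) ?mpolyX0 ?meval1 ?mulr1 //.
    by apply/mnmP => l; rewrite mnmBE subnn mnm0E.
  by rewrite mderivX mnm1E eq_sym (negPf ij) mulr0n scale0r meval0 mulr0.
- rewrite /W mmapD coefD -/W IHp IHq -big_split; apply: eq_bigr => i _.
  by rewrite mderivD mevalD mulrDr.
rewrite /W rmorphM /= -/W coefM !big_ord_recl big_ord0 /= addr0 /bump /=.
rewrite !W0 IHp IHq mulr_sumr mulr_suml -big_split; apply: eq_bigr => i _ /=.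
by rewrite mderivM mevalD !mevalM; ring.
Qed.
End MpolyTools.

(** * Nonvanishing at integer points in characteristic 0 *)

Section Nonvanishing.
Variables (K : fieldType) (char0 : [pchar K] =i pred0).

Lemma natrK_eq0 n : (n%:R == 0 :> K) = (n == 0%N).
Proof. by have /pcharf0P-> := char0. Qed.

Lemma natrK_inj : injective (fun n : nat => n%:R : K).
Proof.
move=> i j; wlog ij : i j / (i <= j)%N.
  by case/orP: (leq_total i j) => ij H E; [|apply/esym]; apply: H.
move/eqP; rewrite eq_sym -subr_eq0 -natrB // natrK_eq0 subn_eq0 => ji.
by apply/eqP; rewrite eqn_leq ij.
Qed.

Lemma poly_natr_neq0 (p : {poly K}) : p != 0 -> exists n : nat, p.[n%:R] != 0.
Proof.
move=> p0; have [/hasP[n _ nz]|/hasPn H] :=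
    boolP (has (fun n : nat => p.[n%:R] != 0) (iota 0 (size p))).
  by exists n.
have U : uniq [seq (n%:R : K) | n <- iota 0 (size p)].
  by rewrite (map_inj_uniq natrK_inj) iota_uniq.
have A : all (root p) [seq (n%:R : K) | n <- iota 0 (size p)].
  by rewrite all_map; apply/allP => n /H /negPn.
by have := max_poly_roots p0 A U; rewrite size_map size_iota ltnn.
Qed.

Lemma poly_natr_eq0 (p : {poly K}) : (forall n : nat, p.[n%:R] = 0) -> p = 0.
Proof. by move=> H; apply: contraTeq isT => /poly_natr_neq0[n]; rewrite H eqxx. Qed.

Lemma poly2_natr_neq0 (p : {poly {poly K}}) : p != 0 ->
  exists m n : nat, p.[n%:R%:P].[m%:R] != 0.
Proof.
rewrite -size_poly_eq0 => sp; have pl : lead_coef p != 0.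
  by rewrite lead_coef_eq0 -size_poly_eq0.
have [m pm] := poly_natr_neq0 pl.
have : map_poly (horner_eval (m%:R : K)) p != 0.
  apply: contraNneq pm => E; have := congr1 (fun q : {poly K} => q`_(size p).-1) E.
  by rewrite coef_map /= coef0 /horner_eval => ->.
move=> /poly_natr_neq0[n pn]; exists m, n.
have nE : n%:R = horner_eval (m%:R : K) (n%:R)%:P by rewrite /horner_eval hornerC.
by move: pn; rewrite [X in _.[X]]nE horner_map.
Qed.

(** Induction on the degree of a monomial of p: some partial derivative contains a smaller monomial,
    hence is nonzero at some v. Along the line through v in that direction p has a nonzero linear
    coefficient, so it is nonzero at some integer parameter. *)
Lemma mpoly_neq0_point n (p : {mpoly K[n]}) : p != 0 -> exists v, p.@[v] != 0.
Proof.
move=> p0; have [mm pm] : exists mm, p@_mm != 0.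
  case E: (msupp p) => [|mm s].
    by move/eqP: E; rewrite msupp_eq0 (negPf p0).
  by exists mm; rewrite -mcoeff_msupp E mem_head.
move: {2}(mdeg mm) (erefl (mdeg mm)) => d; elim: d => [|d IH] in p {p0} mm pm *.
  move=> /eqP; rewrite mdeg_eq0 => /eqP m0; exists (fun=> 0); move: pm.
  rewrite m0; congr (_ != 0); elim/mpoly_alg_ind: p => [c|i|p q Hp Hq|p q Hp Hq].
  - by rewrite mcoeffC eqxx mulr1 mevalC.
  - by rewrite mcoeffX mevalXU mnm1_eq0.
  - by rewrite mcoeffD mevalD Hp Hq.
  - by rewrite rmorphM /= Hp Hq mevalM.
move=> md; have [i mi] : exists i, (0 < mm i)%N.
  apply/existsP; apply: contraPT md; rewrite negb_exists => /forallP m0.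
  by rewrite mdegE big1 // => i _; apply/eqP; rewrite -leqn0 leqNgt.
have mE : mm = ((mm - U_(i)) + U_(i))%MM.
  by rewrite submK //; apply/mnm_lepP => j; rewrite mnm1E; case: eqP => // <-.
have [||v vp] := IH p^`M(i) (mm - U_(i))%MM.
- rewrite mcoeff_deriv -mE -mulr_natr mulf_neq0 //.
  by rewrite natrK_eq0.
- by apply/eqP; rewrite -eqSS -md [in X in _ == X]mE mdegD mdeg1 addn1.
pose W := mmap polyC (fun j => (v j)%:P + ((j == i)%:R : K)%:P * 'X) p.
have W1 : W`_1 = (p^`M(i)).@[v].
  rewrite /W coef1_mmap (bigD1 i) //= eqxx mul1r big1 ?addr0 // => j /negPf->.
  by rewrite mul0r.
have : W != 0 by apply: contraNneq vp => W0; rewrite -W1 W0 coef0.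
by move=> /poly_natr_neq0[x]; rewrite horner_meval; eexists; eassumption.
Qed.
End Nonvanishing.

(** * Smooth cubic surfaces are irreducible *)

Section SmoothCubic.
Variables (K : closedFieldType) (char0 : [pchar K] =i pred0).

Lemma sum_ord4 (f : 'I_4 -> K) :
  \sum_j f j = f 0 + f (inord 1) + f (inord 2) + f ord_max.
Proof.
rewrite !big_ord_recl big_ord0 addr0 !addrA.
by congr (f _ + f _ + f _ + f _); apply: val_inj; rewrite /= ?inordK.
Qed.

Lemma meval_homogZ n d (p : {mpoly K[n]}) (c : K) (v w : 'I_n -> K) :
  p \is d.-homog -> (forall i, v i = c * w i) -> p.@[v] = c ^+ d * p.@[w].
Proof.
move=> /dhomogP hp vw; rewrite !mevalE mulr_sumr; apply: eq_big_seq => mm mp.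
rewrite mulrCA; congr (_ * _); rewrite -(hp _ mp) /= mdegE -prodrXr -big_split.
by apply: eq_bigr => i _; rewrite vw exprMn.
Qed.

Lemma dhomog_mderiv n d (p : {mpoly K[n]}) i :
  p \is d.+1.-homog -> p^`M(i) \is d.-homog.
Proof.
move=> /dhomogP hp; apply/dhomogP => mm; rewrite mcoeff_msupp mcoeff_deriv => pm.
have /hp : (mm + U_(i))%MM \in msupp p.
  by rewrite mcoeff_msupp; apply: contraNneq pm => ->; rewrite mul0rn.
by rewrite /= mdegD mdeg1 addn1 => -[].
Qed.

Variables (F : {mpoly K[4]}) (F_cubic : F \is 3.-homog).
Hypothesis F_smooth : forall v : 'rV[K]_4, v != 0 -> F.@[v 0] = 0 ->
  exists i, F^`M(i).@[v 0] != 0.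

(** If F vanished on the plane spanned by the first three rows of b, its derivatives in these
    directions would vanish there too. The remaining derivative q is a quadratic form and has a zero
    on the plane, which would be a singular point. *)
Lemma no_plane (b : 'M[K]_4) : b \in unitmx ->
  (forall c : 'rV[K]_4, c 0 ord_max = 0 -> F.@[(c *m b) 0] = 0) -> False.
Proof.
move=> ub Fb; pose q := \sum_i b ord_max i *: F^`M(i).
have hq : q \is 2.-homog.
  by apply: rpred_sum => i _; apply: dhomogZ; apply: dhomog_mderiv.
pose o1 : 'I_4 := inord 1.
(* The zero of q is sought on the line through the first two rows: either the second row is one, or
   q restricted to the line has degree exactly 2 and a root in K. *)
have [c [c0 c3 qc]] : exists c : 'rV[K]_4,
    [/\ c != 0, c 0 ord_max = 0 & q.@[(c *m b) 0] = 0].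
  have [q1|q1] := eqVneq (q.@[fun i => b o1 i]) 0.
    exists (delta_mx 0 o1); split.
    - by apply/eqP => /rowP/(_ o1); rewrite !mxE !eqxx => /eqP; rewrite oner_eq0.
    - by rewrite mxE /= -val_eqE /= inordK.
    - by rewrite -rowE -{}[RHS]q1; apply: meval_eq => i; rewrite mxE.
  pose W := mmap polyC (fun i => (b 0 i)%:P + (b o1 i)%:P * 'X) q.
  have [sW W2] : top_coef (2 * 1) W (q.@[fun i => b o1 i]).
    have := @top_coef_mmap 4 K K idfun (fun i => (b 0 i)%:P + (b o1 i)%:P * 'X) 1 2 q _ hq.
    rewrite /top_coef; case=> [i|sW cW]; first exact: size_linear.
    split=> //; rewrite cW; apply: eq_mmap => // i.
    by rewrite coefD coefMX !coefC /= add0r.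
  have /closed_rootP[x /rootP Wx] : size W != 1%N.
    apply: contra_neq q1 => sW1; rewrite -W2 nth_default // sW1 //.
  exists (delta_mx 0 0 + x *: delta_mx 0 o1); split.
  - apply/eqP => /rowP/(_ 0); rewrite !mxE !eqxx /= -val_eqE /= inordK //.
    by rewrite mulr0 addr0 => /eqP; rewrite oner_eq0.
  - by rewrite !mxE /= -val_eqE /= inordK // mulr0 addr0.
  - rewrite -{}[RHS]Wx horner_meval; apply: meval_eq => i.
    by rewrite mulmxDl -scalemxAl -!rowE !hornerE !mxE mulrC.
pose v := c *m b.
have v0 : v != 0.
  by apply: contraNneq c0 => v0; rewrite -[c](mulmxK ub) -/v v0 mul0mx.
have [i] := F_smooth v0 (Fb c c3); apply/negP; rewrite negbK.
pose g : 'cV[K]_4 := \col_i F^`M(i).@[v 0].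
suff : b *m g = 0.
  move=> bg; have : g = 0 by rewrite -[g](mulKmx ub) bg mulmx0.
  by move=> /colP/(_ i); rewrite !mxE => ->.
apply/colP => j; rewrite !mxE; have [->|j3] := eqVneq j ord_max.
  rewrite -[RHS]qc /q raddf_sum /=; apply: eq_bigr => l _.
  by rewrite mevalZ mxE.
have := coef1_mmap (v 0) (b j) F; rewrite (eq_bigr (fun l => b j l * g l 0)).
  move=> <-; rewrite (_ : mmap _ _ _ = 0) ?coef0 //.
  apply: (poly_natr_eq0 char0) => n; rewrite horner_meval.
  have := Fb (c + n%:R *: delta_mx 0 j); rewrite !mxE c3 eq_sym (negPf j3) andbF.
  rewrite mulr0 addr0 => /(_ erefl) <-; apply: meval_eq => l.
  by rewrite mulmxDl -scalemxAl -rowE !hornerE !mxE -/v mulrC.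
by move=> l _; rewrite mxE.
Qed.

Section Chart.
Variables (b : 'M[K]_4) (b_unit : b \in unitmx).
Hypothesis Fb3 : F.@[b ord_max] != 0.

(** An affine chart of P^3. The last row of b, off the surface, is the centre of the projection to
    (x, y), so F has degree 3 in z with the constant leading coefficient F(b_3). *)
Definition chart_pt (x y z : K) : 'rV[K]_4 := \row_i (b 0 i + b (inord 1) i * x +
  b (inord 2) i * y + b ord_max i * z).

Let w2 i : {poly {poly K}} :=
  ((b 0 i)%:P + (b (inord 1) i)%:P * 'X)%:P + (b (inord 2) i)%:P%:P * 'X.
Let w3 i : {poly {poly {poly K}}} := (w2 i)%:P + (b ord_max i)%:P%:P%:P * 'X.

(** The variables are nested with x innermost, then y, and z outermost. *)
Definition chart_poly (p : {mpoly K[4]}) : {poly {poly {poly K}}} :=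
  mmap (polyC \o (polyC \o polyC)) w3 p.

Lemma chart_polyE p s x y :
  (chart_poly p).[s].[y%:P].[x] = p.@[chart_pt x y s.[y%:P].[x] 0].
Proof.
rewrite /chart_poly horner_mmap (horner_mmap polyC) horner_meval.
by apply: meval_eq => i; rewrite /w3 /w2 !hornerE !mxE; ring.
Qed.

Lemma chart_poly_top : top_coef 3 (chart_poly F) (F.@[b ord_max])%:P%:P.
Proof.
have [|sF cF] := @top_coef_mmap 4 K _ (polyC \o polyC) w3 1 3 F _ F_cubic.
  by move=> i; apply: size_linear.
split=> //; rewrite cF.
have -> : F.@[b ord_max] = mmap idfun (b ord_max) F by [].
rewrite (rmorph_mmap _ polyC) (rmorph_mmap _ polyC); apply: eq_mmap => // i.
by rewrite /w3 coefD coefMX !coefC /= add0r.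
Qed.

Definition chart_cubic := ((F.@[b ord_max])^-1)%:P%:P *: chart_poly F.

Lemma size_chart_cubic : size chart_cubic = 4.
Proof.
have [sF cF] := chart_poly_top; rewrite size_scale ?polyC_eq0 ?invr_eq0 //.
apply/eqP; rewrite eqn_leq sF ltnNge; apply: contraNN Fb3 => sF3.
by move/eqP: cF; rewrite nth_default // eq_sym !polyC_eq0.
Qed.

Lemma chart_cubic_monic : chart_cubic \is monic.
Proof.
rewrite monicE lead_coefE size_chart_cubic coefZ; have [_ ->] := chart_poly_top.
by rewrite -!polyCM mulVf.
Qed.

Lemma chart_cubicE s x y : (chart_cubic.[s].[y%:P].[x] == 0) =
  (F.@[chart_pt x y s.[y%:P].[x] 0] == 0).
Proof.
by rewrite /chart_cubic !hornerE chart_polyE mulf_eq0 invr_eq0 (negPf Fb3).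
Qed.

Lemma line_restriction (s : {poly {poly K}}) x0 x1 y0 y1 : exists r : {poly K},
  forall t, r.[t] = s.[(y0 + y1 * t)%:P].[x0 + x1 * t].
Proof.
elim/poly_ind: s => [|s c [r rE]].
  by exists 0 => t; rewrite !horner0.
exists (r * (y0%:P + y1%:P * 'X) + (c \Po (x0%:P + x1%:P * 'X))) => t.
rewrite hornerMXaddC [LHS]hornerD hornerM rE horner_comp.
by rewrite !(hornerD, hornerM, hornerC, hornerX).
Qed.

(* On each line the root is a polynomial, and a nonlinear one would leave the
   leading term F(b_3) r^3 uncancelled. *)
Lemma affine_on_lines (s : {poly {poly K}}) x0 x1 y0 y1 :
  (forall x y, F.@[chart_pt x y s.[y%:P].[x] 0] = 0) ->
  exists r0 r1, forall t, s.[(y0 + y1 * t)%:P].[x0 + x1 * t] = r0 + r1 * t.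
Proof.
move=> Fs; have [r rE] := line_restriction s x0 x1 y0 y1.
suff sr : (size r <= 2)%N.
  exists r`_0, r`_1 => t; rewrite -rE (horner_coef_wide _ sr).
  by rewrite !big_ord_recl big_ord0 /= expr0 mulr1 addr0 expr1.
rewrite leqNgt; apply/negP => sr; pose e := (size r).-1.
have e1 : (1 < e)%N by rewrite /e; case: (size r) sr => [|[|[]]].
pose u i : {poly K} := (b 0 i)%:P + (b (inord 1) i)%:P * (x0%:P + x1%:P * 'X) +
  (b (inord 2) i)%:P * (y0%:P + y1%:P * 'X).
pose w i : {poly K} := u i + (b ord_max i)%:P * r.
have su i : (size (u i) <= 2)%N.
  have -> : u i = (b 0 i + b (inord 1) i * x0 + b (inord 2) i * y0)%:P +
      (b (inord 1) i * x1 + b (inord 2) i * y1)%:P * 'X.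
    by rewrite /u !polyCD !polyCM; ring.
  exact: size_linear.
have sw i : (size (w i) <= e.+1)%N.
  rewrite (leq_trans (size_polyD _ _)) // geq_max (leq_trans (su i)) ?ltnS //.
    rewrite mul_polyC (leq_trans (size_scale_leq _ _)) // /e.
    by case: (size r) sr.
  exact: ltnW.
have := top_coef_mmap idfun sw F_cubic; rewrite /top_coef => -[_].
have -> : mmap (polyC \o idfun) w F = 0.
  apply: (poly_natr_eq0 char0) => n; rewrite horner_meval.
  rewrite -[RHS](Fs (x0 + x1 * n%:R) (y0 + y1 * n%:R)) -rE.
  by apply: meval_eq => i; rewrite /w /u !hornerE !mxE; ring.
rewrite coef0 => /esym/eqP; apply/negP.
have -> : mmap idfun (fun i => (w i)`_e) F = (lead_coef r) ^+ 3 * F.@[b ord_max].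
  apply: meval_homogZ => // i.
  by rewrite coefD (nth_default _ (leq_trans (su i) e1)) add0r mul_polyC coefZ mulrC.
rewrite mulf_neq0 // expf_neq0 // lead_coef_eq0 -size_poly_gt0.
exact: ltn_trans sr.
Qed.

(** A polynomial root is affine on every line by [affine_on_lines], hence an affine function of (x,
    y). Its graph spans a plane inside the surface, against [no_plane]. *)
Lemma no_polynomial_root (s : {poly {poly K}}) :
  (forall x y, F.@[chart_pt x y s.[y%:P].[x] 0] = 0) -> False.
Proof.
move=> Fs; pose r x y := s.[y%:P].[x].
have [a0 [a1 aE]] := affine_on_lines 0 1 0 0 Fs.
have [c0 [c1 cE]] := affine_on_lines 0 0 0 1 Fs.
have ca : c0 = a0.
  have := aE 0; have := cE 0; rewrite !(mul0r, mulr0, add0r, addr0) => -> <-.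
  by [].
have two0 : (2%:R : K) != 0 by rewrite (natrK_eq0 char0).
have rE x y : r x y = a0 + a1 * x + c1 * y.
  (* The point (x, y) is the midpoint of (0, 2y) and (2x, 0), so the values on the two axes
     determine the value there. *)
  have [d0 [d1 dE]] := affine_on_lines 0 (2%:R * x) (2%:R * y) (- (2%:R * y)) Fs.
  have d0E : d0 = a0 + c1 * (2%:R * y).
    have := dE 0; have := cE (2%:R * y).
    by rewrite !(mul0r, mulr0, add0r, addr0, mul1r) ca => -> <-.
  have d1E : d0 + d1 = a0 + a1 * (2%:R * x).
    have := dE 1; have := aE (2%:R * x).
    by rewrite !(mul0r, mulr0, add0r, addr0, mul1r, mulr1) subrr => -> <-.
  have := dE 2%:R^-1; rewrite -/(r _ _).
  have -> : 0 + 2%:R * x * 2%:R^-1 = x by rewrite add0r mulrAC divff ?mul1r.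
  have -> : 2%:R * y + - (2%:R * y) * 2%:R^-1 = y by field.
  rewrite /r => ->; have -> : d1 = a0 + a1 * (2%:R * x) - d0 by rewrite -d1E; ring.
  by rewrite d0E; field.
(* A shear: the first three rows of (1 + N) b span the plane z = a0 + a1 x + c1 y. As N^2 = 0, the
   inverse of 1 + N is 1 - N. *)
pose N : 'M[K]_4 := (\col_i nth 0 [:: a0; a1; c1; 0] i) *m delta_mx 0 ord_max.
have NN : N *m N = 0.
  rewrite /N mulmxA -[_ *m _ *m _ in X in X *m _]mulmxA.
  rewrite (_ : delta_mx 0 ord_max *m _ = 0) ?mulmx0 ?mul0mx //.
  by apply/matrixP => i j; rewrite !ord1 -rowE !mxE.
have ub' : (1%:M + N) *m b \in unitmx.
  rewrite unitmx_mul b_unit andbT.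
  have /mulmx1_unit[] // : (1%:M + N) *m (1%:M - N) = 1%:M.
  by rewrite mulmxBr mulmx1 mulmxDl mul1mx NN addr0 addrK.
pose B := (1%:M + N) *m b.
have FE (c : 'rV[K]_4) : c 0 ord_max = 0 -> c 0 0 != 0 -> F.@[(c *m B) 0] = 0.
  move=> c3 c00.
  rewrite -[RHS](mulr0 (c 0 0 ^+ 3)).
  rewrite -(Fs (c 0 (inord 1) / c 0 0) (c 0 (inord 2) / c 0 0)) -/(r _ _) rE.
  apply: meval_homogZ => // i.
  have -> : c *m B = c *m b +
      (c 0 0 * a0 + c 0 (inord 1) * a1 + c 0 (inord 2) * c1) *: row ord_max b.
    rewrite /B mulmxA mulmxDr mulmx1 mulmxDl; congr (_ + _).
    rewrite /N mulmxA -mulmxA -rowE (mx11_scalar (c *m _)) mul_scalar_mx.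
    by congr (_ *: _); rewrite mxE sum_ord4 !mxE /= !inordK //= mulr0 addr0.
  rewrite !mxE sum_ord4 c3 mul0r addr0; field.
  by [].
apply: (no_plane ub') => c c3; have [c00|] := eqVneq (c 0 0) 0; last exact: FE.
pose v := (c *m B); pose d := row 0 B.
pose W := mmap polyC (fun i => (v 0 i)%:P + (d 0 i)%:P * 'X) F.
(* Points of the plane at infinity for the chart: moving in direction d brings them into the chart
   at T = 1, 2, ..., where F vanishes. The factor ['X] covers T = 0. *)
have W0 : 'X * W = 0.
  apply: (poly_natr_eq0 char0) => -[|n]; first by rewrite !hornerE.
  rewrite !hornerE horner_meval; apply/eqP; rewrite mulf_eq0; apply/orP; right.
  rewrite -[X in _ == X](FE (c + n.+1%:R *: delta_mx 0 0)).
  - apply/eqP; apply: meval_eq => i.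
    by rewrite mulmxDl -scalemxAl -rowE -/v -/d !hornerE !mxE mulrC.
  - by rewrite !mxE c3 /= mulr0 addr0.
  - by rewrite !mxE c00 /= add0r mulr1 (natrK_eq0 char0).
move/eqP: W0; rewrite mulf_eq0 polyX_eq0 /= => /eqP W0.
have := congr1 (fun p => p.[0]) W0; rewrite horner_meval horner0 => <-.
by apply: meval_eq => i; rewrite !hornerE.
Qed.
End Chart.
End SmoothCubic.

Section LinearAlgebra.
Variable K : fieldType.

Lemma row_free_col_mx m n (A : 'M[K]_(m, n)) (v : 'rV[K]_n) :
  row_free A -> ~~ (v <= A)%MS -> row_free (col_mx A v).
Proof.
move=> fA vA; have v0 : v != 0 by apply: contraNneq vA => ->; apply: sub0mx.
rewrite -row_leq_rank -addsmxE.
have := mxrank_sum_cap A v; rewrite (eqP fA) rank_rV v0.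
suff /eqP-> : \rank (A :&: v)%MS == 0%N by rewrite addn0 => ->.
rewrite mxrank_eq0; apply: contraNT vA => c0.
have cv : (A :&: v <= v)%MS := capmxSr A v.
apply: submx_trans (capmxSl A v); rewrite -(geq_leqif (mxrank_leqif_sup cv)).
by rewrite rank_rV v0 lt0n mxrank_eq0.
Qed.

Lemma not_row_full_row m n (A : 'M[K]_(m, n)) : (m < n)%N ->
  exists v : 'rV[K]_n, ~~ (v <= A)%MS.
Proof.
move=> mn; suff /row_subPn[i vi] : ~~ (1%:M <= A)%MS by exists (row i 1%:M).
rewrite sub1mx; apply/negP => /eqP E.
by have := rank_leq_row A; rewrite E leqNgt mn.
Qed.
End LinearAlgebra.

Section OffCubic.
Variables (K : fieldType) (char0 : [pchar K] =i pred0).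
Variables (F : {mpoly K[4]}) (F_neq0 : F != 0) (F_cubic : F \is 3.-homog).

(** Let Q0 be off the surface. If it lies in the row space of A, take N outside that space: N + n Q0
    stays outside, and F(N + T Q0) is a nonzero polynomial with T^3 coefficient F(Q0). *)
Lemma exists_off_cubic (A : 'M[K]_(3, 4)) :
  exists2 Q : 'rV[K]_4, F.@[Q 0] != 0 & ~~ (Q <= A)%MS.
Proof.
have [v Fv] := mpoly_neq0_point char0 F_neq0; pose Q0 : 'rV[K]_4 := \row_i v i.
have FQ0 : F.@[Q0 0] != 0 by rewrite (meval_eq (v2 := v)) // => i; rewrite mxE.
have [Q0A|] := boolP (Q0 <= A)%MS; last by exists Q0.
have [N NA] := not_row_full_row A isT.
pose W := mmap polyC (fun i => (N 0 i)%:P + (Q0 0 i)%:P * 'X) F.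
have /(poly_natr_neq0 char0)[n] : W != 0.
  have := top_coef_mmap idfun (fun i => size_linear (N 0 i) (Q0 0 i)) F_cubic.
  move=> [_ W3]; apply: contraNneq FQ0 => W0.
  move: W3; rewrite -/W W0 coef0 => ->; apply/eqP; apply: eq_mmap => // i.
  by rewrite coefD coefMX !coefC /= add0r.
rewrite horner_meval => Wn; exists (N + n%:R *: Q0).
  apply: contra_neq Wn => <-; apply: meval_eq => i.
  by rewrite !hornerE !mxE mulrC.
apply: contra NA => /(addmx_sub (scalemx_sub (- n%:R) Q0A)).
by rewrite scaleNr addrC addrK.
Qed.
End OffCubic.

(** * Irreducibility by resultants *)

Section Irreducibility.
Variables (K : closedFieldType) (char0 : [pchar K] =i pred0).
Variables (F : {mpoly K[4]}) (F_neq0 : F != 0) (F_cubic : F \is 3.-homog).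
Hypothesis F_smooth : forall v : 'rV[K]_4, v != 0 -> F.@[v 0] = 0 ->
  exists i, F^`M(i).@[v 0] != 0.

Section InChart.
Variables (b : 'M[K]_4) (b_unit : b \in unitmx).
Hypothesis Fb3 : F.@[b ord_max] != 0.
Local Notation f := (chart_cubic F b).
Local Notation pt := (chart_pt b).

(** Denominators disappear one variable at a time. The rational root theorem over K[x][y] leaves a
    denominator e in K[x]. After specialising y to an integer, the same theorem over K[x] shows that
    e divides the numerator, and [dvdp_coefs] removes e altogether. The resulting polynomial root
    contradicts [no_polynomial_root]. *)
Lemma chart_cubic_no_root (a c : {poly {poly K}}) : c != 0 ->
  hom_horner 3 f a c != 0.
Proof.
have sf := size_chart_cubic F_cubic Fb3; have mf := chart_cubic_monic F_cubic Fb3.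
move=> c0; apply/eqP => E.
have [e [a' [e0 eE]]] := monic_rational_root sf mf c0 E.
have E' : hom_horner 3 f a' e%:P = 0.
  apply/eqP; have := hom_hornerZ 3 f a' e%:P c; rewrite -eE mul_polyC -!mul_polyC.
  rewrite ![e%:P * _]mulrC hom_hornerZ E mul0r => /esym/eqP.
  by rewrite mulf_eq0 expf_eq0 (negPf c0) andbF orbF.
have /(dvdp_coefs char0)[s sE] : forall n, e %| a'.[n%:R].
  move=> n; pose ev : {rmorphism {poly {poly K}} -> {poly K}} := horner_eval (n%:R : {poly K}).
  have mfn : map_poly ev f \is monic by exact: monic_map.
  have sfn : size (map_poly ev f) = 4.
    by rewrite size_map_poly_id0 ?sf // (monicP mf) rmorph1 oner_neq0.
  have En : hom_horner 3 (map_poly ev f) a'.[n%:R] e = 0.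
    transitivity (ev (hom_horner 3 f a' e%:P)); last by rewrite E' rmorph0.
    rewrite /hom_horner rmorph_sum; apply: eq_bigr => i _.
    by rewrite !rmorphM !rmorphXn /= coef_map /ev /horner_eval hornerC.
  have [e1 [a'' [e10 e1E]]] := monic_rational_root sfn mfn e0 En.
  by rewrite -(dvdpZr _ _ e10) e1E dvdp_mulIr.
have fs0 : f.[s] = 0.
  have sf4 : (size f <= 4)%N by rewrite sf.
  rewrite -(hom_horner1 s sf4); apply/eqP.
  have := hom_hornerZ 3 f s 1 e%:P; rewrite mul1r mulrC mul_polyC -sE E'.
  by move=> /esym/eqP; rewrite mulf_eq0 expf_eq0 polyC_eq0 (negPf e0) andbF orbF.
apply: (no_polynomial_root char0 F_cubic F_smooth b_unit Fb3 (s := s)) => x y.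
by apply/eqP; rewrite -chart_cubicE // fs0 !horner0.
Qed.

(** The resultant in z is a nonzero rho(x, y) in the ideal of f and g, so f and g have no common
    zero where rho does not vanish. If g does not involve z, rho is g itself. *)
Lemma chart_coprime (g : {poly {poly {poly K}}}) : ~~ (Pdiv.Idomain.dvdp f g) ->
  exists2 rho : {poly {poly K}}, rho != 0 &
    forall x y z, rho.[y%:P].[x] != 0 -> F.@[pt x y z 0] = 0 ->
      g.[z%:P%:P].[y%:P].[x] != 0.
Proof.
have sf := size_chart_cubic F_cubic Fb3; move=> fg.
have g0 : g != 0 by apply: contraNneq fg => ->; rewrite Pdiv.Idomain.dvdp0.
have [sg|sg] := leqP (size g) 1.
  have gE := size1_polyC sg; exists g`_0.
    by apply: contra_neq g0 => g00; rewrite gE g00.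
  by move=> x y z; rewrite [in g.[_]]gE !hornerC.
have r0 := resultant_cubic sf chart_cubic_no_root fg.
have sf1 : (1 < size f)%N by rewrite sf.
have [[u v] _ /= E] := resultant_in_ideal sf1 sg.
exists (resultant f g) => // x y z nz Fz; apply: contra_neq nz => gz.
have := congr1 (fun p => p.[z%:P%:P].[y%:P].[x]) E.
rewrite /= hornerC => ->; rewrite hornerD !hornerM !hornerD !hornerM.
have /eqP-> : f.[z%:P%:P].[y%:P].[x] == 0.
  by rewrite chart_cubicE // !hornerC Fz.
by rewrite gz !mulr0 addr0.
Qed.

Lemma chart_nonvanishing (g : {mpoly K[4]}) x0 y0 z0 :
  F.@[pt x0 y0 z0 0] = 0 -> g.@[pt x0 y0 z0 0] != 0 ->
  exists2 rho : {poly {poly K}}, rho != 0 &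
    forall x y z, rho.[y%:P].[x] != 0 -> F.@[pt x y z 0] = 0 ->
      g.@[pt x y z 0] != 0.
Proof.
move=> F0 g0; have [|rho rho0 rhoE] := @chart_coprime (chart_poly b g).
  apply: contraNN g0 => /(Pdiv.IdomainMonic.dvdpP (chart_cubic_monic F_cubic Fb3))[q qE].
  have := chart_polyE b g z0%:P%:P x0 y0; rewrite !hornerC => <-.
  rewrite qE !hornerM (_ : f.[_].[_].[_] = 0) ?mulr0 //.
  by apply/eqP; rewrite chart_cubicE // !hornerC F0.
exists rho => // x y z nz Fz; have := rhoE x y z nz Fz.
by rewrite chart_polyE !hornerC.
Qed.

(** For degree reasons f does not divide its derivative in z, which is nonzero with leading
    coefficient 3. A general line through the centre of projection thus meets the surface in three
    distinct points. *)
Lemma chart_separable : exists2 rho : {poly {poly K}}, rho != 0 &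
    forall x y z, rho.[y%:P].[x] != 0 -> F.@[pt x y z 0] = 0 ->
      (f^`()).[z%:P%:P].[y%:P].[x] != 0.
Proof.
have sf := size_chart_cubic F_cubic Fb3; apply: chart_coprime.
apply/negP => /Pdiv.Idomain.dvdp_leq; rewrite sf leqNgt -{1}sf lt_size_deriv; last first.
  by rewrite -size_poly_eq0 sf.
have d2 : f^`()`_2 = 3%:R.
  rewrite coef_deriv; have := chart_cubic_monic F_cubic Fb3.
  by rewrite monicE lead_coefE sf /= => /eqP->.
have : f^`() != 0.
  have n3 : (3%:R : K) != 0 by rewrite natrK_eq0.
  apply: contraNneq n3 => f0; move: d2; rewrite f0 coef0.
  move=> /(congr1 (fun p : {poly {poly K}} => p`_0`_0)).
  by rewrite !coef0 -!polyC_natr !coefC /= => <-.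
by move=> nz /(_ nz).
Qed.
End InChart.

(** If x and y are not proportional, x and y - x are completed to a basis whose last vector is off
    the surface, which puts both points in one chart, at (0, 0, 0) and (1, 0, 0). Over an integer
    point outside the two curves rho = 0, any point of the surface satisfies both conditions. *)
Lemma cubic_irreducible d e (G H : {mpoly K[4]}) (x y : 'rV[K]_4) :
  G \is d.-homog -> H \is e.-homog -> x != 0 -> y != 0 ->
  F.@[x 0] = 0 -> G.@[x 0] != 0 -> F.@[y 0] = 0 -> H.@[y 0] != 0 ->
  exists z : 'rV[K]_4, [/\ z != 0, F.@[z 0] = 0, G.@[z 0] != 0 & H.@[z 0] != 0].
Proof.
move=> hG hH x0 y0 Fx Gx Fy Hy.
have [/sub_rVP[c yE]|yx] := boolP (y <= x)%MS.
  exists x; split=> //; apply: contraNneq Hy => Hx.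
  by rewrite (meval_homogZ (c := c) (w := x 0) hH) ?Hx ?mulr0 // => i; rewrite yE mxE.
have fx : row_free x by rewrite -row_leq_rank rank_rV x0.
have yx' : ~~ (y - x <= x)%MS.
  by apply: contra yx => /(addmx_sub (submx_refl x)); rewrite addrC subrK.
have f2 := row_free_col_mx fx yx'.
have [P2 P2A] := not_row_full_row (col_mx x (y - x)) isT.
have f3 := row_free_col_mx f2 P2A.
have [Q FQ QA] := exists_off_cubic char0 F_neq0 F_cubic (col_mx (col_mx x (y - x)) P2).
pose b : 'M[K]_4 := col_mx (col_mx (col_mx x (y - x)) P2) Q.
have ub : b \in unitmx by rewrite -row_free_unit; apply: row_free_col_mx f3 QA.
have b0 i : b 0 i = x 0 i.
  rewrite (_ : 0 = lshift 1 (lshift 1 (lshift 1 (ord0 : 'I_1))) :> 'I_4); last exact: val_inj.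
  apply: etrans (col_mxEu _ _ _ _) _; apply: etrans (col_mxEu _ _ _ _) _.
  by apply: etrans (col_mxEu _ _ _ _) _; congr (x _ _); apply: val_inj.
have b1 i : b (inord 1) i = (y - x) 0 i.
  rewrite (_ : inord 1 = lshift 1 (lshift 1 (rshift 1 (ord0 : 'I_1))) :> 'I_4).
    apply: etrans (col_mxEu _ _ _ _) _; apply: etrans (col_mxEu _ _ _ _) _.
    by apply: etrans (col_mxEd _ _ _ _) _; congr ((y - x)%R _ _); apply: val_inj.
  by apply: val_inj; rewrite /= inordK.
have b3 i : b ord_max i = Q 0 i.
  rewrite (_ : ord_max = rshift (1 + 1 + 1) (ord0 : 'I_1) :> 'I_4); last exact: val_inj.
  by apply: etrans (col_mxEd _ _ _ _) _; congr (Q _ _); apply: val_inj.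
have Fb3 : F.@[b ord_max] != 0 by rewrite (meval_eq (v2 := Q 0)).
have ptx i : chart_pt b 0 0 0 0 i = x 0 i.
  by rewrite mxE !mulr0 !addr0 b0.
have pty i : chart_pt b 1 0 0 0 i = y 0 i.
  by rewrite mxE !mulr0 !addr0 mulr1 b0 b1 !mxE; ring.
have [i0 xi0] : exists i, x 0 i != 0.
  by apply/existsP; apply: contra_neqT x0; rewrite negb_exists => /forallP x0;
    apply/rowP => i; rewrite mxE; apply/eqP/negPn/x0.
(* The factor ['X_i0] guarantees that the vector found in the end is not zero. *)
have [||r1 r10 r1E] := @chart_nonvanishing b ub Fb3 (G * 'X_i0) 0 0 0.
- by rewrite (meval_eq _ ptx).
- by rewrite (meval_eq _ ptx) mevalM mevalXU mulf_neq0.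
have [||r2 r20 r2E] := @chart_nonvanishing b ub Fb3 H 1 0 0.
- by rewrite (meval_eq _ pty).
- by rewrite (meval_eq _ pty).
have [m [n]] := poly2_natr_neq0 char0 (mulf_neq0 r10 r20).
rewrite !hornerM mulf_eq0 negb_or => /andP[n1 n2].
pose W := (mmap polyC (fun i => (chart_pt b m%:R n%:R 0 0 i)%:P +
  (b ord_max i)%:P * 'X) F).
have [sW W3] : top_coef (3 * 1) W (F.@[b ord_max]).
  have [sW W3] := top_coef_mmap idfun (fun i =>
    size_linear (chart_pt b m%:R n%:R 0 0 i) (b ord_max i)) F_cubic.
  split=> //; rewrite W3; apply: eq_mmap => // i.
  by rewrite coefD coefMX !coefC /= add0r.
have /closed_rootP[z /rootP Wz] : size W != 1%N.
  by apply: contraNneq Fb3 => sW1; rewrite -W3 nth_default // sW1.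
have Fz : F.@[chart_pt b m%:R n%:R z 0] = 0.
  rewrite -[RHS]Wz horner_meval; apply: meval_eq => i.
  by rewrite !hornerE !mxE; ring.
have := r1E _ _ _ n1 Fz; rewrite mevalM mevalXU mulf_eq0 negb_or => /andP[Gz zi].
exists (chart_pt b m%:R n%:R z); split=> //; last exact: r2E.
by apply: contraNneq zi => ->; rewrite mxE.
Qed.
End Irreducibility.

(** * A rational cubic curve meeting the surface in nine distinct points *)

Section Frame.
Variables (k : fieldType) (char0 : [pchar k] =i pred0) (K : closedFieldType).
Variable iota : {rmorphism k -> K}.
Variables (F : {mpoly k[4]}) (F_neq0 : F != 0) (F_cubic : F \is 3.-homog).
Hypothesis F_smooth : smooth_hypersurface iota F.

Lemma pchar_ext : [pchar K] =i pred0.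
Proof. by move=> p; rewrite (fmorph_pchar iota). Qed.

Local Notation FK := (map_mpoly iota F).

Lemma map_mpoly_homog n d (p : {mpoly k[n]}) :
  p \is d.-homog -> map_mpoly iota p \is d.-homog.
Proof.
move=> /dhomogP hp; apply/dhomogP => mm; rewrite mcoeff_msupp mcoeff_map_mpoly => pm.
by apply: hp; rewrite mcoeff_msupp; apply: contraNneq pm => ->; rewrite (raddf0 iota).
Qed.

Lemma map_mpoly_neq0 n (p : {mpoly k[n]}) : p != 0 -> map_mpoly iota p != 0.
Proof.
apply: contra_neq => p0; apply/mpolyP => mm; apply: (fmorph_inj iota).
by rewrite -mcoeff_map_mpoly p0 !mcoeff0 rmorph0.
Qed.

Lemma map_mpoly_mderiv n (p : {mpoly k[n]}) i :
  map_mpoly iota p^`M(i) = (map_mpoly iota p)^`M(i).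
Proof.
by apply/mpolyP => mm; rewrite mcoeff_map_mpoly !mcoeff_deriv mcoeff_map_mpoly (raddfMn iota).
Qed.

Lemma smoothK (v : 'rV[K]_4) : v != 0 -> FK.@[v 0] = 0 ->
  exists i, FK^`M(i).@[v 0] != 0.
Proof. by move=> v0 /(F_smooth v0)[i Fi]; exists i; rewrite -map_mpoly_mderiv. Qed.

(** Row j of w is the vector coefficient of t^j: right multiplication of w changes the coordinates
    of P^3, and the last row is the point at infinity of the curve. *)
Definition curve (w : 'M[K]_4) (l : 'I_4) : {poly K} :=
  \sum_j (w j l)%:P * 'X^j.

Lemma curveE w l t : (curve w l).[t] = \sum_j w j l * t ^+ j.
Proof. by rewrite /curve horner_sum; apply: eq_bigr => j _; rewrite !hornerE. Qed.

Definition curve_cubic (w : 'M[K]_4) : {poly K} := mmap polyC (curve w) FK.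

Lemma curve_cubicE w t :
  (curve_cubic w).[t] = evalv iota F (\row_l (curve w l).[t]).
Proof. by rewrite /curve_cubic horner_meval; apply: meval_eq => l; rewrite mxE. Qed.

Lemma exists_basis : exists b : 'M[k]_4, b \in unitmx /\ FK.@[map_mx iota b ord_max] != 0.
Proof.
have f3 : row_free (pid_mx 3 : 'M[k]_(3, 4)).
  by rewrite -row_leq_rank rank_pid_mx.
pose A : 'M[k]_(3, 4) := pid_mx 3.
have [Q FQ QA] := exists_off_cubic char0 F_neq0 F_cubic A.
pose b : 'M[k]_4 := col_mx A Q; exists b; split.
  by rewrite -row_free_unit; apply: row_free_col_mx f3 QA.
have bE i : map_mx iota b ord_max i = iota (Q 0 i).
  rewrite mxE; congr (iota _).
  rewrite (_ : ord_max = rshift 3 (ord0 : 'I_1) :> 'I_4); last exact: val_inj.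
  by apply: etrans (col_mxEd _ _ _ _) _; congr (Q _ _); apply: val_inj.
by rewrite (meval_eq _ bE) meval_map_mpoly_image fmorph_eq0.
Qed.

(* F restricted to P + e t R + e t^2 S + t^3 Q, over K[e]; at e = 0 this is the
   restriction to the transversal line through P and Q, composed with t^3. *)
Lemma exists_frame : exists2 A : 'M[k]_4, A \in unitmx &
  size (curve_cubic (map_mx iota A)) = 10 /\
  separable_poly (curve_cubic (map_mx iota A)).
Proof.
have [b [ub Fb3]] := exists_basis; pose bK := map_mx iota b.
have ubK : bK \in unitmx by rewrite map_unitmx.
have FK_neq0 := map_mpoly_neq0 F_neq0; have FK_cubic := map_mpoly_homog F_cubic.
have charK := pchar_ext.
have [rho rho0 rhoE] := chart_separable charK FK_cubic smoothK ubK Fb3.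
(* The line L over (m, n) meets the surface in three distinct points. *)
have [m [n rho_mn]] := poly2_natr_neq0 charK rho0.
pose u i := chart_pt bK m%:R n%:R 0 0 i.
pose L := mmap polyC (fun i => (u i)%:P + (bK ord_max i)%:P * 'X) FK.
have LE z : L.[z] = FK.@[chart_pt bK m%:R n%:R z 0].
  by rewrite horner_meval; apply: meval_eq => i; rewrite !hornerE /u !mxE; ring.
have [sL L3] : top_coef 3 L FK.@[bK ord_max].
  have [sL L3] := top_coef_mmap idfun (fun i => size_linear (u i) (bK ord_max i)) FK_cubic.
  split=> //; rewrite L3; apply: eq_mmap => // i.
  by rewrite coefD coefMX !coefC /= add0r.
have L_simple z : L.[z] = 0 -> L^`().[z] != 0.
  pose ev : {rmorphism {poly {poly K}} -> K} :=
    horner_eval (m%:R : K) \o horner_eval ((n%:R)%:P : {poly K}).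
  have LfE : L = FK.@[bK ord_max] *: map_poly ev (chart_cubic FK bK).
    apply/eqP; rewrite -subr_eq0; apply/eqP; apply: (poly_natr_eq0 charK) => j.
    rewrite !hornerE LE.
    have jE : j%:R = ev (j%:R)%:P%:P by rewrite /ev /= /horner_eval !hornerC.
    rewrite [X in (map_poly _ _).[X]]jE horner_map /ev /= /horner_eval /chart_cubic.
    rewrite hornerZ !hornerM !hornerC chart_polyE !hornerC.
    by rewrite mulVKf ?subrr.
  rewrite LE => /(rhoE _ _ _ rho_mn) fz; rewrite LfE derivZ deriv_map hornerZ.
  have zE : z = ev z%:P%:P by rewrite /ev /= /horner_eval !hornerC.
  by rewrite mulf_neq0 // [X in _.[X]]zE horner_map.
have L0 : L != 0 by apply: contraNneq Fb3 => L0; rewrite -L3 L0 coef0.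
(* The map t -> z0 + t^3 is ramified at t = 0, so its value z0 there must not be a root of L; then
   the three simple roots of L pull back to nine simple ones. *)
have [z0 Lz0] := poly_natr_neq0 charK L0.
pose c : 'I_4 -> k := fun l => nth 0 [:: 1; m%:R; n%:R; z0%:R] l.
pose T (e : k) : 'M[k]_4 := \matrix_(j, l)
  if j == 0 then c l else if j == l then (if l == ord_max then 1 else e) else 0.
have uT e : e != 0 -> T e *m b \in unitmx.
  move=> e0; rewrite unitmx_mul ub andbT unitmxE -det_tr det_trig.
    rewrite !big_ord_recl big_ord0 !mxE !eqxx /= mul1r mulr1.
    by rewrite unitfE /c /= !mulf_neq0 ?oner_neq0.
  apply/is_trig_mxP => i j ij; rewrite !mxE -!val_eqE /= gtn_eqF; last exact: leq_ltn_trans ij.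
  by rewrite gtn_eqF.
pose P i : K := chart_pt bK m%:R n%:R z0%:R 0 i.
pose wE i : {poly {poly K}} := (P i)%:P%:P + ('X * (bK (inord 1) i)%:P)%:P * 'X +
  ('X * (bK (inord 2) i)%:P)%:P * 'X^2 + (bK ord_max i)%:P%:P * 'X^3.
pose pE := mmap (polyC \o polyC) wE FK.
have swE i : (size (wE i) <= 4)%N.
  apply/leq_sizeP => j j4.
  by rewrite /wE !coefD !coefCM coefX !coefXn coefC; case: j j4 => [|[|[|[|j]]]] // _;
    rewrite /= !mulr0 !addr0.
have [spE pE9] : top_coef 9 pE (FK.@[bK ord_max])%:P.
  have [spE pE9] := top_coef_mmap polyC swE FK_cubic.
  split=> //; rewrite pE9.
  have -> : FK.@[bK ord_max] = mmap idfun (bK ord_max) FK by [].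
  rewrite (rmorph_mmap _ polyC); apply: eq_mmap => // i.
  by rewrite /wE !coefD !coefCM coefX !coefXn coefC /= !mulr0 mulr1 !add0r.
have pE_map (e : K) t : (map_poly (horner_eval e) pE).[t] =
    FK.@[fun i => P i + e * bK (inord 1) i * t + e * bK (inord 2) i * t ^+ 2 +
      bK ord_max i * t ^+ 3].
  have tE : t = horner_eval e t%:P by rewrite /horner_eval hornerC.
  rewrite [X in _.[X]]tE horner_map /= /horner_eval (horner_mmap polyC) horner_meval.
  by apply: meval_eq => i; rewrite /wE !hornerE.
have szE : size pE = 10.
  apply/eqP; rewrite eqn_leq spE ltnNge; apply: contraNN Fb3 => sF.
  by move/eqP: pE9; rewrite nth_default // eq_sym polyC_eq0.
have pE'8 : pE^`()`_8 = (FK.@[bK ord_max] *+ 9)%:P by rewrite coef_deriv pE9 polyCMn.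
have F9 : FK.@[bK ord_max] *+ 9 != 0.
  by rewrite -mulr_natr mulf_neq0 // (natrK_eq0 charK).
have szE' : size pE^`() = 9.
  have pE0 : pE != 0 by rewrite -size_poly_eq0 szE.
  have := lt_size_deriv pE0; rewrite szE => sE'.
  apply/eqP; rewrite eqn_leq -ltnS sE' ltnNge; apply: contraNN F9 => sF.
  by move/eqP: pE'8; rewrite nth_default // eq_sym polyC_eq0.
have lpE (e : K) : horner_eval e (lead_coef pE) != 0.
  by rewrite lead_coefE szE pE9 /horner_eval hornerC.
have lpE' (e : K) : horner_eval e (lead_coef pE^`()) != 0.
  by rewrite lead_coefE szE' pE'8 /horner_eval hornerC.
pose R := resultant pE pE^`().
have RE e : horner_eval e R = resultant (map_poly (horner_eval e) pE)
    (map_poly (horner_eval e) pE)^`().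
  by rewrite deriv_map -map_resultant //; [exact: lpE|exact: lpE'].
have R0 : R != 0.
  apply: contraTneq isT => R0; have := RE 0; rewrite R0 rmorph0 => /esym/eqP.
  rewrite resultant_eq0 => sg.
  have /closed_rootP[t] : size (gcdp (map_poly (horner_eval 0) pE)
    (map_poly (horner_eval 0) pE)^`()) != 1%N by rewrite gtn_eqF.
  rewrite root_gcd => /andP[/rootP r1 /rootP r2].
  have pLE : map_poly (horner_eval 0) pE = L \Po (z0%:R%:P + 'X^3).
    apply/eqP; rewrite -subr_eq0; apply/eqP; apply: (poly_natr_eq0 charK) => j.
    rewrite hornerD hornerN pE_map horner_comp LE; apply/eqP; rewrite subr_eq0.
    apply/eqP/meval_eq => i; rewrite /P !mxE !hornerE /=; ring.
  move: r1 r2; rewrite pLE deriv_comp hornerM !horner_comp => eL /eqP; have r1 := L_simple _ eL.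
  rewrite mulf_eq0 (negPf r1) /= !derivE !hornerE.
  have -> : t * t + t * (t + t) = t * t * 3%:R by ring.
  rewrite !mulf_eq0 (natrK_eq0 charK) orbF orbb => /eqP t0.
  by move: Lz0; rewrite -eL t0 !hornerE expr0n addr0 => /eqP.
(* The factor ['X] excludes e = 0, where [T e] is singular. *)
have [e] : exists e : nat, ('X * R).[e%:R] != 0.
  by apply: (poly_natr_neq0 charK); rewrite mulf_neq0 // polyX_eq0.
rewrite !hornerE mulf_eq0 negb_or => /andP[e0 Re].
exists (T e%:R *m b); first by apply: uT; rewrite (natrK_eq0 char0) -(natrK_eq0 charK).
have cE : curve_cubic (map_mx iota (T e%:R *m b)) = map_poly (horner_eval e%:R) pE.
  apply/eqP; rewrite -subr_eq0; apply/eqP; apply: (poly_natr_eq0 charK) => j.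
  rewrite hornerD hornerN pE_map curve_cubicE /evalv; apply/eqP; rewrite subr_eq0.
  apply/eqP/meval_eq => i; rewrite mxE curveE sum_ord4 map_mxM !mxE !sum_ord4.
  rewrite /P !mxE -!val_eqE /= !inordK //= /c /= !inordK //= !rmorph_nat rmorph0 rmorph1.
  by ring.
rewrite cE; split; first by rewrite size_map_poly_id0 ?lpE // szE.
rewrite unlock coprimep_def -[_ == _]negbK.
have := Re; rewrite -/(horner_eval _ R) RE resultant_eq0.
rewrite -leqNgt negbK leq_eqVlt ltnS leqn0 size_poly_eq0 gcdp_eq0.
by rewrite -size_poly_eq0 size_map_poly_id0 ?lpE // szE orbF.
Qed.
End Frame.

(** * Geometric irreducibility *)

Section GeometricIrreducibility.
Variables (k K : fieldType) (iota : {rmorphism k -> K}).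

(** Fixing one factor of a product at a K-point turns a tensor of functions over k into a K-linear
    combination of functions over k; irreducibility is tested on such combinations. *)
Definition kspan (T : Type) (P : (T -> K) -> Prop) (f : T -> K) : Prop :=
  exists (J : finType) (c : J -> K) (a : J -> T -> K),
    (forall j, P (a j)) /\ forall x, f x = \sum_j c j * a j x.

Lemma kspan_gen T (P : (T -> K) -> Prop) f : P f -> kspan P f.
Proof.
move=> Pf; exists 'I_1, (fun=> 1), (fun=> f); split=> // x.
by rewrite big_ord1 mul1r.
Qed.

Lemma kspan_sum T (P : (T -> K) -> Prop) (J : finType) (c : J -> K)
    (f : J -> T -> K) :
  (forall j, kspan P (f j)) -> kspan P (fun x => \sum_j c j * f j x).
Proof.
move=> Pf; have Pf' j : exists A : {R : finType & ((R -> K) * (R -> T -> K))%type},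
    (forall i, P ((projT2 A).2 i)) /\
      forall x, f j x = \sum_i (projT2 A).1 i * (projT2 A).2 i x.
  by have [R [d [a [Pa aE]]]] := Pf j; exists (existT _ R (d, a)).
have [A AE] := fin_all_exists Pf'.
exists {j : J & projT1 (A j)}, (fun u => c (tag u) * (projT2 (A (tag u))).1 (tagged u)),
    (fun u => (projT2 (A (tag u))).2 (tagged u)); split.
    by move=> [j i] /=; have [Pa _] := AE j; apply: Pa.
move=> x; transitivity (\sum_j \sum_i (c j * (projT2 (A j)).1 i) *
      (projT2 (A j)).2 i x).
    apply: eq_bigr => j _; have [_ ->] := AE j; rewrite mulr_sumr.
    by apply: eq_bigr => i _; rewrite mulrA.
by rewrite (sig_big_dep _ _ (fun j i => c j * (projT2 (A j)).1 i *
    (projT2 (A j)).2 i x)).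
Qed.

(* Any two opens of the K-Zariski topology attached to X meet. *)
Definition geom_irr (X : kspace K) : Prop := forall U V f g,
  opens X U -> opens X V -> kspan (regular X U) f -> kspan (regular X V) g ->
  (exists2 x, U x & f x != 0) -> (exists2 x, V x & g x != 0) ->
  exists z, [/\ U z, V z, f z != 0 & g z != 0].

Lemma geom_irr_dense (X : kspace K) U : kaxioms iota X -> geom_irr X ->
  opens X U -> (exists x, U x) -> dense_open U.
Proof.
move=> kX irr oU [x Ux]; split=> // W oW [y Wy].
have k1 V : kspan (regular X V) (fun=> 1).
  by apply: kspan_gen; apply: (regularE kX) (regularC kX V 1) => z; rewrite rmorph1.
have [||z [Uz Wz _ _]] := irr _ _ _ _ oU oW (k1 U) (k1 W).
- by exists x; rewrite ?oner_neq0.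
- by exists y; rewrite ?oner_neq0.
by exists z.
Qed.

Lemma quot_geom_irr (X : kspace K) (e : equiv_rel X) :
  geom_irr X -> geom_irr (quot_space e).
Proof.
move=> irr U V f g oU oV [J [c [a [ra fE]]]] [J' [c' [a' [ra' gE]]]] [x Ux fx] [y Vy gy].
have [||||z [Uz Vz fz gz]] := irr _ _ (fun x => f (\pi_({eq_quot e}) x))
  (fun x => g (\pi_({eq_quot e}) x)) oU oV.
- by exists J, c, (fun j x => a j (\pi_({eq_quot e}) x)).
- by exists J', c', (fun j x => a' j (\pi_({eq_quot e}) x)).
- by exists (generic_quotient.repr x); rewrite reprK.
- by exists (generic_quotient.repr y); rewrite reprK.
by exists (\pi_({eq_quot e}) z).
Qed.

Section FracLocal.
Variables (T : choiceType) (frac : (T -> Prop) -> (T -> K) -> (T -> K) -> Prop).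
Hypothesis fA : frac_axioms iota frac.

Lemma frac_kspan_local U f x : frac_open frac U ->
  kspan (frac_regular frac U) f -> U x -> f x != 0 ->
  exists (J : finType) (c : J -> K) (V : T -> Prop) h (g : J -> T -> K),
    [/\ V x, forall j, frac V (g j) h, exists g0, frac V g0 h,
        h x * (\sum_j c j * g j x) != 0
      & forall y, V y -> h y * (\sum_j c j * g j y) != 0 -> U y /\ f y != 0].
Proof.
move=> oU [J [c [a [ra fE]]]] Ux fx.
have [V [h [g [Vx hx F F0 E]]]] := frac_common fA oU Ux ra.
have fE' y : V y -> h y != 0 -> f y = (\sum_j c j * g j y) / h y.
  move=> Vy hy; have [Uy Ey] := E y Vy hy; rewrite fE mulr_suml.
  by apply: eq_bigr => j _; rewrite Ey mulrA.
exists J, c, V, h, g; split=> //.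
  rewrite mulf_neq0 //; apply: contraNneq fx => z.
  by rewrite fE' // z mul0r.
move=> y Vy; rewrite mulf_eq0 negb_or => /andP[hy gy].
have [Uy _] := E y Vy hy; split=> //.
by rewrite fE' // mulf_neq0 // invr_eq0.
Qed.
End FracLocal.

Section Products.
Variables (X Y : kspace K) (kX : kaxioms iota X) (kY : kaxioms iota Y).

Lemma prod_kspan_local W f z : opens (prod_space X Y) W ->
  kspan (regular (prod_space X Y) W) f -> W z -> f z != 0 ->
  exists U V h, [/\ opens X U, opens Y V, kspan (prod_tensor U V) h,
    U z.1 /\ V z.2 /\ h z != 0
    & forall x y, U x -> V y -> h (x, y) != 0 -> W (x, y) /\ f (x, y) != 0].
Proof.
move=> oW kf Wz fz.
have [J [c [B [h [g [Bz F [g0 F0] nz H]]]]]] :=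
  frac_kspan_local (prod_frac_axioms kX kY) oW kf Wz fz.
have UV0 j : exists UV : (X -> Prop) * (Y -> Prop),
    [/\ opens X UV.1, opens Y UV.2, forall z, B z <-> UV.1 z.1 /\ UV.2 z.2,
      prod_tensor UV.1 UV.2 (g j) & prod_tensor UV.1 UV.2 h].
  by have [U [V E]] := F j; exists (U, V).
have [UV UVE] := fin_all_exists UV0.
have [U0 [V0 [oU0 oV0 B0 tg0 th0]]] := F0.
pose U x := U0 x /\ forall j, (UV j).1 x; pose V y := V0 y /\ forall j, (UV j).2 y.
have oU : opens X U.
  by apply: (opensI kX) => //; apply: (opensI_fin kX) => j; case: (UVE j).
have oV : opens Y V.
  by apply: (opensI kY) => //; apply: (opensI_fin kY) => j; case: (UVE j).
exists U, V, (fun z => h z * \sum_j c j * g j z); split=> //.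
- have : kspan (prod_tensor U V) (fun z => \sum_j c j * (h z * g j z)).
    apply: kspan_sum => j; apply: kspan_gen.
    have [_ _ _ tg _] := UVE j; apply: (prod_tensorM kX kY).
      by apply: (prod_tensorS kX kY) th0 => ? [].
    by apply: (prod_tensorS kX kY) tg => ? [].
  congr kspan; apply: functional_extensionality => x; rewrite mulr_sumr.
  by apply: eq_bigr => j _; rewrite mulrCA.
- have [U0z V0z] := (B0 z).1 Bz; split; [|split=> //]; split=> // j;
    by have [_ _ /(_ z)[/(_ Bz)[]]] := UVE j.
- move=> x y [U0x _] [V0y _] nz'; apply: H => //.
  exact/B0.
Qed.

Lemma prod_tensor_slicel U V h x : kspan (@prod_tensor K X Y U V) h ->
  kspan (regular Y V) (fun y => h (x, y)).
Proof.
move=> [J [c [a [ta hE]]]].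
rewrite (_ : (fun y => h (x, y)) = fun y => \sum_j c j * a j (x, y)).
  apply: kspan_sum => j; have [r [u [v [ru rv aE]]]] := ta j.
  by exists 'I_r, (fun i => u i x), v.
by apply: functional_extensionality.
Qed.

Lemma prod_tensor_slicer U V h y : kspan (@prod_tensor K X Y U V) h ->
  kspan (regular X U) (fun x => h (x, y)).
Proof.
move=> [J [c [a [ta hE]]]].
rewrite (_ : (fun x => h (x, y)) = fun x => \sum_j c j * a j (x, y)).
  apply: kspan_sum => j; have [r [u [v [ru rv aE]]]] := ta j.
  exists 'I_r, (fun i => v i y), u; split=> // x; rewrite aE.
  by apply: eq_bigr => i _; rewrite mulrC.
by apply: functional_extensionality.
Qed.

(** The slices over x1 and x2 are opens of Y and share a point y; the slices at y are then nonempty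
    opens of X and share a point x. *)
Lemma prod_geom_irr : geom_irr X -> geom_irr Y -> geom_irr (prod_space X Y).
Proof.
move=> irrX irrY W W' f f' oW oW' kf kf' [[x1 y1] Wz fz] [[x2 y2] Wz' fz'].
have [U [V [h [oU oV kh [Ux [Vy hz]] H]]]] := prod_kspan_local oW kf Wz fz.
have [U' [V' [h' [oU' oV' kh' [Ux' [Vy' hz']] H']]]] := prod_kspan_local oW' kf' Wz' fz'.
have [||y [V1 V1' h1 h1']] := irrY _ _ _ _ oV oV' (prod_tensor_slicel x1 kh)
  (prod_tensor_slicel x2 kh').
- by exists y1.
- by exists y2.
have [||x [U1 U1' h2 h2']] := irrX _ _ _ _ oU oU' (prod_tensor_slicer y kh)
  (prod_tensor_slicer y kh').
- by exists x1.
- by exists x2.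
have [Wxy fxy] := H x y U1 V1 h2; have [Wxy' fxy'] := H' x y U1' V1' h2'.
by exists (x, y).
Qed.
End Products.

Section Powers.
Variables (X : kspace K) (kX : kaxioms iota X) (m : nat) (m_gt0 : (0 < m)%N).
Local Notation Xm := {ffun 'I_m -> X}.

Lemma power_kspan_local W f (z : Xm) : opens (power_space X m) W ->
  kspan (regular (power_space X m) W) f -> W z -> f z != 0 ->
  exists (U : 'I_m -> X -> Prop) h, [/\ forall i, opens X (U i),
    kspan (power_tensor U) h, (forall i, U i (z i)) /\ h z != 0
    & forall x : Xm, (forall i, U i (x i)) -> h x != 0 -> W x /\ f x != 0].
Proof.
move=> oW kf Wz fz.
have [J [c [B [h [g [Bz F [g0 F0] nz H]]]]]] :=
  frac_kspan_local (power_frac_axioms kX (Ordinal m_gt0)) oW kf Wz fz.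
have [V VE] := fin_all_exists F.
have [U0 [oU0 B0 tg0 th0]] := F0.
pose U i x := U0 i x /\ forall j, V j i x.
have oU i : opens X (U i).
  by apply: (opensI kX) => //; apply: (opensI_fin kX) => j; case: (VE j).
exists U, (fun z => h z * \sum_j c j * g j z); split=> //.
- have : kspan (power_tensor U) (fun z => \sum_j c j * (h z * g j z)).
    apply: kspan_sum => j; apply: kspan_gen.
    have [_ _ tg _] := VE j; apply: (power_tensorM kX).
      by apply: (power_tensorS kX) th0 => ? ? [].
    by apply: (power_tensorS kX) tg => ? ? [].
  congr kspan; apply: functional_extensionality => x; rewrite mulr_sumr.
  by apply: eq_bigr => j _; rewrite mulrCA.
- split=> // i; split; first by have [+ _] := B0 z; apply.
  by move=> j; have [_ /(_ z)[+ _] _ _] := VE j; apply.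
- move=> x Ux nz'; apply: H => //.
  by apply/B0 => i; case: (Ux i).
Qed.

Definition upd (x : Xm) i z : Xm := [ffun j => if j == i then z else x j].

Lemma upd_id x i : upd x i (x i) = x.
Proof. by apply/ffunP => j; rewrite ffunE; case: eqP => [->|]. Qed.

Lemma power_tensor_slice U h x i : kspan (@power_tensor K X m U) h ->
  kspan (regular X (U i)) (fun z => h (upd x i z)).
Proof.
move=> [J [c [a [ta hE]]]].
rewrite (_ : (fun z => h _) = fun z => \sum_j c j * a j (upd x i z)).
  apply: kspan_sum => j; have [r [u [ru aE]]] := ta j.
  exists 'I_r, (fun l => \prod_(i' | i' != i) u l i' (x i')), (fun l => u l i).
  split=> // z; rewrite aE; apply: eq_bigr => l _; rewrite (bigD1 i) //= mulrC.
  rewrite ffunE eqxx; congr (_ * _); apply: eq_bigr => i' /negPf ii'.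
  by rewrite ffunE ii'.
by apply: functional_extensionality.
Qed.

(** The coordinates are equalised one at a time: when the two points agree in the first n
    coordinates, the slices in the next one are nonempty opens of X and meet. *)
Lemma power_geom_irr : geom_irr X -> geom_irr (power_space X m).
Proof.
move=> irrX W W' f f' oW oW' kf kf' [x1 Wz fz] [x2 Wz' fz'].
have [U [h [oU kh [Ux hz] H]]] := power_kspan_local oW kf Wz fz.
have [U' [h' [oU' kh' [Ux' hz'] H']]] := power_kspan_local oW' kf' Wz' fz'.
suff /(_ m (leqnn _))[x [x' [[Vx Vx' hx hx'] xx']]] : forall n, (n <= m)%N ->
    exists x x' : Xm, [/\ forall i, U i (x i), forall i, U' i (x' i), h x != 0 &
      h' x' != 0] /\ forall i : 'I_m, (i < n)%N -> x i = x' i.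
  have E : x' = x by apply/ffunP => i; rewrite xx'.
  rewrite {x' xx'}E in Vx' hx'; exists x.
  have [Wx fx] := H x Vx hx; have [Wx' fx'] := H' x Vx' hx'.
  by [].
elim=> [_|n IH nm]; first by exists x1, x2.
have [x [x' [[Vx Vx' hx hx'] xx']]] := IH (ltnW nm); pose i : 'I_m := Ordinal nm.
have [||z [Uz Uz' hz1 hz1']] := irrX _ _ _ _ (oU i) (oU' i)
  (power_tensor_slice x i kh) (power_tensor_slice x' i kh').
- by exists (x i); rewrite ?upd_id.
- by exists (x' i); rewrite ?upd_id.
exists (upd x i z), (upd x' i z); split.
  by split=> // j; rewrite ffunE; case: eqP => [->|].
move=> j; rewrite ltnS leq_eqVlt !ffunE => jn; case: (eqVneq j i) => // ji.
by apply: xx'; move: jn; rewrite -[(j == n :> nat)]/(val j == val i) val_eqE (negPf ji).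
Qed.
End Powers.
End GeometricIrreducibility.

(** * Irreducibility of projective space and of the surface *)

Section ProjectiveIrreducibility.
Variables (k : fieldType) (K : closedFieldType) (iota : {rmorphism k -> K}).
Hypothesis charK : [pchar K] =i pred0.

Lemma evalpE n p (x : proj_point K n) :
  evalp iota p x = (map_mpoly iota p).@[rvec x 0].
Proof. by []. Qed.

Lemma dhomog_bigprod n (R : comNzRingType) (J : finType) (P : pred J) (d : J -> nat)
    (q : J -> {mpoly R[n]}) : (forall j, q j \is (d j).-homog) ->
  \prod_(j | P j) q j \is (\sum_(j | P j) d j)%N.-homog.
Proof.
move=> hq; apply: (big_rec2 (fun q e => q \is e.-homog)); first exact: dhomog1.
by move=> j q2 e _ h; exact: (dhomogM (hq j) h).
Qed.

(** Over a common denominator Q the function becomes P / Q with forms over K. The product of P, Q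
    and a denominator defining a neighbourhood inside O is one form that controls everything. *)
Lemma proj_kspan_local n O f (x : proj_space iota n) : opens (proj_space iota n) O ->
  kspan (regular (proj_space iota n) O) f -> O x -> f x != 0 ->
  exists d (G : {mpoly K[n.+1]}), [/\ G \is d.-homog, G.@[rvec x 0] != 0 &
    forall y : proj_space iota n, G.@[rvec y 0] != 0 -> O y /\ f y != 0].
Proof.
move=> oO [J [c [a [ra fE]]]] Ox fx.
have loc j : exists dpq : nat * ({mpoly K[n.+1]} * {mpoly K[n.+1]}),
    [/\ dpq.2.1 \is dpq.1.-homog, dpq.2.2 \is dpq.1.-homog, dpq.2.2.@[rvec x 0] != 0
      & forall y, O y -> dpq.2.2.@[rvec y 0] != 0 ->
        a j y = dpq.2.1.@[rvec y 0] / dpq.2.2.@[rvec y 0]].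
  have [V [g [h [[VT [d [p [q [hp hq gE hE]]]]] Vx hx aE]]]] := ra j x Ox.
  exists (d, (map_mpoly iota p, map_mpoly iota q)); split=> /=.
  - exact: map_mpoly_homog.
  - exact: map_mpoly_homog.
  - by rewrite -evalpE -hE.
  - by move=> y Oy; rewrite -!evalpE -gE -hE; apply: aE.
have {loc}[A AE] := fin_all_exists loc.
have [V [g0 [h0 [[VT [d0 [p0 [q0 [hp0 hq0 g0E h0E]]]]] Vx h0x h0O]]]] := oO x Ox.
pose Q := \prod_j (A j).2.2.
pose P := \sum_j c j *: ((A j).2.1 * \prod_(l | l != j) (A l).2.2).
have hQ : Q \is (\sum_j (A j).1)%N.-homog.
  by apply: dhomog_bigprod => j; case: (AE j).
have hP : P \is (\sum_j (A j).1)%N.-homog.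
  apply: rpred_sum => j _; apply: dhomogZ.
  have -> : (\sum_j (A j).1 = (A j).1 + \sum_(l | l != j) (A l).1)%N by rewrite (bigD1 j).
  apply: dhomogM; first by case: (AE j).
  by apply: dhomog_bigprod => l; case: (AE l).
have fPQ y : O y -> Q.@[rvec y 0] != 0 -> f y = P.@[rvec y 0] / Q.@[rvec y 0].
  move=> Oy Qy; rewrite fE /P raddf_sum mulr_suml; apply: eq_bigr => j _.
  have QE : Q.@[rvec y 0] = (A j).2.2.@[rvec y 0] * (\prod_(l | l != j) (A l).2.2).@[rvec y 0].
    by rewrite /Q (bigD1 j) //= mevalM.
  move: Qy; rewrite QE mulf_eq0 negb_or => /andP[qj ql].
  have [_ _ _ ->] // := AE j; rewrite /= mevalZ mevalM -mulrA; congr (_ * _).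
  by rewrite -mulf_div divff // mulr1.
have Qx : Q.@[rvec x 0] != 0.
  rewrite /Q rmorph_prod; apply/prodf_neq0 => j _.
  by case: (AE j).
exists (d0 + (\sum_j (A j).1 + \sum_j (A j).1))%N, (map_mpoly iota q0 * (Q * P)).
split.
- by apply: dhomogM; [exact: map_mpoly_homog|exact: dhomogM].
- rewrite !mevalM !mulf_neq0 //; first by rewrite -evalpE -h0E.
  by apply: contraNneq fx => Px; rewrite fPQ // Px mul0r.
move=> y; rewrite !mevalM !mulf_eq0 !negb_or => /and3P[q0y Qy Py].
have Oy : O y by apply: h0O; rewrite // h0E evalpE.
by split=> //; rewrite fPQ // mulf_neq0 // invr_eq0.
Qed.

Definition proj_of n (v : 'rV[K]_n.+1) (v0 : v != 0) : proj_space iota n :=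
  \pi_(proj_point K n) (Sub v v0 : nzvec K n).

Lemma rvec_neq0 n (x : proj_point K n) : rvec x != 0.
Proof. exact: valP (generic_quotient.repr x). Qed.

Lemma rvec_proj_of n (v : 'rV[K]_n.+1) (v0 : v != 0) :
  exists2 c, c != 0 & rvec (proj_of v0 : proj_point K n) = c *: v.
Proof. exact: repr_proj. Qed.

Lemma meval_proj_of n d (p : {mpoly K[n.+1]}) (v : 'rV[K]_n.+1) (v0 : v != 0) :
  p \is d.-homog ->
  (p.@[rvec (proj_of v0 : proj_point K n) 0] == 0) = (p.@[v 0] == 0).
Proof.
move=> hp; have [c c0 E] := rvec_proj_of v0.
have vE i : rvec (proj_of v0 : proj_point K n) 0 i = c * v 0 i by rewrite E mxE.
rewrite (meval_homogZ hp vE).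
by rewrite mulf_eq0 expf_eq0 (negPf c0) andbF.
Qed.

Lemma proj_geom_irr n : geom_irr (proj_space iota n).
Proof.
move=> U V f g oU oV kf kg [x Ux fx] [y Vy gy].
have [d [G [hG Gx GU]]] := proj_kspan_local oU kf Ux fx.
have [e [H [hH Hy HV]]] := proj_kspan_local oV kg Vy gy.
(* The factor ['X_ord0] makes the point found a nonzero vector, hence a point of projective
   space. *)
have GH0 : 'X_ord0 * (G * H) != 0.
  rewrite !mulf_neq0 //.
  - by apply/eqP => /mpolyP/(_ U_(ord0)%MM)/eqP; rewrite mcoeffX eqxx mcoeff0 oner_eq0.
  - by apply: contraNneq Gx => ->; rewrite meval0.
  - by apply: contraNneq Hy => ->; rewrite meval0.
have [v] := mpoly_neq0_point charK GH0.
rewrite !mevalM mevalXU !mulf_eq0 !negb_or => /and3P[v0 Gv Hv].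
pose w : 'rV[K]_n.+1 := \row_i v i.
have w0 : w != 0 by apply: contraNneq v0 => /rowP/(_ ord0); rewrite !mxE => ->.
have wE i : w 0 i = v i by rewrite mxE.
exists (proj_of w0).
have [] := GU (proj_of w0); first by rewrite (meval_proj_of _ hG) (meval_eq _ wE).
have [] := HV (proj_of w0); first by rewrite (meval_proj_of _ hH) (meval_eq _ wE).
by [].
Qed.

Lemma sub_kspan_local (X : kspace K) (Z : pred X) U f (x : subspace Z) :
  kaxioms iota X -> opens (subspace Z) U -> kspan (regular (subspace Z) U) f ->
  U x -> f x != 0 -> exists O g, [/\ opens X O, kspan (regular X O) g,
    O (val x) /\ g (val x) != 0 &
    forall y : subspace Z, O (val y) -> g (val y) != 0 -> U y /\ f y != 0].
Proof.
move=> kX [O0 oO0 UE] [J [c [a [ra fE]]]] Ux fx.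
have loc j : exists Og : (X -> Prop) * (X -> K), [/\ opens X Og.1,
    regular X Og.1 Og.2, Og.1 (val x) &
    forall y : subspace Z, U y -> Og.1 (val y) -> a j y = Og.2 (val y)].
  by have [O [g E]] := ra j x Ux; exists (O, g).
have {loc}[A AE] := fin_all_exists loc.
pose O y := O0 y /\ forall j, (A j).1 y.
have oO : opens X O.
  by apply: (opensI kX) => //; apply: (opensI_fin kX) => j; case: (AE j).
have Ax j : (A j).1 (val x) by case: (AE j).
exists O, (fun y => \sum_j c j * (A j).2 y); split=> //.
- apply: kspan_sum => j; apply: kspan_gen; have [_ rj _ _] := AE j.
  by apply: (regularS kX rj) => y [].
- split; first by split=> //; apply/UE.
  suff <- : f x = \sum_j c j * (A j).2 (val x) by [].
  by rewrite fE; apply: eq_bigr => j _; have [_ _ _ ->] := AE j.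
move=> y [O0y Ay] gy; have Uy : U y by apply/UE.
split=> //; suff -> : f y = \sum_j c j * (A j).2 (val y) by [].
by rewrite fE; apply: eq_bigr => j _; have [_ _ _ ->] := AE j.
Qed.

Lemma hypersurface_geom_irr (F : {mpoly k[4]}) : F != 0 -> F \is 3.-homog ->
  smooth_hypersurface iota F -> geom_irr (hypersurface iota F).
Proof.
move=> F0 hF sF U V f g oU oV kf kg [x Ux fx] [y Vy gy].
have kP := proj_space_kaxioms iota 3.
have [O [f1 [oO kf1 [Ox f1x] OU]]] := sub_kspan_local kP oU kf Ux fx.
have [O' [g1 [oO' kg1 [Oy g1y] OV]]] := sub_kspan_local kP oV kg Vy gy.
have [d [G [hG Gx GO]]] := proj_kspan_local oO kf1 Ox f1x.
have [e [H [hH Hy HO]]] := proj_kspan_local oO' kg1 Oy g1y.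
have FK3 := map_mpoly_homog iota hF.
have [z [z0 Fz Gz Hz]] := cubic_irreducible charK (map_mpoly_neq0 iota F0) FK3
  (smoothK sF) hG hH (rvec_neq0 _) (rvec_neq0 _)
  (eqP (valP x)) Gx (eqP (valP y)) Hy.
have Zz : evalp iota F (proj_of z0) == 0.
  by rewrite evalpE (meval_proj_of z0 FK3) Fz.
exists (exist _ (proj_of z0) Zz).
have [|O1 f2] := GO (proj_of z0); first by rewrite (meval_proj_of _ hG).
have [|O2 g2] := HO (proj_of z0); first by rewrite (meval_proj_of _ hH).
have [U1 f3] := OU (exist _ (proj_of z0) Zz) O1 f2.
by have [V1 g3] := OV (exist _ (proj_of z0) Zz) O2 g2.
Qed.
End ProjectiveIrreducibility.

(** * Interpolation by curves through m points *)

Section Lagrange.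
Variables (K : fieldType) (m : nat).
Implicit Types (t : 'rV[K]_m) (s : 'I_m -> K).

(** The Lagrange basis without its denominators [dprod], which are absorbed into the weights: all
    members are monic of degree m - 1, and the top coefficient of a combination is the sum of its
    weights. *)
Definition lag t i : {poly K} := \prod_(j | j != i) ('X - (t 0 j)%:P).
Definition dprod t i : K := \prod_(j | j != i) (t 0 i - t 0 j).
Definition lagsum s t : {poly K} := \sum_i (s i)%:P * lag t i.

Lemma lag_seq t i : lag t i =
  \prod_(x <- [seq t 0 j | j <- enum (predC1 i)]) ('X - x%:P).
Proof. by rewrite big_map big_enum. Qed.

Lemma size_lag_seq t i : size [seq t 0 j | j <- enum (predC1 i)] = m.-1.
Proof. by rewrite size_map -cardE cardC1 card_ord. Qed.

Lemma size_lag t i : size (lag t i) = m.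
Proof.
rewrite lag_seq size_prod_XsubC size_lag_seq prednK //.
exact: leq_ltn_trans (ltn_ord i).
Qed.

Lemma lag_eval t i l : (lag t i).[t 0 l] = if l == i then dprod t i else 0.
Proof.
rewrite horner_prod; case: eqP => [->|/eqP li].
  by apply: eq_bigr => j _; rewrite hornerXsubC.
by rewrite (bigD1 l) //= hornerXsubC subrr mul0r.
Qed.

Lemma dprod_neq0 t i : injective (t 0) -> dprod t i != 0.
Proof.
move=> t_inj; apply/prodf_neq0 => j ji; rewrite subr_eq0.
by apply: contraNneq ji => /t_inj->.
Qed.

Lemma lagsum_eval s t i : (lagsum s t).[t 0 i] = s i * dprod t i.
Proof.
rewrite horner_sum (bigD1 i) //= hornerM hornerC lag_eval eqxx big1 ?addr0 // => j ji.
by rewrite hornerM lag_eval eq_sym (negPf ji) mulr0.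
Qed.

Lemma size_lagsum s t : (size (lagsum s t) <= m)%N.
Proof.
apply: (big_ind (fun p : {poly K} => (size p <= m)%N)) => [|p q sp sq|i _].
- by rewrite size_poly0.
- by rewrite (leq_trans (size_polyD _ _)) // geq_max sp.
by rewrite mul_polyC (leq_trans (size_scale_leq _ _)) // size_lag.
Qed.

Lemma poly_eq_on t (p q : {poly K}) : injective (t 0) -> (size p <= m)%N ->
  (size q <= m)%N -> (forall i, p.[t 0 i] = q.[t 0 i]) -> p = q.
Proof.
move=> t_inj sp sq pq; apply/eqP; rewrite -subr_eq0; apply: contraTT isT => nz.
have U : uniq [seq t 0 i | i <- enum 'I_m] by rewrite (map_inj_uniq t_inj) enum_uniq.
have R : all (root (p - q)) [seq t 0 i | i <- enum 'I_m].
  by rewrite all_map; apply/allP => i _ /=; rewrite rootE !hornerE pq subrr.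
have := max_poly_roots nz R U; rewrite size_map size_enum_ord ltnNge.
by rewrite (leq_trans (size_polyD _ _)) // geq_max sp size_polyN.
Qed.

Lemma lagrange t (q : {poly K}) : injective (t 0) -> (size q <= m)%N ->
  q = lagsum (fun i => q.[t 0 i] / dprod t i) t.
Proof.
move=> t_inj sq; apply: (poly_eq_on t_inj) => // [|i]; first exact: size_lagsum.
by rewrite lagsum_eval divfK // dprod_neq0.
Qed.

Lemma lagsum_coef1 s t : (lagsum s t)`_m.-1 = \sum_i s i.
Proof.
rewrite coef_sum; apply: eq_bigr => i _; rewrite coefCM -{1}(size_lag t i) -lead_coefE.
by rewrite lag_seq (monicP (monic_prod_XsubC _ _ _)) mulr1.
Qed.

(** In [lag t i] the coefficient of degree m - 2 is minus the sum of the other nodes, that is t_i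
    minus the sum of all nodes. *)
Lemma lagsum_coef2 s t : (1 < m)%N ->
  (lagsum s t)`_m.-2 = \sum_i s i * t 0 i - (\sum_i s i) * \sum_i t 0 i.
Proof.
move=> m1; rewrite coef_sum mulr_suml -sumrB; apply: eq_bigr => i _.
rewrite coefCM lag_seq -{1}(size_lag_seq t i) coefPn_prod_XsubC; last first.
  by rewrite size_lag_seq; case: (m) m1 => [|[]].
rewrite big_map big_enum /= [in RHS](bigD1 i) //=.
by rewrite -mulrBr; congr (_ * _); ring.
Qed.

Lemma roots_poly_lag (t : 'rV[K]_m) i : (roots_poly t).[t 0 i] = 0.
Proof. by rewrite horner_prod (bigD1 i) //= hornerXsubC subrr mul0r. Qed.

Lemma roots_poly_seq (t : 'rV[K]_m) :
  roots_poly t = \prod_(x <- [seq t 0 i | i <- enum 'I_m]) ('X - x%:P).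
Proof. by rewrite big_map big_enum. Qed.

Lemma size_roots_poly (t : 'rV[K]_m) : size (roots_poly t) = m.+1.
Proof. by rewrite roots_poly_seq size_prod_XsubC size_map size_enum_ord. Qed.

Lemma roots_poly_coef (t : 'rV[K]_m) : (roots_poly t)`_m = 1.
Proof.
have -> : (roots_poly t)`_m = lead_coef (roots_poly t).
  by rewrite lead_coefE size_roots_poly.
rewrite roots_poly_seq; exact: monicP (monic_prod_XsubC _ _ _).
Qed.

Lemma sym_coefs_inj (t t' : 'rV[K]_m) : sym_coefs t = sym_coefs t' ->
  roots_poly t = roots_poly t'.
Proof.
move=> E; apply/polyP => j; case: (ltngtP j m) => [jm|mj|->].
- by have /rowP/(_ (Ordinal jm)) := E; rewrite !mxE.
- by rewrite !nth_default ?size_roots_poly.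
- by rewrite !roots_poly_coef.
Qed.

Lemma roots_poly_perm (t t' : 'rV[K]_m) : injective (t 0) ->
  roots_poly t = roots_poly t' -> exists s : 'S_m, t' = perm_row s t.
Proof.
move=> t_inj E.
have root_ex (u : 'rV[K]_m) x : (roots_poly u).[x] = 0 -> exists j, u 0 j = x.
  move=> /eqP; rewrite horner_prod => /prodf_eq0[j _].
  by rewrite hornerXsubC subr_eq0 => /eqP->; exists j.
have f_ex i : exists j, t 0 j = t' 0 i by apply: root_ex; rewrite E roots_poly_lag.
have [f fE] := fin_all_exists f_ex.
have f_surj j : exists i, f i = j.
  have [|i it] := root_ex t' (t 0 j); first by rewrite -E roots_poly_lag.
  by exists i; apply: t_inj; rewrite fE.
have f_inj : injective f.
  have [g gE] := fin_all_exists f_surj.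
  have g_inj : injective g by apply: (can_inj (g := f)) => j; rewrite gE.
  have [h gh hg] := injF_bij g_inj.
  by apply: (can_inj (g := g)) => i; rewrite -{1}[i]hg gE hg.
by exists (perm f_inj); apply/rowP => i; rewrite mxE permE fE.
Qed.
End Lagrange.

Section Construction.
Variables (K : closedFieldType) (m n : nat).
(* The parameters u encode y, z in K^m and c in K^4.  Solving a G = y and
   b G = z for G = (gh_j (v_i)) gives the weights a_i and the roots t_i = b_i / a_i
   of the curve sum_i a_i v_i prod_(j <> i) (T - t_j) + c prod_j (T - t_j), which
   passes through [v_i] at T = t_i.  Conversely a_i is w_0(t_i) divided by
   prod_(j <> i) (t_i - t_j).  As a and b are permuted together with the v_i, the
   coordinates y and z are symmetric. *)
Implicit Types (w : 'M[K]_4) (t : 'rV[K]_m) (v : 'M[K]_(m, 4)) (u : 'rV[K]_n).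
Variables (gh : 'I_m -> 'rV[K]_4 -> K) (Ey Ez : 'rV[K]_n -> 'rV[K]_m).
Variables (Ec : 'rV[K]_n -> 'rV[K]_4) (Rp : 'rV[K]_m -> 'rV[K]_m -> 'rV[K]_4 -> 'rV[K]_n).
Variables (Cw : 'M[K]_4 -> 'rV[K]_4).
Hypothesis ghZ : forall j c (v : 'rV[K]_4), gh j (c *: v) = c ^+ 2 * gh j v.

Definition gmx (v : 'M[K]_(m, 4)) : 'M[K]_m := \matrix_(i, j) gh j (row i v).

Definition wt_a (v : 'M[K]_(m, 4)) u := Ey u *m invmx (gmx v).
Definition wt_b (v : 'M[K]_(m, 4)) u := Ez u *m invmx (gmx v).
Definition src_t v u : 'rV[K]_m := \row_i (wt_b v u 0 i / wt_a v u 0 i).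
Definition src_poly v u l : {poly K} :=
  lagsum (fun i => wt_a v u 0 i * v i l) (src_t v u) +
    (Ec u 0 l)%:P * roots_poly (src_t v u).
Definition src_w v u : 'M[K]_4 := \matrix_(j, l) (src_poly v u l)`_j.

Definition src_good (v : 'M[K]_(m, 4)) u : bool :=
  [&& \det (gmx v) != 0, [forall i, wt_a v u 0 i != 0]
    & [forall i, forall j, (src_t v u 0 i == src_t v u 0 j) ==> (i == j)]].

Definition curve_pts (w : 'M[K]_4) (t : 'rV[K]_m) : 'M[K]_(m, 4) :=
  \matrix_(i, l) (curve w l).[t 0 i].
Definition tgt_v w t : 'M[K]_(m, 4) :=
  \matrix_(i, l) (curve_pts w t i l / curve_pts w t i 0).
Definition tgt_a w t : 'rV[K]_m := \row_i (curve_pts w t i 0 / dprod t i).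
Definition tgt_u w t : 'rV[K]_n := Rp (tgt_a w t *m gmx (tgt_v w t))
  ((\row_i (tgt_a w t 0 i * t 0 i)) *m gmx (tgt_v w t)) (Cw w).

Definition tgt_good (w : 'M[K]_4) (t : 'rV[K]_m) : bool :=
  [&& [forall i, forall j, (t 0 i == t 0 j) ==> (i == j)],
      [forall i, curve_pts w t i 0 != 0] & \det (gmx (curve_pts w t)) != 0].

Lemma tgt_goodP w t : reflect [/\ injective (t 0),
  forall i, curve_pts w t i 0 != 0 & \det (gmx (curve_pts w t)) != 0] (tgt_good w t).
Proof.
apply: (iffP and3P) => -[H1 H2 H3]; split=> //.
- by move=> i j E; apply/eqP; have /forallP/(_ i)/forallP/(_ j) := H1; rewrite E eqxx.
- exact/forallP.
- by apply/forallP => i; apply/forallP => j; apply/implyP => /eqP/H1->.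
- exact/forallP.
Qed.

Lemma src_goodP v u : reflect [/\ \det (gmx v) != 0, forall i, wt_a v u 0 i != 0
  & injective (src_t v u 0)] (src_good v u).
Proof.
apply: (iffP and3P) => -[H1 H2 H3]; split=> //.
- exact/forallP.
- by move=> i j E; apply/eqP; have /forallP/(_ i)/forallP/(_ j) := H3; rewrite E eqxx.
- exact/forallP.
- by apply/forallP => i; apply/forallP => j; apply/implyP => /eqP/H3->.
Qed.

(** [Ey], [Ez] and [Ec] unpack the parameter u and [Rp] packs it. For m = 6 packing drops
    coordinates, so the converse [R_E] is asked only of data coming from a curve of degree 3. *)
Hypothesis E_R : forall u, Rp (Ey u) (Ez u) (Ec u) = u.
Hypothesis src_size : forall v u l, src_good v u -> (forall i, v i 0 = 1) ->
  (size (src_poly v u l) <= 4)%N.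
Hypothesis src_C : forall v u, src_good v u -> (forall i, v i 0 = 1) ->
  Cw (src_w v u) = Ec u.
Hypothesis tgt_size : forall w t l, tgt_good w t ->
  (size (curve w l - (Cw w 0 l)%:P * roots_poly t)%R <= m)%N.
Hypothesis R_E : forall w t, tgt_good w t ->
  [/\ Ey (tgt_u w t) = tgt_a w t *m gmx (tgt_v w t),
      Ez (tgt_u w t) = (\row_i (tgt_a w t 0 i * t 0 i)) *m gmx (tgt_v w t)
    & Ec (tgt_u w t) = Cw w].

Lemma gmxZ (v v' : 'M[K]_(m, 4)) (e : 'I_m -> K) :
  (forall i, row i v' = e i *: row i v) ->
  gmx v' = diag_mx (\row_i (e i ^+ 2)) *m gmx v.
Proof.
move=> E; apply/matrixP => i j; rewrite mul_diag_mx !mxE E ghZ //.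
Qed.

Lemma tgt_v_row w t i : row i (tgt_v w t) = (curve_pts w t i 0)^-1 *: row i (curve_pts w t).
Proof. by apply/rowP => l; rewrite !mxE mulrC. Qed.

Lemma tgt_gmx_det w t : tgt_good w t -> \det (gmx (tgt_v w t)) != 0.
Proof.
move=> /tgt_goodP[_ w0 dw]; rewrite (gmxZ (tgt_v_row w t)) det_mulmx mulf_neq0 //.
rewrite det_diag; apply/prodf_neq0 => i _; rewrite mxE expf_neq0 // invr_eq0.
exact: w0.
Qed.

Lemma tgt_a_neq0 w t i : tgt_good w t -> tgt_a w t 0 i != 0.
Proof.
move=> /tgt_goodP[t_inj w0 _]; rewrite mxE mulf_neq0 //.
by rewrite invr_eq0 dprod_neq0.
Qed.

Lemma tgt_src_t w t : tgt_good w t ->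
  wt_a (tgt_v w t) (tgt_u w t) = tgt_a w t /\ src_t (tgt_v w t) (tgt_u w t) = t.
Proof.
move=> G; have [Ry Rz _] := R_E G; have /tgt_goodP[t_inj w0 _] := G.
have U : gmx (tgt_v w t) \in unitmx by rewrite unitmxE unitfE tgt_gmx_det.
have aE : wt_a (tgt_v w t) (tgt_u w t) = tgt_a w t by rewrite /wt_a Ry mulmxK.
split=> //; apply/rowP => i; rewrite mxE aE /wt_b Rz mulmxK // [X in X / _]mxE.
by rewrite mulrAC divff ?mul1r // tgt_a_neq0.
Qed.

Lemma tgt_src_good w t : tgt_good w t -> src_good (tgt_v w t) (tgt_u w t).
Proof.
move=> G; have [aE tE] := tgt_src_t G; have /tgt_goodP[t_inj w0 _] := G.
apply/src_goodP; rewrite aE tE; split=> //; first exact: tgt_gmx_det.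
by move=> i; apply: tgt_a_neq0.
Qed.

Lemma curve_size (w : 'M[K]_4) l : (size (curve w l) <= 4)%N.
Proof.
apply: (big_ind (fun p : {poly K} => (size p <= 4)%N)) => [|p q sp sq|i _].
- by rewrite size_poly0.
- by rewrite (leq_trans (size_polyD _ _)) // geq_max sp.
by rewrite mul_polyC (leq_trans (size_scale_leq _ _)) // size_polyXn.
Qed.

Lemma curve_coef (w : 'M[K]_4) l (j : 'I_4) : (curve w l)`_j = w j l.
Proof.
rewrite coef_sum (bigD1 j) //= coefCM coefXn eqxx mulr1 big1 ?addr0 // => i ij.
by rewrite coefCM coefXn eq_sym -[(_ == _)]/(i == j) (negPf ij) mulr0.
Qed.

Lemma curve_inj (w : 'M[K]_4) l (p : {poly K}) : (size p <= 4)%N ->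
  (forall j : 'I_4, p`_j = w j l) -> curve w l = p.
Proof.
move=> sp E; apply/polyP => j; case: (ltnP j 4) => j4.
  by rewrite (curve_coef w l (Ordinal j4)) -E.
by rewrite !nth_default // (leq_trans _ j4) // curve_size.
Qed.

(** Without the multiple of the product of the T - t_j the curve has degree less than m, and
    Lagrange interpolation at the t_i recovers it. *)
Lemma tgt_src_w w t : tgt_good w t -> src_w (tgt_v w t) (tgt_u w t) = w.
Proof.
move=> G; have [aE tE] := tgt_src_t G; have [_ _ cE] := R_E G.
have /tgt_goodP[t_inj w0 _] := G.
apply/matrixP => j l; rewrite mxE -(curve_coef w l j).
suff -> : src_poly (tgt_v w t) (tgt_u w t) l = curve w l by [].
rewrite /src_poly aE tE cE -[RHS](subrK ((Cw w 0 l)%:P * roots_poly t)).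
rewrite [in RHS](lagrange t_inj (tgt_size l G)); congr (_ + _).
apply: eq_bigr => i _; congr (_%:P * _).
rewrite hornerD hornerN hornerM roots_poly_lag mulr0 subr0.
have := w0 i; rewrite !mxE => w0i; field.
by rewrite w0i dprod_neq0.
Qed.

Section FromSource.
Variables (v : 'M[K]_(m, 4)) (u : 'rV[K]_n).
Hypotheses (G : src_good v u) (v0 : forall i, v i 0 = 1).
Let w := src_w v u.
Let t := src_t v u.

Lemma src_curve l : curve w l = src_poly v u l.
Proof. by apply: curve_inj => [|j]; [exact: src_size|rewrite mxE]. Qed.

(** At T = t_i only the i-th term survives, so the curve passes through the point of row i of v. *)
Lemma src_curve_pts i l : curve_pts w t i l = wt_a v u 0 i * dprod t i * v i l.
Proof.
by rewrite mxE src_curve /src_poly hornerD lagsum_eval hornerM roots_poly_lag mulr0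
  addr0 mulrAC.
Qed.

Lemma src_tgt_v : tgt_v w t = v.
Proof.
have /src_goodP[_ a0 t_inj] := G.
apply/matrixP => i l; rewrite mxE !src_curve_pts v0 mulr1 mulrC mulKf //.
by rewrite mulf_neq0 // dprod_neq0.
Qed.

Lemma src_tgt_good : tgt_good w t.
Proof.
have /src_goodP[dv a0 t_inj] := G; apply/tgt_goodP; split=> //.
  by move=> i; rewrite src_curve_pts v0 mulr1 mulf_neq0 // dprod_neq0.
rewrite (@gmxZ v _ (fun i => wt_a v u 0 i * dprod t i)).
  rewrite det_mulmx mulf_neq0 // det_diag; apply/prodf_neq0 => i _.
  by rewrite mxE expf_neq0 // mulf_neq0 // dprod_neq0.
by move=> i; apply/rowP => l; rewrite mxE src_curve_pts !mxE.
Qed.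

Lemma src_tgt_u : tgt_u w t = u.
Proof.
have /src_goodP[dv a0 t_inj] := G.
have U : gmx v \in unitmx by rewrite unitmxE unitfE.
have aE : tgt_a w t = wt_a v u.
  by apply/rowP => i; rewrite mxE src_curve_pts v0 mulr1 mulfK // dprod_neq0.
have bE : \row_i (tgt_a w t 0 i * t 0 i) = wt_b v u.
  by apply/rowP => i; rewrite mxE aE [t 0 i]mxE mulrC divfK.
rewrite /tgt_u bE aE src_tgt_v src_C // /wt_a /wt_b !mulmxKV //.
Qed.
End FromSource.
End Construction.

(** * Independence of the ordering of the points *)

Section PermutationInvariance.
Variables (K : closedFieldType) (m n : nat).
Implicit Types (w : 'M[K]_4) (t : 'rV[K]_m) (v : 'M[K]_(m, 4)) (u : 'rV[K]_n).
Variables (gh : 'I_m -> 'rV[K]_4 -> K) (Ey Ez : 'rV[K]_n -> 'rV[K]_m).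
Variables (Ec : 'rV[K]_n -> 'rV[K]_4) (Rp : 'rV[K]_m -> 'rV[K]_m -> 'rV[K]_4 -> 'rV[K]_n).
Variables (Cw : 'M[K]_4 -> 'rV[K]_4).
Variable s : 'S_m.

Lemma lag_perm t i : lag (perm_row s t) i = lag t (s i).
Proof.
rewrite /lag [RHS](reindex_inj (@perm_inj _ s)) /=; apply: eq_big => j.
  by rewrite (inj_eq (@perm_inj _ s)).
by rewrite mxE.
Qed.

Lemma dprod_perm t i : dprod (perm_row s t) i = dprod t (s i).
Proof.
rewrite /dprod [RHS](reindex_inj (@perm_inj _ s)) /=; apply: eq_big => j.
  by rewrite (inj_eq (@perm_inj _ s)).
by rewrite !mxE.
Qed.

Lemma roots_poly_perm_row t : roots_poly (perm_row s t) = roots_poly t.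
Proof.
rewrite /roots_poly [RHS](reindex_inj (@perm_inj _ s)) /=.
by apply: eq_bigr => i _; rewrite mxE.
Qed.

Lemma lagsum_perm (a : 'I_m -> K) t :
  lagsum (fun i => a (s i)) (perm_row s t) = lagsum a t.
Proof.
rewrite /lagsum [RHS](reindex_inj (@perm_inj _ s)) /=.
by apply: eq_bigr => i _; rewrite lag_perm.
Qed.

Lemma gmx_perm v : gmx gh (row_perm s v) = row_perm s (gmx gh v).
Proof.
apply/matrixP => i j; rewrite !mxE; congr (gh _ _).
by apply/rowP => l; rewrite !mxE.
Qed.

Lemma det_gmx_perm v : (\det (gmx gh (row_perm s v)) == 0) = (\det (gmx gh v) == 0).
Proof.
by rewrite gmx_perm row_permE det_mulmx det_perm mulf_eq0 signr_eq0.
Qed.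

Lemma mul_row_perm (a : 'rV[K]_m) (G : 'M[K]_m) :
  perm_row s a *m row_perm s G = a *m G.
Proof.
apply/rowP => j; rewrite !mxE [RHS](reindex_inj (@perm_inj _ s)) /=.
by apply: eq_bigr => i _; rewrite !mxE.
Qed.

Lemma solve_perm (y : 'rV[K]_m) v : \det (gmx gh v) != 0 ->
  y *m invmx (gmx gh (row_perm s v)) = perm_row s (y *m invmx (gmx gh v)).
Proof.
move=> dv; have U : gmx gh v \in unitmx by rewrite unitmxE unitfE.
have U' : gmx gh (row_perm s v) \in unitmx by rewrite unitmxE unitfE det_gmx_perm.
by rewrite -[RHS](mulmxK U') gmx_perm mul_row_perm mulmxKV.
Qed.

Lemma src_t_perm v u : \det (gmx gh v) != 0 ->
  src_t gh Ey Ez (row_perm s v) u = perm_row s (src_t gh Ey Ez v u).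
Proof.
move=> dv; apply/rowP => i; rewrite mxE [RHS]mxE [in RHS]mxE.
rewrite /wt_b /wt_a !solve_perm //; congr (_ / _).
  by rewrite [LHS]mxE.
by rewrite [LHS]mxE.
Qed.

Lemma src_w_perm v u : \det (gmx gh v) != 0 ->
  src_w gh Ey Ez Ec (row_perm s v) u = src_w gh Ey Ez Ec v u.
Proof.
move=> dv; apply/matrixP => j l; rewrite mxE [RHS]mxE.
suff -> : src_poly gh Ey Ez Ec (row_perm s v) u l = src_poly gh Ey Ez Ec v u l by [].
rewrite /src_poly src_t_perm // roots_poly_perm_row; congr (_ + _).
rewrite -[RHS]lagsum_perm; apply: eq_bigr => i _; congr (_%:P * _).
rewrite /wt_a solve_perm // [row_perm s v i l]mxE; congr (_ * _).
by rewrite [LHS]mxE.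
Qed.

Lemma src_good_perm v u : src_good gh Ey Ez v u -> src_good gh Ey Ez (row_perm s v) u.
Proof.
move=> /src_goodP[dv a0 t_inj]; apply/src_goodP; split.
- by rewrite det_gmx_perm.
- by move=> i; rewrite /wt_a solve_perm // mxE; apply: a0.
move=> i j; rewrite src_t_perm // [LHS]mxE [RHS]mxE => /t_inj.
exact: perm_inj.
Qed.

Lemma curve_pts_perm w t : curve_pts w (perm_row s t) = row_perm s (curve_pts w t).
Proof. by apply/matrixP => i l; rewrite !mxE. Qed.

Lemma tgt_good_perm w t : tgt_good gh w t -> tgt_good gh w (perm_row s t).
Proof.
move=> /tgt_goodP[t_inj w0 dv]; apply/tgt_goodP; split.
- by move=> i j; rewrite !mxE => /t_inj; apply: perm_inj.
- by move=> i; rewrite curve_pts_perm mxE; apply: w0.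
- by rewrite curve_pts_perm det_gmx_perm.
Qed.

Lemma tgt_v_perm w t : tgt_v w (perm_row s t) = row_perm s (tgt_v w t).
Proof. by apply/matrixP => i l; rewrite !mxE. Qed.

Lemma tgt_a_perm w t : tgt_a w (perm_row s t) = perm_row s (tgt_a w t).
Proof. by apply/rowP => i; rewrite mxE curve_pts_perm dprod_perm !mxE. Qed.

Lemma tgt_u_perm w t : tgt_u gh Rp Cw w (perm_row s t) = tgt_u gh Rp Cw w t.
Proof.
rewrite /tgt_u tgt_v_perm gmx_perm tgt_a_perm mul_row_perm; congr (Rp _ _ _).
rewrite -[RHS]mul_row_perm; congr (_ *m _).
by apply/rowP => i; rewrite !mxE.
Qed.
End PermutationInvariance.

(** * The construction is rational over k *)

Section ConstructionRational.
Variables (k : fieldType) (K : closedFieldType) (iota : {rmorphism k -> K}) (m n : nat).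
Variables (gh : 'I_m -> 'rV[K]_4 -> K) (Ey Ez : 'rV[K]_n -> 'rV[K]_m).
Variables (Ec : 'rV[K]_n -> 'rV[K]_4) (Rp : 'rV[K]_m -> 'rV[K]_m -> 'rV[K]_4 -> 'rV[K]_n).
Variables (Cw : 'M[K]_4 -> 'rV[K]_4).
Hypothesis kgh : forall j, kalg iota (fun i (u : 'rV[K]_4) => u 0 i) (gh j).
Hypothesis kEy : forall j, kalg iota (fun i (u : 'rV[K]_n) => u 0 i) (fun u => Ey u 0 j).
Hypothesis kEz : forall j, kalg iota (fun i (u : 'rV[K]_n) => u 0 i) (fun u => Ez u 0 j).
Hypothesis kEc : forall j, kalg iota (fun i (u : 'rV[K]_n) => u 0 i) (fun u => Ec u 0 j).
Hypothesis kCw : forall j, kalg iota (fun i (w : 'M[K]_4) => w i.1 i.2) (fun w => Cw w 0 j).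
Hypothesis kRp : forall i,
  [\/ exists j, forall y z c, Rp y z c 0 i = y 0 j,
      exists j, forall y z c, Rp y z c 0 i = z 0 j
    | exists j, forall y z c, Rp y z c 0 i = c 0 j].

Section Source.
Variables (T I : Type) (c : I -> T -> K) (v : T -> 'M[K]_(m, 4)) (u : T -> 'rV[K]_n).
Hypothesis kv : forall i l, kalg iota c (fun x => v x i l).
Hypothesis ku : forall i, kalg iota c (fun x => u x 0 i).

Lemma kalg_gmx i j : kalg iota c (fun x => gmx gh (v x) i j).
Proof.
apply: (@kalg_ext _ _ _ _ _ _ (fun x => gh j (row i (v x)))).
  by move=> x; rewrite mxE.
apply: kalg_comp (kgh j) => l; apply: kalg_ext (kv i l) => x.
by rewrite mxE.
Qed.

Lemma kalg_adj i j : kalg iota c (fun x => (\adj (gmx gh (v x))) i j).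
Proof.
apply: (@kalg_ext _ _ _ _ _ _ (fun x => (-1) ^+ (j + i) *
    \det (row' j (col' i (gmx gh (v x)))))).
  by move=> x; rewrite mxE.
apply: kalgM.
  apply: kalg_ext (kalg_exp (j + i) (kalgC iota c (-1))) => x.
  by rewrite rmorphN1.
apply: kalg_det => i' j'; apply: kalg_ext (kalg_gmx (lift j i') (lift i j')) => x.
by rewrite !mxE.
Qed.

Definition num_a x : 'rV[K]_m := Ey (u x) *m \adj (gmx gh (v x)).
Definition num_b x : 'rV[K]_m := Ez (u x) *m \adj (gmx gh (v x)).

Lemma kalg_num_a i : kalg iota c (fun x => num_a x 0 i).
Proof.
apply: (@kalg_ext _ _ _ _ _ _ (fun x => \sum_j Ey (u x) 0 j * (\adj (gmx gh (v x))) j i)).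
  by move=> x; rewrite mxE.
apply: kalg_sum => j _; apply: kalgM; last exact: kalg_adj.
exact: kalg_comp (kEy j).
Qed.

Lemma kalg_num_b i : kalg iota c (fun x => num_b x 0 i).
Proof.
apply: (@kalg_ext _ _ _ _ _ _ (fun x => \sum_j Ez (u x) 0 j * (\adj (gmx gh (v x))) j i)).
  by move=> x; rewrite mxE.
apply: kalg_sum => j _; apply: kalgM; last exact: kalg_adj.
exact: kalg_comp (kEz j).
Qed.

(** A polynomial form of [src_good]: Cramer numerators replace the weights, and t_i != t_j becomes
    b_i a_j != b_j a_i. *)
Definition src_disc x : K := \det (gmx gh (v x)) * ((\prod_i num_a x 0 i) *
  \prod_i \prod_(j | j != i) (num_b x 0 i * num_a x 0 j - num_b x 0 j * num_a x 0 i)).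

Lemma kalg_src_disc : kalg iota c src_disc.
Proof.
apply: kalgM; first by apply: kalg_det => i j; apply: kalg_gmx.
apply: kalgM; first by apply: kalg_prod => i _; apply: kalg_num_a.
apply: kalg_prod => i _; apply: kalg_prod => j _.
by apply: kalgB; apply: kalgM; try exact: kalg_num_a; exact: kalg_num_b.
Qed.

Lemma src_discE x : src_good gh Ey Ez (v x) (u x) = (src_disc x != 0).
Proof.
have [d0|d0] := eqVneq (\det (gmx gh (v x))) 0.
  rewrite /src_disc d0 mul0r eqxx; apply/negP => /src_goodP[].
  by rewrite d0 eqxx.
have U : gmx gh (v x) \in unitmx by rewrite unitmxE unitfE.
have aE i : wt_a gh Ey (v x) (u x) 0 i = (\det (gmx gh (v x)))^-1 * num_a x 0 i.
  by rewrite /wt_a /invmx U -scalemxAr mxE.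
have bE i : wt_b gh Ez (v x) (u x) 0 i = (\det (gmx gh (v x)))^-1 * num_b x 0 i.
  by rewrite /wt_b /invmx U -scalemxAr mxE.
have di : (\det (gmx gh (v x)))^-1 != 0 by rewrite invr_eq0.
have tE i : num_a x 0 i != 0 ->
    src_t gh Ey Ez (v x) (u x) 0 i = num_b x 0 i / num_a x 0 i.
  by move=> a0; rewrite mxE aE bE -mulf_div divff // mul1r.
apply/idP/idP => [/src_goodP[_ a0 t_inj]|].
  have a0' i : num_a x 0 i != 0.
    by have := a0 i; rewrite aE mulf_eq0 negb_or => /andP[].
  rewrite /src_disc !mulf_neq0 //; first by apply/prodf_neq0 => i _.
  apply/prodf_neq0 => i _; apply/prodf_neq0 => j ji.
  apply: contraNneq ji => E; apply/eqP/t_inj; rewrite !tE //.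
  by apply/eqP; rewrite eqr_div // eq_sym -subr_eq0 E.
rewrite /src_disc !mulf_eq0 !negb_or => /and3P[_ /prodf_neq0 a0 /prodf_neq0 dd].
apply/src_goodP; split=> // [i|i j].
  by rewrite aE mulf_neq0 // a0.
rewrite !tE ?a0 // => /eqP; rewrite eqr_div ?a0 // => /eqP E.
apply/eqP; apply: contraT => ij.
have /prodf_neq0/(_ j) := dd i isT; rewrite eq_sym => /(_ ij).
by rewrite E subrr eqxx.
Qed.

Variable S : T -> Prop.
Hypothesis S_good : forall x, S x -> src_good gh Ey Ez (v x) (u x).

Let S_det x : S x -> gmx gh (v x) \in unitmx.
Proof. by move=> /S_good/src_goodP[d0 _ _]; rewrite unitmxE unitfE. Qed.

Lemma rat_wt_a i : rat iota c S (fun x => wt_a gh Ey (v x) (u x) 0 i).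
Proof.
apply: (@rat_ext _ _ _ _ _ _ _ (fun x => \sum_j Ey (u x) 0 j * invmx (gmx gh (v x)) j i)).
  by move=> x _; rewrite mxE.
apply: rat_sum => j _; apply: ratM.
  by apply: rat_kalg; apply: kalg_comp (kEy j).
by apply: rat_invmx => [i' j'|x Sx]; [exact/rat_kalg/kalg_gmx|exact: S_det].
Qed.

Lemma rat_wt_b i : rat iota c S (fun x => wt_b gh Ez (v x) (u x) 0 i).
Proof.
apply: (@rat_ext _ _ _ _ _ _ _ (fun x => \sum_j Ez (u x) 0 j * invmx (gmx gh (v x)) j i)).
  by move=> x _; rewrite mxE.
apply: rat_sum => j _; apply: ratM.
  by apply: rat_kalg; apply: kalg_comp (kEz j).
by apply: rat_invmx => [i' j'|x Sx]; [exact/rat_kalg/kalg_gmx|exact: S_det].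
Qed.

Lemma rat_src_t i : rat iota c S (fun x => src_t gh Ey Ez (v x) (u x) 0 i).
Proof.
apply: (@rat_ext _ _ _ _ _ _ _ (fun x => wt_b gh Ez (v x) (u x) 0 i *
    (wt_a gh Ey (v x) (u x) 0 i)^-1)).
  by move=> x _; rewrite [RHS]mxE.
apply: ratM; first exact: rat_wt_b.
by apply: ratV; [move=> x /S_good/src_goodP[]|exact: rat_wt_a].
Qed.

Lemma ratp_src_root i : ratp iota c S (fun x => 'X - (src_t gh Ey Ez (v x) (u x) 0 i)%:P).
Proof. by apply: ratpB; [exact: ratpX|exact/ratpC/rat_src_t]. Qed.

Lemma rat_src_w j l : rat iota c S (fun x => src_w gh Ey Ez Ec (v x) (u x) j l).
Proof.
have rp : ratp iota c S (fun x => src_poly gh Ey Ez Ec (v x) (u x) l).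
  apply: ratpD.
    apply: ratp_sum => i _; apply: ratpM.
      by apply/ratpC/ratM; [exact: rat_wt_a|exact: rat_kalg].
    by apply: ratp_prod => i' _; apply: ratp_src_root.
  apply: ratpM; first by apply/ratpC/rat_kalg; apply: kalg_comp (kEc l).
  by apply: ratp_prod => i' _; apply: ratp_src_root.
by apply: rat_ext (rp j) => x _; rewrite [RHS]mxE.
Qed.

Lemma rat_src_coefs j : rat iota c S (fun x => sym_coefs (src_t gh Ey Ez (v x) (u x)) 0 j).
Proof.
have rp : ratp iota c S (fun x => roots_poly (src_t gh Ey Ez (v x) (u x))).
  by apply: ratp_prod => i' _; apply: ratp_src_root.
by apply: rat_ext (rp j) => x _; rewrite [RHS]mxE.
Qed.
End Source.

Section Target.
Definition mx_coord (i : 'I_4 * 'I_4) (w : 'M[K]_4) : K := w i.1 i.2.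
Local Notation crd := (pair_coord mx_coord (m := m)).

Lemma kalg_mx_coord j l : kalg iota crd (fun z : 'M[K]_4 * 'rV[K]_m => z.1 j l).
Proof. exact: (kalgX _ crd (inl (j, l))). Qed.

Lemma kalg_root_coord i : kalg iota crd (fun z : 'M[K]_4 * 'rV[K]_m => z.2 0 i).
Proof. exact: (kalgX _ crd (inr i)). Qed.

Lemma kalg_curve_pts i l : kalg iota crd (fun z : 'M[K]_4 * 'rV[K]_m => curve_pts z.1 z.2 i l).
Proof.
apply: (@kalg_ext _ _ _ _ _ _ (fun z : 'M[K]_4 * 'rV[K]_m => \sum_j z.1 j l * z.2 0 i ^+ j)).
  by move=> z; rewrite mxE curveE.
apply: kalg_sum => j _; apply: kalgM; first exact: kalg_mx_coord.
exact/kalg_exp/kalg_root_coord.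
Qed.

Lemma kalg_dprod i : kalg iota crd (fun z : 'M[K]_4 * 'rV[K]_m => dprod z.2 i).
Proof. by apply: kalg_prod => j _; apply: kalgB; exact: kalg_root_coord. Qed.

Variable S : 'M[K]_4 * 'rV[K]_m -> Prop.
Hypothesis S_good : forall z, S z -> tgt_good gh z.1 z.2.

Lemma rat_tgt_a i : rat iota crd S (fun z : 'M[K]_4 * 'rV[K]_m => tgt_a z.1 z.2 0 i).
Proof.
apply: (@rat_ext _ _ _ _ _ _ _ (fun z : 'M[K]_4 * 'rV[K]_m => curve_pts z.1 z.2 i 0 * (dprod z.2 i)^-1)).
  by move=> z _; rewrite [RHS]mxE.
apply: ratM; first exact/rat_kalg/kalg_curve_pts.
apply: ratV; last exact/rat_kalg/kalg_dprod.
by move=> z /S_good/tgt_goodP[t_inj _ _]; apply: dprod_neq0.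
Qed.

Lemma rat_tgt_v i l : rat iota crd S (fun z : 'M[K]_4 * 'rV[K]_m => tgt_v z.1 z.2 i l).
Proof.
apply: (@rat_ext _ _ _ _ _ _ _ (fun z : 'M[K]_4 * 'rV[K]_m => curve_pts z.1 z.2 i l *
    (curve_pts z.1 z.2 i 0)^-1)).
  by move=> z _; rewrite [RHS]mxE.
apply: ratM; first exact/rat_kalg/kalg_curve_pts.
apply: ratV; last exact/rat_kalg/kalg_curve_pts.
by move=> z /S_good/tgt_goodP[].
Qed.

Lemma rat_tgt_gmx i j : rat iota crd S (fun z : 'M[K]_4 * 'rV[K]_m => gmx gh (tgt_v z.1 z.2) i j).
Proof.
apply: (@rat_ext _ _ _ _ _ _ _ (fun z : 'M[K]_4 * 'rV[K]_m => gh j (row i (tgt_v z.1 z.2)))).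
  by move=> z _; rewrite [RHS]mxE.
apply: rat_comp (kgh j) => l; apply: rat_ext (rat_tgt_v i l) => z _.
by rewrite [RHS]mxE.
Qed.

Lemma rat_tgt_u i : rat iota crd S (fun z : 'M[K]_4 * 'rV[K]_m => tgt_u gh Rp Cw z.1 z.2 0 i).
Proof.
case: (kRp i) => -[j E].
- apply: (@rat_ext _ _ _ _ _ _ _ (fun z : 'M[K]_4 * 'rV[K]_m => \sum_l tgt_a z.1 z.2 0 l *
    gmx gh (tgt_v z.1 z.2) l j)).
    by move=> z _; rewrite /tgt_u E [RHS]mxE.
  by apply: rat_sum => l _; apply: ratM; [exact: rat_tgt_a|exact: rat_tgt_gmx].
- apply: (@rat_ext _ _ _ _ _ _ _ (fun z : 'M[K]_4 * 'rV[K]_m => \sum_l (tgt_a z.1 z.2 0 l * z.2 0 l) *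
    gmx gh (tgt_v z.1 z.2) l j)).
    move=> z _; rewrite /tgt_u E [RHS]mxE; apply: eq_bigr => l _.
    by rewrite [in RHS]mxE.
  apply: rat_sum => l _; apply: ratM; last exact: rat_tgt_gmx.
  by apply: ratM; [exact: rat_tgt_a|exact/rat_kalg/kalg_root_coord].
apply: (@rat_ext _ _ _ _ _ _ _ (fun z : 'M[K]_4 * 'rV[K]_m => Cw z.1 0 j)).
  by move=> z _; rewrite /tgt_u E.
by apply/rat_kalg; apply: kalg_comp (kCw j) => -[i' l]; exact: kalg_mx_coord.
Qed.
End Target.
End ConstructionRational.

(** * Charts *)

Lemma row_coef (R : Type) m n (M : 'M[R]_(m, n)) i l : row i M 0 l = M i l.
Proof. by rewrite mxE. Qed.

Section ProjectiveCharts.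
Variables (k K : fieldType) (iota : {rmorphism k -> K}).

Lemma proj_quotient_regular n d (p q : {mpoly k[n.+1]}) :
  p \is d.-homog -> q \is d.-homog ->
  opens (proj_space iota n) (fun x => evalp iota q x != 0) /\
  regular (proj_space iota n) (fun x => evalp iota q x != 0)
    (fun x => evalp iota p x / evalp iota q x).
Proof.
move=> hp hq; have pf : proj_frac iota (fun=> True) (evalp iota p) (evalp iota q).
  by split=> //; exists d, p, q.
by split=> x qx; exists (fun=> True), (evalp iota p), (evalp iota q).
Qed.

Lemma const_mx1_neq0 n : (const_mx 1 : 'rV[K]_n.+1) != 0.
Proof. by apply/eqP => /rowP/(_ ord0)/eqP; rewrite !mxE oner_eq0. Qed.

(** [insubd] makes the map total; the value at the zero vector is an arbitrary default. *)
Definition pt_of n (v : 'rV[K]_n.+1) : proj_point K n :=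
  \pi_(proj_point K n) (insubd (exist _ (const_mx 1) (const_mx1_neq0 n) : nzvec K n) v).

Lemma pt_ofE n (v : 'rV[K]_n.+1) : v != 0 ->
  exists2 c, c != 0 & rvec (pt_of v) = c *: v.
Proof.
move=> v0; have [c c0 E] := repr_proj (insubd (exist _ (const_mx 1) (const_mx1_neq0 n) : nzvec K n) v).
by exists c; rewrite // /pt_of E val_insubd v0.
Qed.

Lemma evalp_pt_of n d (p : {mpoly k[n.+1]}) (v : 'rV[K]_n.+1) :
  p \is d.-homog -> v != 0 ->
  (evalp iota p (pt_of v) == 0) = (evalv iota p v == 0).
Proof.
move=> hp /pt_ofE[c c0 E].
rewrite /evalp -/(rvec _) E (evalvZ _ _ _ hp) mulf_eq0 expf_eq0 (negPf c0).
by rewrite andbF.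
Qed.

Lemma dhomogXU n (i : 'I_n) : ('X_i : {mpoly k[n]}) \is 1.-homog.
Proof. by rewrite dhomogX /= mdeg1. Qed.

Lemma evalpXU n (i : 'I_n.+1) (x : proj_point K n) : evalp iota 'X_i x = rvec x 0 i.
Proof. by rewrite /evalp /evalv map_mpolyX mevalXU. Qed.

Definition par_coord n (j : 'I_n) (y : proj_space iota n) : K :=
  rvec y 0 (lift ord0 j) / rvec y 0 ord0.
Definition par_dom n (y : proj_space iota n) : Prop := rvec y 0 ord0 != 0.

Lemma opens_par_dom n : opens (proj_space iota n) (@par_dom n).
Proof.
have [o _] := proj_quotient_regular (dhomogXU ord0) (dhomogXU (ord0 : 'I_n.+1)).
by apply: opens_ext o => y; rewrite evalpXU.
Qed.

Lemma regular_par_coord n (j : 'I_n) :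
  regular (proj_space iota n) (@par_dom n) (par_coord j).
Proof.
have [_ r] := proj_quotient_regular (dhomogXU (lift ord0 j)) (dhomogXU (ord0 : 'I_n.+1)).
have kP := proj_space_kaxioms iota n.
apply: (regularE kP (f := fun x => evalp iota 'X_(lift ord0 j) x / evalp iota 'X_ord0 x)).
  by move=> x _; rewrite !evalpXU.
by apply: (regularS kP r) => x; rewrite evalpXU.
Qed.

Definition par_row n (y : proj_space iota n) : 'rV[K]_n := \row_j par_coord j y.
Definition par_lift n (u : 'rV[K]_n) : 'rV[K]_n.+1 :=
  \row_j (if unlift ord0 j is Some i then u 0 i else 1).
Definition par_pt n (u : 'rV[K]_n) : proj_space iota n := pt_of (par_lift u).

Lemma par_lift_neq0 n (u : 'rV[K]_n) : par_lift u != 0.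
Proof.
apply/eqP => /rowP/(_ ord0)/eqP; rewrite !mxE; case: unliftP => [j /eqP|_].
  by rewrite -val_eqE.
by rewrite oner_eq0.
Qed.

Lemma par_lift0 n (u : 'rV[K]_n) : par_lift u 0 ord0 = 1.
Proof. by rewrite mxE; case: unliftP => // j /eqP; rewrite -val_eqE. Qed.

Lemma par_ptK n (u : 'rV[K]_n) : par_row (par_pt u) = u /\ par_dom (par_pt u).
Proof.
have [c c0 E] := pt_ofE (par_lift_neq0 u).
have E' i : rvec (par_pt u) 0 i = c * par_lift u 0 i by rewrite E mxE.
rewrite /par_dom E' par_lift0 mulr1; split=> //.
apply/rowP => j; rewrite mxE /par_coord !E' par_lift0 mulr1.
by rewrite mxE liftK mulrC mulKf.
Qed.

Lemma par_rowK n (y : proj_space iota n) : par_dom y -> par_pt (par_row y) = y.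
Proof.
move=> y0; have [c c0 E] := pt_ofE (par_lift_neq0 (par_row y)).
apply: (@proj_eq _ _ _ _ (c / rvec y 0 ord0)); rewrite E -scalerA.
congr (_ *: _); apply/rowP => j; rewrite [RHS]mxE mxE.
case: unliftP => [i ->|->]; first by rewrite mxE /par_coord mulrC.
by rewrite mulVf.
Qed.
End ProjectiveCharts.

(** * Affine coordinates on the surface in a frame *)

Section HypersurfaceChart.
Variables (k : fieldType) (K : closedFieldType) (iota : {rmorphism k -> K}).
Variables (F : {mpoly k[4]}) (F_cubic : F \is 3.-homog).
Variables (A : 'M[k]_4) (A_unit : A \in unitmx).
Local Notation X := (hypersurface iota F).
Local Notation AK := (map_mx iota A).

(** Coordinates in the basis formed by the rows of A. For the frame of [exists_frame], the curve
    with nine distinct intersections is (1, t, t^2, t^3) in them. *)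
Definition lin (x : X) : 'rV[K]_4 := rvec (val x) *m invmx AK.
Definition lin_poly l : {mpoly k[4]} := \sum_j invmx A j l *: 'X_j.
Definition aff_coord (l : 'I_4) (x : X) : K := lin x 0 l / lin x 0 0.
Definition aff_dom (x : X) : Prop := lin x 0 0 != 0.
Definition aff_row (x : X) : 'rV[K]_4 := \row_l aff_coord l x.
Definition frame_eval (v : 'rV[K]_4) : K := evalv iota F (v *m AK).

Lemma lin_polyE l (x : X) : evalp iota (lin_poly l) (val x) = lin x 0 l.
Proof.
rewrite /evalp /evalv /lin_poly (rmorph_sum (map_mpoly iota)) (rmorph_sum (meval _)) mxE; apply: eq_bigr => j _ /=.
by rewrite map_mpolyZ mevalZ map_mpolyX mevalXU -map_invmx mxE mulrC.
Qed.

Lemma lin_poly_homog l : lin_poly l \is 1.-homog.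
Proof. by apply: rpred_sum => j _; apply: dhomogZ; apply: dhomogXU. Qed.

Lemma opens_aff_dom : opens X aff_dom.
Proof.
have [o _] := proj_quotient_regular iota (lin_poly_homog 0) (lin_poly_homog 0).
exists (fun x => evalp iota (lin_poly 0) x != 0) => // x.
by rewrite lin_polyE.
Qed.

Lemma regular_aff_coord l : regular X aff_dom (aff_coord l).
Proof.
have [o r] := proj_quotient_regular iota (lin_poly_homog l) (lin_poly_homog 0).
move=> x x0; exists (fun x => evalp iota (lin_poly 0) x != 0),
  (fun x => evalp iota (lin_poly l) x / evalp iota (lin_poly 0) x).
by split=> //; rewrite ?lin_polyE // => y _ _; rewrite !lin_polyE.
Qed.

Let AK_unit : AK \in unitmx. Proof. by rewrite map_unitmx. Qed.

Lemma frame_evalZ c v : frame_eval (c *: v) = c ^+ 3 * frame_eval v.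
Proof. by rewrite /frame_eval -scalemxAl (evalvZ _ _ _ F_cubic). Qed.

Lemma lin_frame x : frame_eval (lin x) = 0.
Proof. by rewrite /frame_eval /lin mulmxKV //; apply/eqP/(valP x). Qed.

Lemma aff_rowE x : aff_row x = (lin x 0 0)^-1 *: lin x.
Proof. by apply/rowP => l; rewrite [LHS]mxE [RHS]mxE /aff_coord mulrC. Qed.

Lemma aff_row_frame x : frame_eval (aff_row x) = 0.
Proof. by rewrite aff_rowE frame_evalZ lin_frame mulr0. Qed.

Lemma aff_row0 x : aff_dom x -> aff_row x 0 0 = 1.
Proof. by move=> x0; rewrite mxE /aff_coord divff. Qed.

Variable x_def : X.

Definition cubic_pt (v : 'rV[K]_4) : X := insubd x_def (pt_of (v *m AK)).

Lemma cubic_ptE (v : 'rV[K]_4) : v != 0 -> frame_eval v = 0 ->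
  exists2 c, c != 0 & rvec (val (cubic_pt v)) = c *: (v *m AK).
Proof.
move=> v0 Fv; have vA : v *m AK != 0.
  by apply: contraNneq v0 => vA; rewrite -[v](mulmxK AK_unit) vA mul0mx.
rewrite /cubic_pt val_insubd (evalp_pt_of iota F_cubic vA) -/(frame_eval v) Fv eqxx.
exact: pt_ofE.
Qed.

Lemma lin_cubic_pt (v : 'rV[K]_4) : v != 0 -> frame_eval v = 0 ->
  exists2 c, c != 0 & lin (cubic_pt v) = c *: v.
Proof.
move=> v0 Fv; have [c c0 E] := cubic_ptE v0 Fv.
by exists c; rewrite // /lin E -scalemxAl mulmxK.
Qed.

Lemma aff_cubic_pt (v : 'rV[K]_4) : v 0 0 != 0 -> frame_eval v = 0 ->
  aff_dom (cubic_pt v) /\ aff_row (cubic_pt v) = (v 0 0)^-1 *: v.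
Proof.
move=> v00 Fv; have v0 : v != 0 by apply: contraNneq v00 => ->; rewrite mxE.
have [c c0 E] := lin_cubic_pt v0 Fv.
rewrite /aff_dom aff_rowE E mxE; split; first by rewrite mulf_neq0.
by rewrite scalerA invfM mulrAC mulVf // mul1r.
Qed.

Lemma cubic_pt_aff (e : K) (x : X) : e != 0 -> aff_dom x -> cubic_pt (e *: aff_row x) = x.
Proof.
move=> e0 x0; have v0 : e *: aff_row x != 0.
  rewrite scaler_eq0 negb_or e0 /=; apply: contraTneq (oner_neq0 K) => z.
  by rewrite -(aff_row0 x0) z mxE eqxx.
have [|c c0 E] := cubic_ptE v0; first by rewrite frame_evalZ aff_row_frame mulr0.
apply/val_inj/(@proj_eq _ _ _ _ (c * (e * (lin x 0 0)^-1))); rewrite E aff_rowE.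
by rewrite -!scalemxAl /lin mulmxKV // !scalerA mulrA.
Qed.
End HypersurfaceChart.

(** * Symmetric products and spaces of curves *)

Section SymmetricModel.
Variables (k : fieldType) (K : closedFieldType) (iota : {rmorphism k -> K}).
Hypothesis charK : [pchar K] =i pred0.
Variables (F : {mpoly k[4]}) (F_cubic : F \is 3.-homog).
Variables (A : 'M[k]_4) (A_unit : A \in unitmx).
Variables (m n : nat) (m_gt0 : (0 < m)%N).
Variables (gh : 'I_m -> 'rV[K]_4 -> K) (Ey Ez : 'rV[K]_n -> 'rV[K]_m).
Variables (Ec : 'rV[K]_n -> 'rV[K]_4) (Rp : 'rV[K]_m -> 'rV[K]_m -> 'rV[K]_4 -> 'rV[K]_n).
Variables (Cw : 'M[K]_4 -> 'rV[K]_4).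

Hypothesis ghZ : forall j c (v : 'rV[K]_4), gh j (c *: v) = c ^+ 2 * gh j v.
Hypothesis kgh : forall j, kalg iota (fun i (u : 'rV[K]_4) => u 0 i) (gh j).
Hypothesis kEy : forall j, kalg iota (fun i (u : 'rV[K]_n) => u 0 i) (fun u => Ey u 0 j).
Hypothesis kEz : forall j, kalg iota (fun i (u : 'rV[K]_n) => u 0 i) (fun u => Ez u 0 j).
Hypothesis kEc : forall j, kalg iota (fun i (u : 'rV[K]_n) => u 0 i) (fun u => Ec u 0 j).
Hypothesis kCw : forall j, kalg iota (fun i (w : 'M[K]_4) => w i.1 i.2) (fun w => Cw w 0 j).
Hypothesis kRp : forall i,
  [\/ exists j, forall y z c, Rp y z c 0 i = y 0 j,
      exists j, forall y z c, Rp y z c 0 i = z 0 j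
    | exists j, forall y z c, Rp y z c 0 i = c 0 j].
Hypothesis E_R : forall u, Rp (Ey u) (Ez u) (Ec u) = u.
Hypothesis src_size : forall v u l, src_good gh Ey Ez v u -> (forall i, v i 0 = 1) ->
  (size (src_poly gh Ey Ez Ec v u l) <= 4)%N.
Hypothesis src_C : forall v u, src_good gh Ey Ez v u -> (forall i, v i 0 = 1) ->
  Cw (src_w gh Ey Ez Ec v u) = Ec u.
Hypothesis tgt_size : forall w t l, tgt_good gh w t ->
  (size (curve w l - (Cw w 0 l)%:P * roots_poly t)%R <= m)%N.
Hypothesis R_E : forall w t, tgt_good gh w t ->
  [/\ Ey (tgt_u gh Rp Cw w t) = tgt_a w t *m gmx gh (tgt_v w t),
      Ez (tgt_u gh Rp Cw w t) = (\row_i (tgt_a w t 0 i * t 0 i)) *m gmx gh (tgt_v w t)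
    & Ec (tgt_u gh Rp Cw w t) = Cw w].

Local Notation X := (hypersurface iota F).
Local Notation P := (proj_space iota n).
Local Notation Sm := (sym_product X m).
Local Notation src := (prod_space Sm P).
Local Notation aX := (aff_coord A (iota := iota) (F := F)).
Local Notation cX := (ffun_coord aX (@par_coord k K iota n) (m := m)).
Local Notation locus := (@affine_locus K X P (aff_dom A (F := F)) (@par_dom k K iota n) m).

Definition aff_mx (x : {ffun 'I_m -> X}) : 'M[K]_(m, 4) := \matrix_(i, l) aX l (x i).

Lemma aff_mx_row i x : row i (aff_mx x) = aff_row A (x i).
Proof. by apply/rowP => l; rewrite !mxE. Qed.

Lemma aff_mx_perm s x : aff_mx (perm_ffun s x) = row_perm s (aff_mx x).
Proof. by apply/matrixP => i l; rewrite !mxE ffunE. Qed.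

Definition src_dom (z : src) : Prop :=
  locus z /\ src_good gh Ey Ez (aff_mx (sym_lift z.1)) (par_row z.2).

(** Frees the domain from the ordering chosen by [sym_lift]. *)
Lemma src_dom_class x y : src_dom (sym_class x, y) <->
  [/\ forall i, aff_dom A (x i), par_dom y & src_good gh Ey Ez (aff_mx x) (par_row y)].
Proof.
rewrite /src_dom affine_locus_class /=; have [s xs] := sym_classK x.
have xs' : x = perm_ffun s^-1 (sym_lift (sym_class x)).
  by rewrite xs perm_ffunM mulVg; apply/ffunP => i; rewrite ffunE perm1.
split=> [[[Xx Py] G]|[Xx Py G]].
  by split; [exact: Xx|exact: Py|rewrite xs' aff_mx_perm; exact: src_good_perm G].
by split; [split; [exact: Xx|exact: Py]|rewrite xs aff_mx_perm; exact: src_good_perm G].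
Qed.

Let kX : kaxioms iota X := subspace_kaxioms _ (proj_space_kaxioms iota 3).
Let kP : kaxioms iota P := proj_space_kaxioms iota n.
Let kS : kaxioms iota src :=
  prod_space_kaxioms (sym_product_kaxioms kX m_gt0) kP.

Let m_fact : (m`!)%:R != 0 :> K.
Proof. by rewrite (natrK_eq0 charK) -lt0n fact_gt0. Qed.

Lemma kalg_aff_mx i l : kalg iota cX (fun z => aff_mx z.1 i l).
Proof. by apply: kalg_ext (kalgX iota cX (inl (l, i))) => z; rewrite mxE. Qed.

Lemma kalg_par_row j : kalg iota cX (fun z => par_row z.2 0 j).
Proof. by apply: kalg_ext (kalgX iota cX (inr j)) => z; rewrite mxE. Qed.

Lemma opens_src_dom : opens src src_dom.
Proof.
have kD := kalg_src_disc kgh kEy kEz kalg_aff_mx kalg_par_row.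
have DE x (y : P) : src_disc gh Ey Ez (fun z => aff_mx z.1) (fun z => par_row z.2) (x, y) != 0
    = src_good gh Ey Ez (aff_mx x) (par_row y).
  by rewrite -(src_discE _ _ _ (fun z => aff_mx z.1) (fun z : _ * P => par_row z.2) (x, y)).
have := sym_open kX kP (opens_aff_dom iota F A) (@opens_par_dom k K iota n)
  (@regular_aff_coord k K iota F A) (@regular_par_coord _ _ iota n) m_gt0 m_fact kD.
move=> H; apply: opens_ext (H _) => [z|x y s].
  by rewrite DE.
by rewrite DE DE aff_mx_perm => G; exact: src_good_perm G.
Qed.

Definition tgt_pred (z : 'M[K]_4 * 'rV[K]_m) : bool :=
  tgt_good gh z.1 z.2 &&
  [forall i, frame_eval iota F A (row i (curve_pts z.1 z.2)) == 0].

Lemma sym_coefs_surj (p : 'rV[K]_m) : exists t, sym_coefs t == p.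
Proof.
(* At j = m [insub] fails, and its default 1 becomes the leading coefficient. *)
pose q : {poly K} := \poly_(j < m.+1) (if insub j is Some i then p 0 i else 1).
have qm : q`_m = 1 by rewrite coef_poly ltnSn insubF ?ltnn.
have sq : size q = m.+1.
  apply: size_poly_eq; by rewrite insubF ?ltnn // oner_neq0.
have [r rE] := closed_field_poly_normal q.
have lq : lead_coef q = 1 by rewrite lead_coefE sq.
rewrite lq scale1r in rE.
have sr : size r = m by have := sq; rewrite rE size_prod_XsubC => -[].
exists (\row_(i < m) r`_i); apply/eqP/rowP => j; rewrite mxE.
have <- : q = roots_poly (\row_(i < m) r`_i).
  apply: (etrans rE); rewrite (big_nth 0) sr big_mkord.
  by apply: eq_bigr => i _; rewrite mxE.
by rewrite coef_poly ltnS (ltnW (ltn_ord j)) valK.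
Qed.

(** An ordering of the roots chosen pointwise, with no regularity; it only enters constructions that
    are invariant under permutation of the roots. *)
Definition roots_of (p : 'rV[K]_m) : 'rV[K]_m := xchoose (sym_coefs_surj p).

Lemma roots_ofK p : sym_coefs (roots_of p) = p.
Proof. exact/eqP/(xchooseP (sym_coefs_surj p)). Qed.

Lemma tgt_pred_perm w t s : tgt_pred (w, t) -> tgt_pred (w, perm_row s t).
Proof.
move=> /andP[G /forallP H]; apply/andP; split; first exact: tgt_good_perm.
apply/forallP => i; have := H (s i); congr (frame_eval _ _ _ _ == 0).
by apply/rowP => l; rewrite !mxE.
Qed.

Definition tgt_coef_pred (z : 'M[K]_4 * 'rV[K]_m) : bool := tgt_pred (z.1, roots_of z.2).

Lemma tgt_coef_predE w t : tgt_pred (w, t) -> tgt_coef_pred (w, sym_coefs t).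
Proof.
move=> G; have /andP[/tgt_goodP[t_inj _ _] _] := G.
rewrite /tgt_coef_pred /=; have [|s ->] := roots_poly_perm t_inj (t' := roots_of (sym_coefs t)).
  by apply: sym_coefs_inj; rewrite roots_ofK.
exact: tgt_pred_perm.
Qed.

Lemma tgt_coef_pred_lift w p : tgt_coef_pred (w, p) ->
  exists2 t, tgt_pred (w, t) & sym_coefs t = p.
Proof. by move=> H; exists (roots_of p) => //; apply: roots_ofK. Qed.

Lemma tgt_pred_inj w t : tgt_pred (w, t) -> injective (t 0).
Proof. by move=> /andP[/tgt_goodP[]]. Qed.

Local Notation crd := (pair_coord (@mx_coord K) (m := m)).
Local Notation root_space := (aff_sub iota crd tgt_pred).
(** The model of the good part of W_m: w together with the coefficients of a monic factor whose m
    roots are distinct parameters of points on the surface. [root_space] is its cover by ordered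
    roots. *)
Definition tgt : kspace K := aff_sub iota crd tgt_coef_pred.

Lemma tgt_kaxioms : kaxioms iota tgt.
Proof. exact: aff_sub_kaxioms. Qed.

Variables (x_def : X) (tgt_def : tgt).

Definition src_raw (z : {ffun 'I_m -> X} * P) : 'M[K]_4 * 'rV[K]_m :=
  (src_w gh Ey Ez Ec (aff_mx z.1) (par_row z.2),
   sym_coefs (src_t gh Ey Ez (aff_mx z.1) (par_row z.2))).

Definition src_map (z : src) : tgt := insubd tgt_def (src_raw (sym_lift z.1, z.2)).

Lemma src_raw_perm x y s : \det (gmx gh (aff_mx x)) != 0 ->
  src_raw (perm_ffun s x, y) = src_raw (x, y).
Proof.
by move=> d0; rewrite /src_raw /= aff_mx_perm src_w_perm // src_t_perm // sym_coefs_perm.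
Qed.

Lemma src_raw_good x y : src_dom (sym_class x, y) ->
  tgt_pred ((src_raw (x, y)).1, src_t gh Ey Ez (aff_mx x) (par_row y)).
Proof.
move=> /src_dom_class[Xx Py G].
have v0 i : aff_mx x i 0 = 1.
  by rewrite mxE; have := aff_row0 (Xx i); rewrite mxE.
apply/andP; split; first exact: src_tgt_good.
apply/forallP => i; set v := row i _.
have -> : v = (wt_a gh Ey (aff_mx x) (par_row y) 0 i *
    dprod (src_t gh Ey Ez (aff_mx x) (par_row y)) i) *: aff_row A (x i).
  apply/rowP => l; rewrite -aff_mx_row row_coef (src_curve_pts src_size G v0) //.
  by rewrite [RHS]mxE row_coef.
by rewrite frame_evalZ // aff_row_frame // mulr0.
Qed.

Lemma val_src_map x y : src_dom (sym_class x, y) ->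
  val (src_map (sym_class x, y)) = src_raw (x, y).
Proof.
move=> Ux; have [s xs] := sym_classK x.
have /src_dom_class[_ _ /src_goodP[d0 _ _]] := Ux.
rewrite /src_map /= xs src_raw_perm // val_insubd; case: ifP => // /negP[].
exact: tgt_coef_predE (src_raw_good Ux).
Qed.

Lemma src_map_morphism : morphism_on src_dom src_map.
Proof.
apply: morphism_on_aff => //; first exact: opens_src_dom.
move=> i; pose S z := src_dom (sym_class z.1, z.2).
have S_good z : S z -> src_good gh Ey Ez (aff_mx z.1) (par_row z.2).
  by case: z => x y /src_dom_class[].
apply: (sym_descent_regular kX kP (opens_aff_dom iota F A) (@opens_par_dom k K iota n)
  (@regular_aff_coord k K iota F A) (@regular_par_coord _ _ iota n) m_gt0 m_fact
  opens_src_dom (F := fun z => crd i (src_raw z))).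
- by move=> z [].
- case: i => [[j l]|j] /=.
    exact: (rat_src_w kgh kEy kEz kEc kalg_aff_mx kalg_par_row S_good).
  exact: (rat_src_coefs kgh kEy kEz kalg_aff_mx kalg_par_row S_good).
by move=> x y Uxy; rewrite val_src_map.
Qed.

Definition root_pts (w : 'M[K]_4) (t : 'rV[K]_m) : {ffun 'I_m -> X} :=
  [ffun i => cubic_pt A x_def (row i (curve_pts w t))].

Definition tgt_map (z : tgt) : src :=
  (sym_class (root_pts (val z).1 (roots_of (val z).2)),
   par_pt iota (tgt_u gh Rp Cw (val z).1 (roots_of (val z).2))).

Lemma root_pts_perm w t s : root_pts w (perm_row s t) = perm_ffun s (root_pts w t).
Proof.
apply/ffunP => i; rewrite !ffunE curve_pts_perm; congr (cubic_pt _ _ _).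
by apply/rowP => l; rewrite !mxE.
Qed.

Lemma tgt_mapE w t (Z : tgt_coef_pred (w, sym_coefs t)) : tgt_pred (w, t) ->
  tgt_map (exist (fun x => tgt_coef_pred x) (w, sym_coefs t) Z) =
  (sym_class (root_pts w t), par_pt iota (tgt_u gh Rp Cw w t)).
Proof.
move=> G; have [|s sE] := roots_poly_perm (tgt_pred_inj G) (t' := roots_of (sym_coefs t)).
  by apply: sym_coefs_inj; rewrite roots_ofK.
by rewrite /tgt_map /= sE root_pts_perm sym_class_perm tgt_u_perm.
Qed.

Lemma root_pts_morphism : morphism_on (X := root_space) (Y := power_space X m)
  (fun=> True) (fun z => root_pts (val z).1 (val z).2).
Proof.
have kN := aff_sub_kaxioms iota crd tgt_pred; have oT := opensT kN.
apply: (morphism_on_power kN oT) => i; apply: (morphism_on_subspace kN).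
apply: (morphism_on_proj kN oT
  (v := fun z => row i (curve_pts (val z).1 (val z).2) *m map_mx iota A)).
  move=> l; apply: aff_regular.
  have kc : kalg iota crd (fun z => \sum_j curve_pts z.1 z.2 i j * iota (A j l)).
    by apply: kalg_sum => j _; apply: kalgM; [exact: kalg_curve_pts|exact: kalgC].
  apply: kalg_ext (kalg_sub _ kc) => z; rewrite [RHS]mxE.
  by apply: eq_bigr => j _; rewrite row_coef; congr (_ * _); rewrite mxE.
move=> [[w t] G] _ /=; have /andP[/tgt_goodP[_ w0 _] /forallP/(_ i)/eqP Fi] := G.
rewrite ffunE; apply: cubic_ptE => //.
apply: contraNneq (w0 i) => /rowP/(_ 0); rewrite row_coef => ->.
by rewrite mxE.
Qed.

(** On ordered roots the map is given by explicit rational functions; [morphism_on_root_descent]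
    carries it to the coefficients, in which the single roots are not rational. *)
Lemma tgt_map_morphism : morphism_on (fun=> True) tgt_map.
Proof.
have kN := aff_sub_kaxioms iota crd tgt_pred; have oT := opensT kN.
apply: (morphism_on_root_descent tgt_pred_inj tgt_pred_perm
  (ZNM := tgt_coef_predE) tgt_coef_pred_lift).
have mapE (z : root_space) : tgt_map (root_map tgt_coef_predE z) =
    (sym_class (root_pts (val z).1 (val z).2),
     par_pt iota (tgt_u gh Rp Cw (val z).1 (val z).2)).
  case: z => -[w t] G; rewrite -(tgt_mapE (tgt_coef_predE G) G).
  by apply: (congr1 tgt_map); apply: val_inj.
rewrite (functional_extensionality _ _ mapE).
apply: (morphism_on_prod kN) => /=.
  move=> W oW; have [o r] := root_pts_morphism (W := fun x => W (sym_class x)) oW.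
  split; first exact: o.
  by move=> f rf; apply: (r (fun x => f (sym_class x))).
apply: (morphism_on_proj kN oT
  (v := fun z => par_lift (tgt_u gh Rp Cw (val z).1 (val z).2))).
  move=> j; have S_good (z : 'M[K]_4 * 'rV[K]_m) : tgt_pred z -> tgt_good gh z.1 z.2.
    by case/andP.
  have rj : rat iota crd tgt_pred (fun z => par_lift (tgt_u gh Rp Cw z.1 z.2) 0 j).
    case: (unliftP ord0 j) => [i ji|ji].
      apply: rat_ext (rat_tgt_u kgh kCw kRp S_good i) => z _.
      by rewrite mxE ji liftK.
    by apply: rat_ext (rat1 _ _ _) => z _; rewrite ji par_lift0.
  by apply: (rat_regular _ rj) => z _; apply: (valP z).
by move=> z _; apply: pt_ofE; apply: par_lift_neq0.
Qed.

Lemma src_mapK z : src_dom z -> tgt_map (src_map z) = z.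
Proof.
case: z => s y; rewrite -[s]sym_liftK; move: (sym_lift s) => x {s} Uxy.
have /src_dom_class[Xx Py G] := Uxy.
have v0 i : aff_mx x i 0 = 1.
  by rewrite mxE; have := aff_row0 (Xx i); rewrite mxE.
have gN := src_raw_good Uxy; have gM := tgt_coef_predE gN.
have -> : src_map (sym_class x, y) = exist (fun x => tgt_coef_pred x) _ gM.
  by apply: val_inj; rewrite /= val_src_map.
rewrite tgt_mapE //; congr (_, _); last first.
  by rewrite (src_tgt_u E_R src_size src_C) // par_rowK.
congr sym_class; apply/ffunP => i; rewrite ffunE.
have /src_goodP[_ a0 t_inj] := G.
(* The curve at t_i is the normalised vector of the i-th point times a_i and [dprod]; this nonzero
   factor does not change the projective point. *)
rewrite -[RHS](cubic_pt_aff F_cubic A_unit x_def (e := wt_a gh Ey (aff_mx x) (par_row y) 0 i *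
    dprod (src_t gh Ey Ez (aff_mx x) (par_row y)) i)) //; last first.
  by rewrite mulf_neq0 // dprod_neq0.
congr (cubic_pt _ _ _); apply/rowP => l.
rewrite -aff_mx_row row_coef (src_curve_pts src_size G v0) //.
by rewrite [RHS]mxE row_coef.
Qed.

Lemma tgt_mapK z : src_dom (tgt_map z) /\ src_map (tgt_map z) = z.
Proof.
case: z => -[w p] Zp; have [t G tp] := tgt_coef_pred_lift Zp.
case: p / tp in Zp *; rewrite tgt_mapE //.
have /andP[tG /forallP Fw] := G; have /tgt_goodP[t_inj w0 _] := tG.
have vE : aff_mx (root_pts w t) = tgt_v w t.
  apply/row_matrixP => i; rewrite aff_mx_row ffunE tgt_v_row.
  have w0i : row i (curve_pts w t) 0 0 != 0 by rewrite row_coef; apply: w0.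
  have [_ ->] := aff_cubic_pt F_cubic A_unit x_def w0i (eqP (Fw i)).
  by rewrite row_coef.
have [uE uD] := par_ptK iota (tgt_u gh Rp Cw w t).
have Ud : src_dom (sym_class (root_pts w t), par_pt iota (tgt_u gh Rp Cw w t)).
  apply/src_dom_class; split=> // [i|]; last first.
    by rewrite vE uE; apply: (tgt_src_good ghZ R_E tG).
  rewrite ffunE; apply: (aff_cubic_pt F_cubic A_unit x_def _ (eqP (Fw i))).1.
  by rewrite row_coef; apply: w0.
split=> //; apply: val_inj; rewrite val_src_map //= /src_raw /= vE uE.
have [_ ->] := tgt_src_t ghZ R_E tG.
by rewrite (tgt_src_w ghZ tgt_size R_E).
Qed.
End SymmetricModel.

(** * Residual intersection *)

Lemma mmap_map_mpoly n (R S T : comNzRingType) (f : {rmorphism R -> S})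
    (g : {rmorphism S -> T}) (w : 'I_n -> T) p :
  mmap g w (map_mpoly f p) = mmap (g \o f) w p.
Proof.
elim/mpoly_alg_ind: p => [c|i|p q Hp Hq|p q Hp Hq].
- by rewrite map_mpolyC !mmapC.
- by rewrite map_mpolyX !mmapX.
- by rewrite !raddfD /= Hp Hq.
- by rewrite !rmorphM /= Hp Hq.
Qed.

(* As p is monic, f = q p can be solved for the coefficients of q from the top down. *)
Lemma ratp_quotient (k K : fieldType) (iota : {rmorphism k -> K}) (T I : Type)
    (c : I -> T -> K) (S : T -> Prop) (f p q : T -> {poly K}) m d :
  ratp iota c S f -> ratp iota c S p ->
  (forall x, S x -> [/\ f x = q x * p x, (size (p x) <= m.+1)%N, (p x)`_m = 1
    & (size (q x) <= d)%N]) -> ratp iota c S q.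
Proof.
move=> rf rp H; suff Hr e j : (d - e <= j)%N -> rat iota c S (fun x => (q x)`_j).
  by move=> j; apply: (Hr d); rewrite subnn.
elim: e j => [|e IH] j ej.
  apply: rat_ext (rat0 _ _ _) => x /H[_ _ _ sq]; rewrite nth_default //.
  by rewrite (leq_trans sq) // -[d]subn0.
apply: (@rat_ext _ _ _ _ _ _ _ (fun x => (f x)`_(j + m) -
    \sum_(i < m) (p x)`_i * (q x)`_(j + m - i))).
  move=> x /H[fE sp pm sq]; rewrite fE mulrC coefM.
  have mj : (m < (j + m).+1)%N by rewrite ltnS leq_addl.
  rewrite (bigID (fun i : 'I_(j + m).+1 => (i < m)%N)) /=.
  rewrite (big_ord_narrow (ltnW mj)) /= addrAC subrr add0r.
  rewrite (bigD1 (Ordinal mj)) /=; last by rewrite ltnn.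
  rewrite addnK pm mul1r big1 ?addr0 // => i /andP[im].
  rewrite -val_eqE /= => ii; rewrite nth_default ?mul0r //.
  by rewrite (leq_trans sp) // ltn_neqAle eq_sym ii leqNgt.
apply: ratB; first exact: rf.
apply: rat_sum => i _; apply: ratM; first exact: rp.
by apply: IH; have := ltn_ord i; lia.
Qed.

Section TargetOpen.
Variables (k : fieldType) (K : closedFieldType) (iota : {rmorphism k -> K}).
Hypothesis charK : [pchar K] =i pred0.
Variables (m : nat) (gh : 'I_m -> 'rV[K]_4 -> K).
Hypothesis kgh : forall j, kalg iota (fun i (u : 'rV[K]_4) => u 0 i) (gh j).
Local Notation crd := (pair_coord (@mx_coord K) (m := m)).

(** Expresses an invariant condition on the ordered roots through the coefficients, as the openness
    of the linkage domain requires. The norm of the defining product D is symmetric, and its sum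
    over S_m is m! times itself. *)
Lemma tgt_good_theta : exists2 Th, kalg iota crd Th &
  forall w t, tgt_good gh w t = (Th (w, sym_coefs t) != 0).
Proof.
pose D (z : 'M[K]_4 * 'rV[K]_m) := (\prod_i dprod z.2 i) *
  ((\prod_i curve_pts z.1 z.2 i 0) * \det (gmx gh (curve_pts z.1 z.2))).
have kD : kalg iota crd D.
  apply: kalgM; first by apply: kalg_prod => i _; apply: kalg_dprod.
  apply: kalgM; first by apply: kalg_prod => i _; apply: kalg_curve_pts.
  by apply: kalg_det => i j; apply: (kalg_gmx kgh) => i' l; apply: kalg_curve_pts.
have DE w t : tgt_good gh w t = (D (w, t) != 0).
  apply/idP/idP => [/tgt_goodP[t_inj w0 dv]|].
    rewrite /D !mulf_neq0 //; apply/prodf_neq0 => i _; last exact: w0.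
    exact: dprod_neq0.
  rewrite /D !mulf_eq0 !negb_or => /and3P[/prodf_neq0 dt /prodf_neq0 w0 dv].
  apply/tgt_goodP; split=> // [i j tij|i]; last exact: w0.
  apply/eqP; apply: contraT => ij; have /prodf_neq0/(_ j) := dt i isT.
  by rewrite eq_sym tij subrr eqxx => /(_ ij).
pose N (z : 'M[K]_4 * 'rV[K]_m) := \prod_(s : 'S_m) D (z.1, perm_row s z.2).
have kN : kalg iota crd N.
  apply: kalg_prod => s _; apply: kalg_comp kD => -[i|i].
    exact: (kalgX _ crd (inl i)).
  apply: kalg_ext (kalgX _ crd (inr (s i))) => z /=.
  by rewrite mxE.
have NE w t : tgt_good gh w t = (N (w, t) != 0).
  apply/idP/prodf_neq0 => [G s _|/(_ 1%g isT)]; rewrite -DE; first exact: tgt_good_perm.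
  by rewrite (_ : perm_row 1 _ = t) //; apply/rowP => i; rewrite mxE perm1.
have [Th kTh ThE] := kalg_symmetrize kN; exists Th => // w t.
rewrite -ThE NE (eq_bigr (fun=> N (w, t))) => [|s _].
  rewrite sumr_const card_Sn -[X in _ = (X != 0)]mulr_natr mulf_eq0 negb_or.
  by rewrite (natrK_eq0 charK) -lt0n fact_gt0 andbT.
rewrite /N [RHS](reindex_inj (mulIg s)) /=; apply: eq_bigr => s' _; congr (D (_, _)).
by apply/rowP => i; rewrite !mxE permM.
Qed.
End TargetOpen.

(** * The residual factor *)

Section Link.
Variables (k : fieldType) (K : closedFieldType) (iota : {rmorphism k -> K}).
Hypothesis charK : [pchar K] =i pred0.
Variables (F : {mpoly k[4]}) (F_cubic : F \is 3.-homog) (A : 'M[k]_4).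

Definition framed_cubic (w : 'M[K]_4) : {poly K} :=
  curve_cubic iota F (w *m map_mx iota A).
Local Notation fc := framed_cubic.

Lemma framed_cubicE w t :
  (fc w).[t] = frame_eval iota F A (\row_l (curve w l).[t]).
Proof.
rewrite /fc curve_cubicE /frame_eval; congr evalv; apply/rowP => l.
rewrite !mxE curveE; under eq_bigr do rewrite mxE mulr_suml.
rewrite exchange_big /=; apply: eq_bigr => i _.
rewrite mxE curveE mulr_suml; apply: eq_bigr => j _.
by rewrite mulrAC.
Qed.

Lemma size_framed_cubic w : (size (fc w) <= 10)%N.
Proof.
have [] := top_coef_mmap idfun (curve_size (w *m map_mx iota A))
  (map_mpoly_homog iota F_cubic).
by [].
Qed.

Lemma ratp_framed_cubic m S :
  ratp iota (pair_coord (@mx_coord K) (m := m)) S (fun z => fc z.1).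
Proof.
have E z : fc z = mmap (polyC \o iota) (curve (z *m map_mx iota A)) F.
  exact: mmap_map_mpoly.
move=> j; apply: (@rat_ext _ _ _ _ _ _ _ (fun z : 'M[K]_4 * 'rV[K]_m =>
    (mmap (polyC \o iota) (curve (z.1 *m map_mx iota A)) F)`_j)).
  by move=> z _; rewrite E.
move: j; apply: (@ratp_mpoly _ _ _ _ _ _ _ _ _
  (fun l (z : 'M[K]_4 * 'rV[K]_m) => curve (z.1 *m map_mx iota A) l)) => l.
apply: ratp_sum => i _; apply: ratpM; last exact/ratp_exp/ratpX.
apply: ratpC; apply: (@rat_ext _ _ _ _ _ _ _ (fun z : 'M[K]_4 * 'rV[K]_m =>
    \sum_j z.1 i j * iota (A j l))).
  by move=> z _; rewrite mxE; apply: eq_bigr => j _; congr (_ * _); rewrite mxE.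
apply: rat_sum => j _; apply: ratM; last exact: ratC.
exact/rat_kalg/kalg_mx_coord.
Qed.

Lemma roots_of_coefs m (q : {poly K}) : size q = m.+1 -> q`_m = 1 ->
  roots_poly (roots_of (\row_(j < m) q`_j)) = q.
Proof.
move=> sq qm; apply/polyP => j; case: (ltngtP j m) => [jm|mj|->].
- have := congr1 (fun u : 'rV[K]_m => u 0 (Ordinal jm)) (roots_ofK (\row_(j < m) q`_j)).
  by rewrite !mxE.
- by rewrite !nth_default ?size_roots_poly ?sq.
- by rewrite roots_poly_coef.
Qed.

Lemma ratp_roots_of m S :
  ratp iota (pair_coord (@mx_coord K) (m := m)) S (fun z => roots_poly (roots_of z.2)).
Proof.
move=> j; case: (ltngtP j m) => [jm|mj|->].
- apply: (@rat_ext _ _ _ _ _ _ _ (fun z : 'M[K]_4 * 'rV[K]_m => z.2 0 (Ordinal jm))).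
    by move=> z _; rewrite -{1}(roots_ofK z.2) mxE.
  exact/rat_kalg/kalg_root_coord.
- by apply: rat_ext (rat0 _ _ _) => z _; rewrite nth_default ?size_roots_poly.
- by apply: rat_ext (rat1 _ _ _) => z _; rewrite roots_poly_coef.
Qed.

Section Cofactor.
Variables (m m' : nat) (mm' : (m + m' = 9)%N).
Variables (gh : 'I_m -> 'rV[K]_4 -> K) (gh' : 'I_m' -> 'rV[K]_4 -> K).
Hypothesis kgh' : forall j, kalg iota (fun i (u : 'rV[K]_4) => u 0 i) (gh' j).
Local Notation crd := (pair_coord (@mx_coord K) (m := m)).

(** Division by the coefficient of T^9 makes the quotient monic. If that coefficient vanishes, the
    form of degree 9 has a zero at infinity and the quotient drops in degree. *)
Definition cofactor_poly (z : 'M[K]_4 * 'rV[K]_m) : {poly K} :=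
  ((fc z.1)`_9)^-1 *: (fc z.1 %/ roots_poly (roots_of z.2)).
Definition cofactor (z : 'M[K]_4 * 'rV[K]_m) : 'rV[K]_m' :=
  \row_j (cofactor_poly z)`_j.

Lemma cofactor_polyE z : tgt_coef_pred iota F A gh z -> (fc z.1)`_9 != 0 ->
  [/\ fc z.1 = (fc z.1)`_9 *: (cofactor_poly z * roots_poly (roots_of z.2)),
      size (cofactor_poly z) = m'.+1 & (cofactor_poly z)`_m' = 1].
Proof.
case: z => w p; rewrite /tgt_coef_pred /cofactor_poly /=; move: (roots_of p) => t G e0.
have /andP[/tgt_goodP[t_inj _ _] /forallP Ft] := G.
have dv : roots_poly t %| fc w.
  rewrite roots_poly_seq; apply: uniq_roots_dvdp.
    rewrite all_map; apply/allP => i _ /=; rewrite rootE framed_cubicE.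
    rewrite (_ : \row__ _ = row i (curve_pts w t)); first exact: Ft.
    by apply/rowP => l; rewrite !mxE.
  by rewrite uniq_rootsE (map_inj_uniq t_inj) enum_uniq.
have fE := divpK dv; set q := fc w %/ _ in fE *.
have f0 : fc w != 0 by apply: contraNneq e0 => ->; rewrite coef0.
have sf : size (fc w) = 10.
  apply/eqP; rewrite eqn_leq size_framed_cubic ltnNge; apply: contra e0 => s9.
  by rewrite nth_default.
have q0 : q != 0 by apply: contraNneq f0 => q0; rewrite -fE q0 mul0r.
have P0 : roots_poly t != 0 by rewrite -size_poly_eq0 size_roots_poly.
have sq : size q = m'.+1.
  have := size_mul q0 P0; rewrite fE sf size_roots_poly addnS /=; move: (size q) mm' => s; lia.
have lq : q`_m' = (fc w)`_9.
  have : lead_coef (fc w) = lead_coef q * lead_coef (roots_poly t).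
    by rewrite -fE lead_coefM.
  by rewrite !lead_coefE sf sq size_roots_poly roots_poly_coef mulr1.
rewrite -/q; split.
- by rewrite -scalerAl scalerA divff // scale1r fE.
- by rewrite size_scale ?invr_eq0.
- by rewrite coefZ lq mulVf.
Qed.

Lemma cofactor_roots z : tgt_coef_pred iota F A gh z -> (fc z.1)`_9 != 0 ->
  roots_poly (roots_of (cofactor z)) = cofactor_poly z.
Proof. by move=> Z /(cofactor_polyE Z)[_ sq lq]; apply: roots_of_coefs. Qed.

(** The residual roots are roots of the restricted cubic, so their points lie on the surface
    automatically and only the open condition remains. *)
Lemma cofactor_pred z : tgt_coef_pred iota F A gh z -> (fc z.1)`_9 != 0 ->
  tgt_coef_pred iota F A gh' (z.1, cofactor z) = tgt_good gh' z.1 (roots_of (cofactor z)).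
Proof.
move=> Z e0; rewrite /tgt_coef_pred /tgt_pred /=.
suff -> : [forall i, frame_eval iota F A (row i (curve_pts z.1 (roots_of (cofactor z)))) == 0].
  by rewrite andbT.
apply/forallP => i.
rewrite (_ : row i _ = \row_l (curve z.1 l).[roots_of (cofactor z) 0 i]).
  have [fE _ _] := cofactor_polyE Z e0; rewrite -framed_cubicE fE.
  by rewrite -(cofactor_roots Z e0) hornerZ hornerM roots_poly_lag mul0r mulr0.
by apply/rowP => l; rewrite !mxE.
Qed.

Lemma rat_cofactor j :
  rat iota crd (fun z => tgt_coef_pred iota F A gh z /\ (fc z.1)`_9 != 0)
    (fun z => cofactor z 0 j).
Proof.
have re : rat iota crd (fun z => tgt_coef_pred iota F A gh z /\ (fc z.1)`_9 != 0)
    (fun z => ((fc z.1)`_9)^-1).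
  by apply: ratV => [z []//|]; apply: ratp_framed_cubic.
have rq : ratp iota crd (fun z => tgt_coef_pred iota F A gh z /\ (fc z.1)`_9 != 0)
    cofactor_poly.
  apply: (ratp_quotient (f := fun z => ((fc z.1)`_9)^-1 *: fc z.1)
    (p := fun z => roots_poly (roots_of z.2)) (m := m) (d := m'.+1)).
  - move=> i; apply: rat_ext (ratM re (ratp_framed_cubic _ i)) => z _.
    by rewrite coefZ.
  - exact: ratp_roots_of.
  move=> z [Z e0]; have [fE sq _] := cofactor_polyE Z e0; split.
  - by rewrite {2}fE scalerA mulVf // scale1r.
  - by rewrite size_roots_poly.
  - exact: roots_poly_coef.
  - by rewrite sq.
by apply: rat_ext (rq j) => z _; rewrite mxE.
Qed.

Definition link_dom (z : tgt iota F A gh) : Prop :=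
  (fc (val z).1)`_9 != 0 /\
  tgt_coef_pred iota F A gh' ((val z).1, cofactor (val z)).

Let lead_open : opens (tgt iota F A gh) (fun z => (fc (val z).1)`_9 != 0).
Proof.
have kT := tgt_kaxioms iota F A gh.
have r9 := rat_regular (U := fun=> True) (Z := tgt_coef_pred iota F A gh)
  (S := fun=> True) (fun _ _ => Logic.I) (ratp_framed_cubic (m := m) _ 9).
by apply: opens_ext (opens_neq0 kT (opensT kT) r9) => z; split=> [[]|].
Qed.

Lemma opens_link_dom : opens (tgt iota F A gh) link_dom.
Proof.
have kT := tgt_kaxioms iota F A gh.
have [Th kTh ThE] := tgt_good_theta charK kgh'.
have rTh : rat iota crd (fun z => tgt_coef_pred iota F A gh z /\ (fc z.1)`_9 != 0)
    (fun z => Th (z.1, cofactor z)).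
  apply: rat_comp kTh => -[[j l]|j]; first exact/rat_kalg/kalg_mx_coord.
  exact: rat_cofactor.
have regTh := rat_regular (U := fun z : tgt iota F A gh => (fc (val z).1)`_9 != 0)
  (fun z e0 => conj (valP z) e0) rTh.
apply: opens_ext (opens_neq0 kT lead_open regTh) => z; rewrite /link_dom.
split=> -[e0 H]; split=> //; move: H;
  by rewrite (cofactor_pred (valP z) e0) ThE roots_ofK.
Qed.

Variable tgt_def' : tgt iota F A gh'.

Definition link_map (z : tgt iota F A gh) : tgt iota F A gh' :=
  insubd tgt_def' ((val z).1, cofactor (val z)).

Lemma val_link_map z : link_dom z ->
  val (link_map z) = ((val z).1, cofactor (val z)).
Proof. by move=> [_ H]; rewrite /link_map val_insubd H. Qed.

Lemma link_map_morphism : morphism_on link_dom link_map.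
Proof.
have kT := tgt_kaxioms iota F A gh.
apply: (morphism_on_aff kT opens_link_dom) => -[[j l]|j].
  apply: (regularE kT (f := fun z => (val z).1 j l)).
    by move=> z Oz; rewrite val_link_map.
  apply: aff_regular.
  exact: (kalg_sub (tgt_coef_pred iota F A gh) (kalg_mx_coord iota m j l)).
apply: (regularE kT (f := fun z => cofactor (val z) 0 j)).
  by move=> z Oz; rewrite val_link_map.
by apply: (rat_regular _ (rat_cofactor j)) => z [e0 _]; split=> //; apply: valP.
Qed.
End Cofactor.

(** In the factorisation of the degree 9 polynomial as a constant times q p, each of the monic
    factors q and p determines the other by cancellation. *)
Lemma link_mapK m m' (mm' : (m + m' = 9)%N) (m'm : (m' + m = 9)%N)
    (gh : 'I_m -> 'rV[K]_4 -> K) (gh' : 'I_m' -> 'rV[K]_4 -> K)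
    (d : tgt iota F A gh) (d' : tgt iota F A gh') z :
  link_dom gh' z -> link_dom gh (link_map d' z) /\ link_map d (link_map d' z) = z.
Proof.
move=> Oz; have [e0 Z'] := Oz; have zE := val_link_map d' Oz.
have Z := valP z; have [fE _ _] := cofactor_polyE mm' Z e0.
have [fE' _ _] := cofactor_polyE m'm Z' e0.
have cE : cofactor m ((val z).1, cofactor m' (val z)) = (val z).2.
  apply/rowP => j; rewrite -[in RHS](roots_ofK (val z).2) !mxE.
  suff -> : cofactor_poly ((val z).1, cofactor m' (val z)) =
    roots_poly (roots_of (val z).2) by [].
  have c0 : cofactor_poly (val z) != 0.
    apply: contraNneq e0 => c0; move: fE; rewrite c0 mul0r scaler0 => ->.
    by rewrite coef0.
  apply: (mulfI c0); apply: (scalerI e0); rewrite -fE.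
  rewrite [in RHS]fE' /= (cofactor_roots mm' Z e0) [X in _ *: X]mulrC.
  by [].
have O' : link_dom gh (link_map d' z).
  by rewrite /link_dom zE /= cE -surjective_pairing; split=> //; apply: valP.
split=> //; apply: val_inj; rewrite val_link_map // zE /= cE.
by rewrite -surjective_pairing.
Qed.
End Link.

(** * Six and three points *)

(** An isomorphism of Z with the open subset U of Y. The map g is a morphism on all of Z because the
    models already include the nondegeneracy conditions. *)
Definition open_retract (K : fieldType) (Y Z : kspace K) : Prop :=
  exists (U : Y -> Prop) (f : Y -> Z) (g : Z -> Y),
    [/\ opens Y U, morphism_on U f, morphism_on (fun=> True) g,
        forall y, U y -> g (f y) = y & forall z, U (g z) /\ f (g z) = z].

Section Quadrics.
Variables (k : fieldType) (K : closedFieldType) (iota : {rmorphism k -> K}).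
Implicit Types (v : 'rV[K]_4) (t : 'rV[K]_3).

Definition quadric3 (j : 'I_3) v : K := v 0 0 * v 0 (lshift 1 j).
(** The last two quadrics are x_1 x_3 and x_2 x_3. On (1, t, t^2, t^3) the six take the values 1, t,
    ..., t^5; see [quadric6_powers]. *)
Definition quadric6 (j : 'I_(4 + 2)) v : K :=
  match split j with
  | inl i => v 0 0 * v 0 i
  | inr i => v 0 (rshift 1 (lshift 1 i)) * v 0 ord_max
  end.

Let crd (i : 'I_4) v := v 0 i.

Lemma quadric3Z j c v : quadric3 j (c *: v) = c ^+ 2 * quadric3 j v.
Proof. by rewrite /quadric3 !mxE; ring. Qed.

Lemma quadric6Z j c v : quadric6 j (c *: v) = c ^+ 2 * quadric6 j v.
Proof. by rewrite /quadric6; case: split => i; rewrite !mxE; ring. Qed.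

Lemma kalg_quadric3 j : kalg iota crd (quadric3 j).
Proof. exact: kalgM (kalgX iota crd _) (kalgX iota crd _). Qed.

Lemma kalg_quadric6 j : kalg iota crd (quadric6 j).
Proof.
by rewrite /quadric6; case: split => i; apply: kalgM (kalgX iota crd _) (kalgX iota crd _).
Qed.

Lemma quadric6_lshift l v : quadric6 (lshift 2 l) v = v 0 0 * v 0 l.
Proof. by rewrite /quadric6 (unsplitK (inl l)). Qed.

Lemma size_le_coef0 d e (p : {poly K}) : (size p <= d)%N ->
  (forall j, (e <= j < d)%N -> p`_j = 0) -> (size p <= e)%N.
Proof.
move=> sp H; apply/leq_sizeP => j ej; case: (ltnP j d) => jd; first by rewrite H ?ej.
by rewrite nth_default // (leq_trans sp).
Qed.

Lemma size_poly_curve3 (p : {poly K}) (c : K) t : (size p <= 4)%N ->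
  p`_3 = c -> (size (p - c%:P * roots_poly t)%R <= 3)%N.
Proof.
move=> sp pc; apply: (@size_le_coef0 4).
  rewrite (leq_trans (size_polyD _ _)) // geq_max sp size_polyN mul_polyC.
  by rewrite (leq_trans (size_scale_leq _ _)) // size_roots_poly.
move=> j /andP[j3 j4]; have -> : j = 3 by lia.
by rewrite coefB coefCM roots_poly_coef mulr1 pc subrr.
Qed.

(* The first four quadrics are x_0 x_l, so on vectors with x_0 = 1 a relation
   between their values is a linear relation between the vectors. *)
Lemma gmx6_lshift (a : 'rV[K]_(4 + 2)) (v : 'M[K]_(4 + 2, 4)) l :
  (a *m gmx quadric6 v) 0 (lshift 2 l) = \sum_i a 0 i * (v i 0 * v i l).
Proof.
rewrite mxE; apply: eq_bigr => i _; congr (_ * _).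
by rewrite mxE quadric6_lshift !mxE.
Qed.
(** Interpolation at six nodes has degree at most 5, so only the coefficients of degrees 4 and 5
    have to vanish. *)
Lemma lagsum6_small (s : 'I_(4 + 2) -> K) (t : 'rV[K]_(4 + 2)) :
  \sum_i s i = 0 -> \sum_i s i * t 0 i = 0 -> (size (lagsum s t) <= 4)%N.
Proof.
move=> s0 s1; apply: size_le_coef0 (size_lagsum s t) _ => j /andP[j4 j6].
have [->|->] : j = 4 \/ j = 5 by lia.
  by rewrite (lagsum_coef2 s t) // s1 s0 mul0r subr0.
by rewrite (lagsum_coef1 s t).
Qed.

(** Converse of [lagsum6_small]: the sums are read off from the vanishing coefficients of degrees 5
    and 4. *)
Lemma lagrange6_sum (p : {poly K}) (t : 'rV[K]_(4 + 2)) : injective (t 0) ->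
  (size p <= 4)%N -> \sum_i p.[t 0 i] / dprod t i = 0 /\
  \sum_i p.[t 0 i] / dprod t i * t 0 i = 0.
Proof.
move=> t_inj sp; have pE := lagrange t_inj (leq_trans sp (isT : 4 <= 4 + 2)%N).
have s0 : \sum_i p.[t 0 i] / dprod t i = 0.
  rewrite -(lagsum_coef1 (fun i => p.[t 0 i] / dprod t i) t) -pE nth_default //.
  exact: leq_trans sp _.
split=> //; have := lagsum_coef2 (fun i => p.[t 0 i] / dprod t i) t isT.
by rewrite -pE s0 mul0r subr0 => <-; rewrite nth_default.
Qed.
End Quadrics.

Section Instances.
Variables (k : fieldType) (K : closedFieldType) (iota : {rmorphism k -> K}).
Hypothesis charK : [pchar K] =i pred0.
Variables (F : {mpoly k[4]}) (F_cubic : F \is 3.-homog).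
Variables (A : 'M[k]_4) (A_unit : A \in unitmx).
Local Notation X := (hypersurface iota F).
Variable x_def : X.

Lemma kalg_row_mx T n m m' (c : 'I_n -> T -> K) (f : T -> 'rV[K]_m) (g : T -> 'rV[K]_m') :
  (forall j, kalg iota c (fun x => f x 0 j)) ->
  (forall j, kalg iota c (fun x => g x 0 j)) ->
  forall j, kalg iota c (fun x => row_mx (f x) (g x) 0 j).
Proof.
move=> kf kg j; rewrite -[j]splitK; case: (split j) => i /=.
  by apply: kalg_ext (kf i) => x; rewrite row_mxEl.
by apply: kalg_ext (kg i) => x; rewrite row_mxEr.
Qed.

Lemma kalg_zero_row T n m (c : 'I_n -> T -> K) j :
  kalg iota c (fun x => (0 : 'rV[K]_m) 0 j).
Proof. by apply: kalg_ext (kalg0 _ _) => x; rewrite mxE. Qed.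

Lemma kalg_lsubmx n m j : kalg iota (fun i (u : 'rV[K]_(n + m)) => u 0 i)
  (fun u => lsubmx u 0 j).
Proof.
by apply: kalg_ext (kalgX iota (fun i (u : 'rV[K]_(n + m)) => u 0 i) (lshift m j)) => u;
  rewrite mxE.
Qed.

Lemma kalg_rsubmx n m j : kalg iota (fun i (u : 'rV[K]_(n + m)) => u 0 i)
  (fun u => rsubmx u 0 j).
Proof.
by apply: kalg_ext (kalgX iota (fun i (u : 'rV[K]_(n + m)) => u 0 i) (rshift n j)) => u;
  rewrite mxE.
Qed.

Lemma sym3_model (d : tgt iota F A (@quadric3 K)) :
  open_retract (prod_space (sym_product X 3) (proj_space iota (3 + (3 + 4))))
    (tgt iota F A (@quadric3 K)).
Proof.
pose Ey (u : 'rV[K]_(3 + (3 + 4))) := lsubmx u.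
pose Ez (u : 'rV[K]_(3 + (3 + 4))) := lsubmx (rsubmx u).
pose Ec (u : 'rV[K]_(3 + (3 + 4))) := rsubmx (rsubmx u).
pose Rp (y z : 'rV[K]_3) (c : 'rV[K]_4) := row_mx y (row_mx z c).
(* Interpolation at three nodes has degree at most 2, so c is the coefficient of T^3, the last row
   of w. *)
pose Cw (w : 'M[K]_4) := row ord_max w.
have kEy j : kalg iota (fun i (u : 'rV[K]_(3 + (3 + 4))) => u 0 i) (fun u => Ey u 0 j) by apply: kalg_lsubmx.
have kEz j : kalg iota (fun i (u : 'rV[K]_(3 + (3 + 4))) => u 0 i) (fun u => Ez u 0 j).
  by apply: kalg_ext (kalg_rsubmx _ (lshift 4 j)) => u; rewrite [RHS]mxE.
have kEc j : kalg iota (fun i (u : 'rV[K]_(3 + (3 + 4))) => u 0 i) (fun u => Ec u 0 j).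
  by apply: kalg_ext (kalg_rsubmx _ (rshift 3 j)) => u; rewrite [RHS]mxE.
have kCw j : kalg iota (fun i (w : 'M[K]_4) => w i.1 i.2) (fun w => Cw w 0 j).
  apply: kalg_ext (kalgX iota (fun i (w : 'M[K]_4) => w i.1 i.2) (ord_max, j)) => w.
  by rewrite mxE.
have kRp i : [\/ exists j, forall y z c, Rp y z c 0 i = y 0 j,
      exists j, forall y z c, Rp y z c 0 i = z 0 j
    | exists j, forall y z c, Rp y z c 0 i = c 0 j].
  rewrite /Rp -[i]splitK; case: (split i) => {}i /=.
    by constructor 1; exists i => y z c; rewrite row_mxEl.
  rewrite -[i]splitK; case: (split i) => {}i /=.
    by constructor 2; exists i => y z c; rewrite row_mxEr row_mxEl.
  by constructor 3; exists i => y z c; rewrite !row_mxEr.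
have E_R u : Rp (Ey u) (Ez u) (Ec u) = u by rewrite /Rp !hsubmxK.
have src_size v u l : src_good (@quadric3 K) Ey Ez v u -> (forall i, v i 0 = 1) ->
    (size (src_poly (@quadric3 K) Ey Ez Ec v u l) <= 4)%N.
  move=> _ _; rewrite (leq_trans (size_polyD _ _)) // geq_max.
  rewrite (leq_trans (size_lagsum _ _)) // mul_polyC.
  by rewrite (leq_trans (size_scale_leq _ _)) // size_roots_poly.
have src_C v u : src_good (@quadric3 K) Ey Ez v u -> (forall i, v i 0 = 1) ->
    Cw (src_w (@quadric3 K) Ey Ez Ec v u) = Ec u.
  move=> _ _; apply/rowP => l; rewrite mxE mxE coefD coefCM roots_poly_coef mulr1.
  by rewrite nth_default ?add0r // size_lagsum.
have tgt_size w t l : tgt_good (@quadric3 K) w t ->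
    (size (curve w l - (Cw w 0 l)%:P * roots_poly t)%R <= 3)%N.
  move=> _; apply: size_poly_curve3; first exact: curve_size.
  by rewrite mxE (curve_coef w l ord_max).
have R_E w t : tgt_good (@quadric3 K) w t ->
  [/\ Ey (tgt_u (@quadric3 K) Rp Cw w t) = tgt_a w t *m gmx (@quadric3 K) (tgt_v w t),
      Ez (tgt_u (@quadric3 K) Rp Cw w t) =
        (\row_i (tgt_a w t 0 i * t 0 i)) *m gmx (@quadric3 K) (tgt_v w t)
    & Ec (tgt_u (@quadric3 K) Rp Cw w t) = Cw w].
  by move=> _; rewrite /Ey /Ez /Ec /tgt_u /Rp !row_mxKr !row_mxKl.
have kg := @kalg_quadric3 k K iota.
exists (src_dom A (@quadric3 K) Ey Ez), (src_map Ey Ez Ec d), (tgt_map Rp Cw x_def).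
split.
- exact: (opens_src_dom charK (isT : 0 < 3)%N kg kEy kEz).
- exact: (src_map_morphism charK F_cubic A_unit (isT : 0 < 3)%N (@quadric3Z K) kg
    kEy kEz kEc src_size d).
- exact: (tgt_map_morphism F_cubic A_unit kg kCw kRp x_def).
- exact: (src_mapK F_cubic A_unit (@quadric3Z K) E_R src_size src_C x_def d).
- exact: (tgt_mapK F_cubic A_unit (@quadric3Z K) src_size tgt_size R_E x_def d).
Qed.

Lemma sym6_model (d : tgt iota F A (@quadric6 K)) :
  open_retract (prod_space (sym_product X (4 + 2)) (proj_space iota (2 + 2)))
    (tgt iota F A (@quadric6 K)).
Proof.
pose Ey (u : 'rV[K]_(2 + 2)) : 'rV[K]_(4 + 2) := row_mx 0 (lsubmx u).
pose Ez (u : 'rV[K]_(2 + 2)) : 'rV[K]_(4 + 2) := row_mx 0 (rsubmx u).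
(* Here c = 0: a nonzero multiple of the degree 6 polynomial with roots t_j would destroy cubicity,
   as the interpolating part has degree at most 5. *)
pose Ec (u : 'rV[K]_(2 + 2)) : 'rV[K]_4 := 0.
pose Rp (y z : 'rV[K]_(4 + 2)) (c : 'rV[K]_4) := row_mx (rsubmx y) (rsubmx z).
pose Cw (w : 'M[K]_4) : 'rV[K]_4 := 0.
have kEy j : kalg iota (fun i (u : 'rV[K]_(2 + 2)) => u 0 i) (fun u => Ey u 0 j).
  by apply: kalg_row_mx j => j; [exact: kalg_zero_row|exact: kalg_lsubmx].
have kEz j : kalg iota (fun i (u : 'rV[K]_(2 + 2)) => u 0 i) (fun u => Ez u 0 j).
  by apply: kalg_row_mx j => j; [exact: kalg_zero_row|exact: kalg_rsubmx].
have kEc j : kalg iota (fun i (u : 'rV[K]_(2 + 2)) => u 0 i) (fun u => Ec u 0 j).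
  exact: kalg_zero_row.
have kCw j : kalg iota (fun i (w : 'M[K]_4) => w i.1 i.2) (fun w => Cw w 0 j).
  by apply: kalg_ext (kalg0 _ _) => w; rewrite mxE.
have kRp i : [\/ exists j, forall y z c, Rp y z c 0 i = y 0 j,
      exists j, forall y z c, Rp y z c 0 i = z 0 j
    | exists j, forall y z c, Rp y z c 0 i = c 0 j].
  rewrite /Rp -[i]splitK; case: (split i) => {}i /=.
    by constructor 1; exists (rshift 4 i) => y z c; rewrite row_mxEl mxE.
  by constructor 2; exists (rshift 4 i) => y z c; rewrite row_mxEr mxE.
have E_R u : Rp (Ey u) (Ez u) (Ec u) = u by rewrite /Rp !row_mxKr hsubmxK.
have src_size v u l : src_good (@quadric6 K) Ey Ez v u -> (forall i, v i 0 = 1) ->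
    (size (src_poly (@quadric6 K) Ey Ez Ec v u l) <= 4)%N.
  move=> /src_goodP[dv a0 _] v0; rewrite /src_poly mxE polyC0 mul0r addr0.
  have U : gmx (@quadric6 K) v \in unitmx by rewrite unitmxE unitfE.
  have rel (y : 'rV[K]_(4 + 2)) : y 0 (lshift 2 l) = 0 ->
      \sum_i (y *m invmx (gmx (@quadric6 K) v)) 0 i * v i l = 0.
    move=> y0; rewrite -[RHS]y0 -[in RHS](mulmxKV U y) gmx6_lshift.
    by apply: eq_bigr => i _; rewrite v0 mul1r.
  apply: lagsum6_small; first by apply: rel; rewrite row_mxEl mxE.
  rewrite -[RHS](rel (Ez u)); last by rewrite row_mxEl mxE.
  apply: eq_bigr => i _; rewrite mulrAC; congr (_ * _).
  by rewrite [X in _ * X = _]mxE mulrCA mulfV ?mulr1.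
have src_C v u : src_good (@quadric6 K) Ey Ez v u -> (forall i, v i 0 = 1) ->
    Cw (src_w (@quadric6 K) Ey Ez Ec v u) = Ec u by [].
have tgt_size w t l : tgt_good (@quadric6 K) w t ->
    (size (curve w l - (Cw w 0 l)%:P * roots_poly t)%R <= 4 + 2)%N.
  move=> _; rewrite mxE polyC0 mul0r subr0.
  exact: leq_trans (curve_size w l) _.
have R_E w t : tgt_good (@quadric6 K) w t ->
  [/\ Ey (tgt_u (@quadric6 K) Rp Cw w t) = tgt_a w t *m gmx (@quadric6 K) (tgt_v w t),
      Ez (tgt_u (@quadric6 K) Rp Cw w t) =
        (\row_i (tgt_a w t 0 i * t 0 i)) *m gmx (@quadric6 K) (tgt_v w t)
    & Ec (tgt_u (@quadric6 K) Rp Cw w t) = Cw w].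
  move=> /tgt_goodP[t_inj w0 _].
  have v0 i : tgt_v w t i 0 = 1 by rewrite mxE divff.
  have vE i l : tgt_a w t 0 i * (tgt_v w t i 0 * tgt_v w t i l) =
      (curve w l).[t 0 i] / dprod t i.
    rewrite v0 mul1r; have := w0 i; rewrite !mxE => w0i; field.
    by rewrite w0i dprod_neq0.
  have rel l := lagrange6_sum t_inj (curve_size w l).
  split=> //; rewrite /tgt_u /Rp /Ey /Ez ?row_mxKl ?row_mxKr -[RHS]hsubmxK;
    congr row_mx; apply/rowP => l; rewrite [LHS]mxE [RHS]mxE gmx6_lshift.
    by rewrite -[LHS](rel l).1; apply: eq_bigr => i _; rewrite vE.
  rewrite -[LHS](rel l).2; apply: eq_bigr => i _.
  by rewrite [X in _ = X * _]mxE [RHS]mulrAC vE.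
have kg := @kalg_quadric6 k K iota.
exists (src_dom A (@quadric6 K) Ey Ez), (src_map Ey Ez Ec d), (tgt_map Rp Cw x_def).
split.
- exact: (opens_src_dom charK (isT : 0 < 4 + 2)%N kg kEy kEz).
- exact: (src_map_morphism charK F_cubic A_unit (isT : 0 < 4 + 2)%N (@quadric6Z K) kg
    kEy kEz kEc src_size d).
- exact: (tgt_map_morphism F_cubic A_unit kg kCw kRp x_def).
- exact: (src_mapK F_cubic A_unit (@quadric6Z K) E_R src_size src_C x_def d).
- exact: (tgt_mapK F_cubic A_unit (@quadric6Z K) src_size tgt_size R_E x_def d).
Qed.
End Instances.

(** * A curve split into six and three points *)

Section LinkedPoint.
Variables (k : fieldType) (K : closedFieldType) (iota : {rmorphism k -> K}).
Variables (F : {mpoly k[4]}) (F_cubic : F \is 3.-homog).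
Variables (A : 'M[k]_4) (A_unit : A \in unitmx).
Hypothesis F_size : size (curve_cubic iota F (map_mx iota A)) = 10.
Hypothesis F_sep : separable_poly (curve_cubic iota F (map_mx iota A)).
Local Notation X := (hypersurface iota F).
Local Notation fc1 := (framed_cubic iota F A 1%:M).

Lemma framed_cubic1 : fc1 = curve_cubic iota F (map_mx iota A).
Proof. by rewrite /framed_cubic mul1mx. Qed.

Lemma curve1 l (x : K) : (curve 1%:M l).[x] = x ^+ l.
Proof.
rewrite curveE (bigD1 l) //= mxE eqxx mul1r big1 ?addr0 // => j /negPf jl.
by rewrite mxE jl mul0r.
Qed.

(** For w = 1 the curve is (1, t, t^2, t^3), and the values of the quadrics at its points form a
    Vandermonde matrix. *)
Lemma tgt_good1 m (gh : 'I_m -> 'rV[K]_4 -> K) (t : 'rV[K]_m) :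
  (forall j x, gh j (\row_l x ^+ l) = x ^+ j) -> injective (t 0) ->
  tgt_good gh 1%:M t.
Proof.
move=> ghE t_inj; apply/tgt_goodP; split=> // [i|].
  by rewrite mxE curve1 expr0 oner_neq0.
have -> : gmx gh (curve_pts 1%:M t) = (Vandermonde m t)^T.
  apply/matrixP => i j; rewrite !mxE -ghE; congr (gh j _).
  by apply/rowP => l; rewrite !mxE curve1.
rewrite det_tr det_Vandermonde; apply/prodf_neq0 => i _; apply/prodf_neq0 => j ij.
by rewrite subr_eq0; apply: contraTneq ij => /t_inj->; rewrite ltnn.
Qed.

Lemma tgt_pred1 m (gh : 'I_m -> 'rV[K]_4 -> K) (t : 'rV[K]_m) :
  (forall j x, gh j (\row_l x ^+ l) = x ^+ j) -> injective (t 0) ->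
  (forall i, root fc1 (t 0 i)) -> tgt_pred iota F A gh (1%:M, t).
Proof.
move=> ghE t_inj tr; apply/andP; split; first exact: tgt_good1.
apply/forallP => i; have := tr i; rewrite rootE framed_cubicE.
by congr (frame_eval _ _ _ _ == 0); apply/rowP => l; rewrite !mxE.
Qed.

Lemma quadric3_powers j (x : K) : quadric3 j (\row_l x ^+ l) = x ^+ j.
Proof. by rewrite /quadric3 !mxE mul1r. Qed.

Lemma quadric6_powers j (x : K) : quadric6 j (\row_l x ^+ l) = x ^+ j.
Proof.
rewrite -{2}[j]splitK /quadric6; case: (split j) => i /=; rewrite !mxE.
  by rewrite mul1r.
by rewrite -exprD /=; congr (_ ^+ _); lia.
Qed.

Lemma exists_linked_points : exists (t6 : 'rV[K]_(4 + 2)) (t3 : 'rV[K]_3),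
  [/\ injective (t6 0), injective (t3 0)
    & fc1 = fc1`_9 *: (roots_poly t3 * roots_poly t6)].
Proof.
have [r rE] := closed_field_poly_normal fc1.
have f0 : fc1 != 0 by rewrite -size_poly_eq0 framed_cubic1 F_size.
have l0 : lead_coef fc1 != 0 by rewrite lead_coef_eq0.
have sr : size r = 9.
  by have := F_size; rewrite -framed_cubic1 rE size_scale // size_prod_XsubC => -[].
have ur : uniq r.
  move: F_sep; rewrite -framed_cubic1 rE -mul_polyC separable_mul => /and3P[_].
  by rewrite separable_prod_XsubC.
exists (\row_i r`_i), (\row_i r`_(6 + i)); split.
- move=> i j; rewrite !mxE => /eqP; rewrite nth_uniq ?sr //.
  + by move=> /eqP/val_inj.
  + by rewrite (leq_trans (ltn_ord i)).
  + by rewrite (leq_trans (ltn_ord j)).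
- move=> i j; rewrite !mxE => /eqP; rewrite nth_uniq ?sr ?ltn_add2l //.
  by rewrite eqn_add2l => /eqP/val_inj.
rewrite [LHS]rE lead_coefE framed_cubic1 F_size /=; congr (_ *: _).
rewrite (big_nth 0) sr big_mkord (@big_split_ord _ _ _ 6 3) mulrC.
by congr (_ * _); apply: eq_bigr => i _; rewrite mxE.
Qed.

Lemma exists_link_dom :
  exists z : tgt iota F A (@quadric6 K), link_dom (@quadric3 K) z.
Proof.
have [t6 [t3 [i6 i3 fE]]] := exists_linked_points.
have e0 : fc1`_9 != 0.
  have f0 : fc1 != 0 by rewrite -size_poly_eq0 framed_cubic1 F_size.
  by rewrite -lead_coef_eq0 lead_coefE framed_cubic1 F_size in f0 *.
have r6 i : root fc1 (t6 0 i).
  by rewrite rootE fE hornerZ hornerM roots_poly_lag !mulr0.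
have r3 i : root fc1 (t3 0 i).
  by rewrite rootE fE hornerZ hornerM roots_poly_lag mul0r mulr0.
have Z6 := tgt_coef_predE (tgt_pred1 quadric6_powers i6 r6).
have Z3 := tgt_coef_predE (tgt_pred1 quadric3_powers i3 r3).
exists (exist (fun z => tgt_coef_pred iota F A (@quadric6 K) z) _ Z6); split; first exact: e0.
suff E : cofactor iota F A 3 (1%:M, sym_coefs t6) = sym_coefs t3.
  by rewrite [(val _).1]/= [val _]/= E.
have [fE' _ _] := cofactor_polyE F_cubic (erefl : (4 + 2 + 3 = 9)%N) Z6 e0.
suff cE : cofactor_poly iota F A (1%:M, sym_coefs t6) = roots_poly t3.
  by apply/rowP => j; rewrite !mxE cE.
have R6 : roots_poly (roots_of (sym_coefs t6)) = roots_poly t6.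
  by apply: sym_coefs_inj; rewrite roots_ofK.
have P0 : roots_poly t6 != 0 by rewrite -size_poly_eq0 size_roots_poly.
by apply: (mulIf P0); apply: (scalerI e0); rewrite -fE [RHS]fE' R6.
Qed.

(** Supplies the default point needed to make [cubic_pt] total. *)
Lemma exists_hypersurface_pt : inhabited X.
Proof.
have [t6 [t3 [i6 i3 fE]]] := exists_linked_points.
set x := t6 0 0; pose v := \row_l x ^+ l : 'rV[K]_4.
have Fv : frame_eval iota F A v = 0.
  have <- : fc1.[x] = 0 by rewrite fE hornerZ hornerM roots_poly_lag !mulr0.
  rewrite framed_cubicE; congr (frame_eval _ _ _ _).
  by apply/rowP => l; rewrite !mxE curve1.
have vA : v *m map_mx iota A != 0.
  have UA : map_mx iota A \in unitmx by rewrite map_unitmx.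
  apply/eqP => vA; have /rowP/(_ 0)/eqP : v = 0 by rewrite -[v](mulmxK UA) vA mul0mx.
  by rewrite !mxE expr0 oner_eq0.
split; apply: (exist (fun x => evalp iota F x == 0) (pt_of (v *m map_mx iota A))).
by rewrite (evalp_pt_of iota F_cubic vA) -/(frame_eval iota F A v) Fv.
Qed.
End LinkedPoint.

(** Y1 and Y2 contain open copies of Z1 and Z2, and l1 identifies D1 with D2; a nonempty open set in
    an irreducible space is dense, so one point of D1 makes both domains dense. *)
Lemma birational_linked (k K : fieldType) (iota : {rmorphism k -> K})
    (Y1 Y2 Z1 Z2 : kspace K) (D1 : Z1 -> Prop) (D2 : Z2 -> Prop)
    (l1 : Z1 -> Z2) (l2 : Z2 -> Z1) :
  kaxioms iota Y1 -> kaxioms iota Y2 -> geom_irr Y1 -> geom_irr Y2 ->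
  open_retract Y1 Z1 -> open_retract Y2 Z2 ->
  opens Z1 D1 -> opens Z2 D2 -> morphism_on D1 l1 -> morphism_on D2 l2 ->
  (forall z, D1 z -> D2 (l1 z) /\ l2 (l1 z) = z) ->
  (forall z, D2 z -> D1 (l2 z) /\ l1 (l2 z) = z) ->
  (exists z, D1 z) -> birational Y1 Y2.
Proof.
move=> kY1 kY2 irr1 irr2 [U1 [f1 [g1 [oU1 mf1 mg1 fK1 gK1]]]]
  [U2 [f2 [g2 [oU2 mf2 mg2 fK2 gK2]]]] oD1 oD2 ml1 ml2 lK1 lK2 [z Dz].
have comp (Y Y' Z Z' : kspace K) (U : Y -> Prop) (D : Z -> Prop) (f : Y -> Z)
    (l : Z -> Z') (g : Z' -> Y') : morphism_on U f -> morphism_on D l ->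
    morphism_on (fun=> True) g ->
    morphism_on (fun y => U y /\ D (f y)) (fun y => g (l (f y))).
  move=> mf ml mg; have := morphism_on_comp (morphism_on_comp mf ml) mg.
  by congr morphism_on; apply: pred_ext => y; split=> [[]|].
exists (fun y => U1 y /\ D1 (f1 y)), (fun y => U2 y /\ D2 (f2 y)),
  (fun y => g2 (l1 (f1 y))), (fun y => g1 (l2 (f2 y))); split.
- split.
    apply: (geom_irr_dense kY1 irr1); first exact: (mf1 _ oD1).1.
    by have [Uz fz] := gK1 z; exists (g1 z); rewrite fz.
  apply: (geom_irr_dense kY2 irr2); first exact: (mf2 _ oD2).1.
  by have [Uz fz] := gK2 (l1 z); exists (g2 (l1 z)); rewrite fz; have [] := lK1 z Dz.
- by split; [exact: (comp _ _ _ _ _ _ _ _ _ mf1 ml1 mg2)|exact: (comp _ _ _ _ _ _ _ _ _ mf2 ml2 mg1)].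
- move=> y [Uy Dy]; have [Uz fz] := gK2 (l1 (f1 y)); have [Dl lK] := lK1 _ Dy.
  by rewrite fz lK fK1.
- move=> y [Uy Dy]; have [Uz fz] := gK1 (l2 (f2 y)); have [Dl lK] := lK2 _ Dy.
  by rewrite fz lK fK2.
Qed.

Theorem proposition6p1
  (k : fieldType) (char_k : [pchar k] =i pred0)
  (K : closedFieldType) (iota : {rmorphism k -> K})
  (K_closure : is_algebraic_closure iota)
  (F : {mpoly k[4]}) (F_neq0 : F != 0) (F_cubic : F \is 3.-homog)
  (F_smooth : smooth_hypersurface iota F) :
  stably_birational iota (sym_product (hypersurface iota F) 6)
                         (sym_product (hypersurface iota F) 3).
Proof.
have charK := pchar_ext char_k iota.
have [A A_unit [F_size F_sep]] := exists_frame char_k F_neq0 F_cubic F_smooth.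
have [x_def] := exists_hypersurface_pt F_cubic A_unit F_size F_sep.
have [z Dz] := exists_link_dom F_cubic A_unit F_size F_sep.
(* The residual of z is a point of the model for m = 3 and serves as the default value there. *)
pose d3 := link_map (exist (fun z => tgt_coef_pred iota F A (@quadric3 K) z) _ Dz.2) z.
have kX : kaxioms iota (hypersurface iota F) := subspace_kaxioms _ (proj_space_kaxioms iota 3).
have kS m n : (0 < m)%N ->
    kaxioms iota (prod_space (sym_product (hypersurface iota F) m) (proj_space iota n)).
  move=> m0; apply: prod_space_kaxioms (proj_space_kaxioms iota n).
  exact: sym_product_kaxioms.
have irr m n : (0 < m)%N ->
    geom_irr (prod_space (sym_product (hypersurface iota F) m) (proj_space iota n)).
  move=> m0; apply: (prod_geom_irr (sym_product_kaxioms kX m0)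
    (proj_space_kaxioms iota n) _ (@proj_geom_irr _ _ iota charK n)).
  apply: quot_geom_irr; apply: (power_geom_irr kX) => //.
  exact: (@hypersurface_geom_irr _ _ iota charK F F_neq0 F_cubic F_smooth).
exists 4, (3 + (3 + 4))%N.
apply: (birational_linked (kS 6 4 isT) (kS 3 _ isT) (irr 6 4 isT) (irr 3 _ isT)
  (sym6_model charK F_cubic A_unit x_def z) (sym3_model charK F_cubic A_unit x_def d3)
  (opens_link_dom charK F_cubic (erefl : (4 + 2 + 3 = 9)%N) (@kalg_quadric3 k K iota))
  (opens_link_dom charK F_cubic (erefl : (3 + (4 + 2) = 9)%N) (@kalg_quadric6 k K iota))
  (link_map_morphism charK F_cubic (erefl : (4 + 2 + 3 = 9)%N) _ (@kalg_quadric3 k K iota) d3)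
  (link_map_morphism charK F_cubic (erefl : (3 + (4 + 2) = 9)%N) _ (@kalg_quadric6 k K iota) z)).
- exact: (link_mapK F_cubic (erefl : (4 + 2 + 3 = 9)%N) (erefl : (3 + (4 + 2) = 9)%N) z d3).
- exact: (link_mapK F_cubic (erefl : (3 + (4 + 2) = 9)%N) (erefl : (4 + 2 + 3 = 9)%N) d3 z).
- by exists z.
Qed.
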